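(* Given a graph $G$ on $n$ vertices and a parameter $\phi>0$, there exists a randomized algorithm, whose running time is dominated by computing a polylogarithmic number (in $n$) of maximum flow problems, that either 1. certifies that $\Phi(G)=\Omega(\phi)$ with high probability; or 2. finds a cut $(S,V\setminus S)$ in $G$ whose conductance is $\Phi_G(S,V\setminus S)=O(\phi\log^2 n)$.
   Context: Graphs are undirected and unweighted. $\mathrm{vol}(S)=\sum_{v\in S}\deg_G(v)$; for $\emptyset\ne S\subsetneq V$, $\Phi_G(S,V\setminus S)=\frac{|E(S,V\setminus S)|}{\min(\mathrm{vol}(S),\mathrm{vol}(V\setminus S))}$ and $\Phi(G)=\min_S\Phi_G(S,V\setminus S)$. ''With high probability'' means with probability at least $1-n^{-p}$, where $p$ can be any fixed constant (affecting hidden constants); ''certifies with high probability'' means that the statement output is correct with high probability over the algorithm's random choices. All hidden constants are absolute. *)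

(* Defs.v *)
From HB Require Import structures.
From mathcomp Require Import all_boot all_order all_algebra.
From mathcomp Require Import boolp classical_sets reals exp.
Set Implicit Arguments.
Unset Strict Implicit.
Unset Printing Implicit Defensive.
Import Order.TTheory GRing.Theory Num.Theory.
Local Open Scope ring_scope.

(** * Conductance *)

Section Graphs.
Variables (n : nat) (e : rel 'I_n).

Definition deg (v : 'I_n) : nat := #|[set u : 'I_n | e v u]%SET|.

Definition vol (S : {set 'I_n}) : nat := (\sum_(v in S) deg v)%N.

Definition boundary (S : {set 'I_n}) : nat :=
  #|[set x : 'I_n * 'I_n | [&& x.1 \in S, x.2 \notin S & e x.1 x.2]]%SET|.

Definition is_cut (S : {set 'I_n}) : bool :=
  (S != finset.set0) && (S != [set: 'I_n]%SET).

(* A side of volume 0 has no boundary edge; the quotient 0 / 0 is then 0, so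
   that every disconnected graph, isolated vertices included, has
   conductance 0. *)
Definition cut_conductance (R : realType) (S : {set 'I_n}) : R :=
  (boundary S)%:R / (minn (vol S) (vol (~: S)%SET))%:R.

(* The family of cuts is finite, and nonempty when 1 < n: the infimum is then a
   minimum. *)
Definition conductance (R : realType) : R :=
  inf [set x | exists2 S : {set 'I_n}, is_cut S & x = cut_conductance R S]%classic.

(* Each undirected edge is listed once. *)
Definition edges : seq ('I_n * 'I_n) :=
  [seq x : 'I_n * 'I_n <- enum {: 'I_n * 'I_n} | (x.1 < x.2)%N && e x.1 x.2].

End Graphs.

(** * Maximum flow *)

(* An arc is a triple ((tail, head), capacity); parallel arcs are allowed. *)
Record network := Network {
  nodes : nat;
  source : nat;
  sink : nat;
  arcs : seq (nat * nat * nat)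
}.

Definition wf_network (N : network) : bool :=
  [&& (source N < nodes N)%N, (sink N < nodes N)%N, source N != sink N &
      all (fun a => (a.1.1 < nodes N)%N && (a.1.2 < nodes N)%N) (arcs N)].

Definition arc_nth (N : network) (i : nat) : nat * nat * nat :=
  nth (0, 0, 0)%N (arcs N) i.

Definition outflow (N : network) (f : seq nat) (v : nat) : nat :=
  (\sum_(i < size (arcs N) | (arc_nth N i).1.1 == v) nth 0 f i)%N.

Definition inflow (N : network) (f : seq nat) (v : nat) : nat :=
  (\sum_(i < size (arcs N) | (arc_nth N i).1.2 == v) nth 0 f i)%N.

Definition is_flow (N : network) (f : seq nat) : Prop :=
  [/\ size f = size (arcs N),
      forall i, (i < size (arcs N))%N -> (nth 0 f i <= (arc_nth N i).2)%N
    & forall v, (v < nodes N)%N -> v != source N -> v != sink N ->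
        inflow N f v = outflow N f v].

Definition flow_value (N : network) (f : seq nat) : int :=
  (outflow N f (source N))%:Z - (inflow N f (source N))%:Z.

Definition is_max_flow (N : network) (f : seq nat) : Prop :=
  is_flow N f /\ forall g, is_flow N g -> flow_value N g <= flow_value N f.

(* Nothing is assumed about the answer on an ill-formed network. *)
Definition max_flow_solver (O : network -> seq nat) : Prop :=
  forall N, wf_network N -> is_max_flow N (O N).

Definition bitsize (z : int) : nat := (trunc_log 2 `|z|%N).+1.

(* Length of a binary encoding of a network. *)
Definition network_length (N : network) : nat :=
  (nodes N +
   \sum_(a <- arcs N) (bitsize a.1.1%:Z + bitsize a.1.2%:Z + bitsize a.2%:Z))%N.

(** * Randomized algorithms with a maximum flow subroutine

   Algorithms are programs of an integer random access machine under the
   logarithmic cost criterion: an operation costs the number of bits of its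
   operands and result, and a memory access also the number of bits of the
   address.  (Under unit cost, arithmetic on unboundedly large integers would
   be unrealistically powerful.)  The memory consists of integer arrays, each
   named by a constant of the program.  A program is a finite syntactic object,
   so one and the same program serves all inputs. *)

Inductive binop := OpAdd | OpSub | OpMul | OpDiv | OpLe | OpLePhi.

Inductive expr :=
| Const of int
| Get of nat & expr
| Bin of binop & expr & expr.

Inductive cmd :=
| Skip
| Assign of nat & expr & expr
| Flip of nat & expr
| Seq of cmd & cmd
| If of expr & cmd & cmd
| While of expr & cmd
(* MaxFlow en em es et tl hd cp fl: solve the network with en nodes, em arcs,
   source es and sink et, whose arcs are read in the arrays tl, hd (endpoints)
   and cp (capacities), and write the flow in the array fl; all these integers
   are read in absolute value. *)
| MaxFlow of expr & expr & expr & expr & nat & nat & nat & nat.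

Definition memory := nat -> int -> int.

Definition write (m : memory) (a : nat) (i z : int) : memory :=
  fun b j => if (b == a) && (j == i) then z else m b j.

(* Writes the first k entries of f in cells 0, ..., k - 1 of array a. *)
Definition write_seq (m : memory) (a k : nat) (f : seq nat) : memory :=
  fun b j => if j is Posz i then
    (if (b == a) && (i < k)%N then (nth 0%N f i)%:Z else m b j) else m b j.

Record state := State {
  contents : memory;
  coins : seq bool;  (* the coin flips still to come *)
  time : nat;        (* time spent outside the maximum flow subroutine *)
  calls : seq nat    (* lengths of the networks solved so far *)
}.

Section Semantics.
Variables (R : realType) (phi : R) (O : network -> seq nat).

(* The real parameter is not part of the memory: OpLePhi compares it with the
   rational numbers computed by the program, x / y <= phi being read as
   x <= y * phi. *)
Definition binop_eval (o : binop) (x y : int) : int :=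
  match o with
  | OpAdd => x + y
  | OpSub => x - y
  | OpMul => x * y
  | OpDiv => (x %/ y)%Z
  | OpLe => (nat_of_bool (x <= y))%:Z
  | OpLePhi => (nat_of_bool (x%:~R <= y%:~R * phi))%:Z
  end.

Fixpoint eval (m : memory) (t : expr) : int :=
  match t with
  | Const z => z
  | Get a t1 => m a (eval m t1)
  | Bin o t1 t2 => binop_eval o (eval m t1) (eval m t2)
  end.

Fixpoint cost (m : memory) (t : expr) : nat :=
  (bitsize (eval m t) +
   match t with
   | Const _ => 0
   | Get _ t1 => cost m t1
   | Bin _ t1 t2 => cost m t1 + cost m t2
   end)%N.

Definition read_network (m : memory) (en em es et : expr) (tl hd cp : nat) :
    network :=
  Network `|eval m en|%N `|eval m es|%N `|eval m et|%N
    [seq (`|m tl i%:Z|, `|m hd i%:Z|, `|m cp i%:Z|)%N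
       | i : nat <- iota 0 `|eval m em|%N].

(* There is no rule for flipping a coin once the supply is exhausted: such an
   execution does not terminate. *)
Inductive exec : cmd -> state -> state -> Prop :=
| exec_skip s : exec Skip s s
| exec_set a t1 t2 m r k l :
    exec (Assign a t1 t2) (State m r k l)
      (State (write m a (eval m t1) (eval m t2)) r
             (k + (cost m t1 + cost m t2).+1) l)
| exec_flip a t b m r k l :
    exec (Flip a t) (State m (b :: r) k l)
      (State (write m a (eval m t) (nat_of_bool b)%:Z) r (k + (cost m t).+1) l)
| exec_seq c1 c2 s1 s2 s3 :
    exec c1 s1 s2 -> exec c2 s2 s3 -> exec (Seq c1 c2) s1 s3
| exec_if t c1 c2 m r k l s :
    exec (if eval m t != 0 then c1 else c2)
         (State m r (k + (cost m t).+1) l) s ->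
    exec (If t c1 c2) (State m r k l) s
| exec_while_false t c m r k l :
    eval m t = 0 ->
    exec (While t c) (State m r k l) (State m r (k + (cost m t).+1) l)
| exec_while_true t c m r k l s1 s2 :
    eval m t <> 0 ->
    exec c (State m r (k + (cost m t).+1) l) s1 ->
    exec (While t c) s1 s2 ->
    exec (While t c) (State m r k l) s2
| exec_maxflow en em es et tl hd cp fl m r k l :
    let N := read_network m en em es et tl hd cp in
    exec (MaxFlow en em es et tl hd cp fl) (State m r k l)
      (State (write_seq m fl `|eval m em|%N (O N)) r
             (k + (cost m en + cost m em + cost m es + cost m et).+1)
             (rcons l (network_length N))).

End Semantics.

(* Input: the numbers of vertices and of edges in cells 0 and 1 of array 0, the
   endpoints of the edges in arrays 1 and 2; all other cells contain 0. *)
Definition input_mem (n : nat) (e : rel 'I_n) : memory := fun a z =>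
  match a, z with
  | 0%N, Posz 0%N => n%:Z
  | 0%N, Posz 1%N => (size (edges e))%:Z
  | 1%N, Posz i => (nth 0%N [seq nat_of_ord x.1 | x <- edges e] i)%:Z
  | 2%N, Posz i => (nth 0%N [seq nat_of_ord x.2 | x <- edges e] i)%:Z
  | _, _ => 0
  end.

Definition init (n : nat) (e : rel 'I_n) (w : seq bool) : state :=
  State (input_mem e) w 0 [::].

Inductive answer (n : nat) :=
| Expander
| Cut of {set 'I_n}.

(* Output: a nonzero cell 0 of array 3 announces an expander; otherwise array 4
   is the indicator of one side of a cut. *)
Definition output (n : nat) (s : state) : answer n :=
  if contents s 3%N 0 != 0 then Expander n
  else Cut [set v : 'I_n | contents s 4%N (nat_of_ord v)%:Z != 0]%SET.

Definition correct_expander (R : realType) (n : nat) (e : rel 'I_n) (x : R)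
    (A : answer n) : Prop :=
  if A is Expander then x <= conductance e R else True.

Definition correct_cut (R : realType) (n : nat) (e : rel 'I_n) (x : R)
    (A : answer n) : Prop :=
  if A is Cut U then is_cut U /\ cut_conductance e R U <= x else True.

(* Probability of E for L independent fair coin flips. *)
Definition coin_prob (R : realType) (L : nat) (E : L.-tuple bool -> Prop) : R :=
  #|[set w : L.-tuple bool | `[< E w >]]%SET|%:R / 2 ^+ L.

(* Main.v *)
(* The program plays the cut-matching game of Khandekar, Rao and Vazirani on the
   [N = 2 m] darts (oriented edges) of the graph, so that volumes become numbers
   of darts.  Let [l] be about [log2 n].  In each of [T = B l^2] rounds, random
   signs on the darts are averaged along the matchings found so far, the darts are
   divided at the median of this projection, and a flow of congestion about
   [c = 1 / (l^2 phi)] is sought from one half to the other.  If there is none, the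
   nodes reachable in the residual network, which a second maximum flow computes,
   form a cut of conductance at most [1 / c = O(phi log^2 n)].  Otherwise,
   eliminating the vertices one after the other turns the flow into paths, that is,
   into a perfect matching of the darts which crosses any cut [U] at most
   [4 c |dU|] times.

   The potential is the squared distance from the averaging walk along the
   matchings to the uniform distribution.  Projections being subgaussian, a median
   cut separates the darts well enough to decrease it in expectation by a factor
   [1 - Omega(1 / log n)].  After [T] rounds it is at most [1 / (4 N^2)], except with
   probability [n^-p]; then half of the mass of the smaller side of any cut [U] has
   left it, which forces [T c |dU| = Omega(min vol)] and conductance [Omega(phi)]. *)
Require Import Defs.
From HB Require Import structures.
From mathcomp Require Import all_boot all_order all_algebra.
From mathcomp Require Import boolp classical_sets reals sequences exp.
From mathcomp Require Import zify ring lra.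
Set Implicit Arguments.
Unset Strict Implicit.
Unset Printing Implicit Defensive.
Import Order.TTheory GRing.Theory Num.Theory.
Local Open Scope ring_scope.

(** * Time-bounded program logic *)

(** The matchings depend on the coins through an arbitrary solver, so the decrease of the potential
    is conditional: the game is conditioned on the coins of its first round, and the bound for the
    later rounds is integrated over them. The final potential [F w] then bounds the probability of
    error by Markov's inequality. Cuts need no luck; only the expander answer can err.

    Two obstacles shape the program. It pays for every bit, and projections are kept integral by a
    factor [2 ^ t], so a word has about [T] bits. And the paths of a flow may be too long to be
    written down: flow entering a vertex is spliced with flow leaving it, vertices of small degree
    first, which keeps the work near-linear. As [phi] can only be compared with rationals, [c] is
    found by doubling.

    Constants: with [L] about [log2 n], the deviation parameter [s = 72 * L] makes each deviation
    have probability at most [2 * n ^ -9]; a round then has factor [1 - 1 / (288 * L)], and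
    [B >= 288 * (8 + p)] brings the expected potential below [n ^ -p / (4 * N ^ 2)]. Time is the
    size of the graph times [T ^ 2] steps on words of about [T] bits, hence the sixth power of the
    logarithm. *)

Lemma bitsize_le (z : int) (b : nat) :
  (0 < b)%N -> (bitsize z <= b)%N = (`|z| < 2 ^ b)%N.
Proof.
move=> b0; rewrite /bitsize; apply/idP/idP => [h|h].
  exact: leq_trans (trunc_log_ltn _ (isT : (1 < 2)%N)) (leq_pexp2l _ h).
case: (posnP `|z|%N) => [->|z0]; first by rewrite trunc_log0.
by rewrite -(ltn_exp2l _ _ (isT : (1 < 2)%N)) (leq_ltn_trans (trunc_logP _ _)).
Qed.

Lemma bitsizeP (z : int) : (`|z| < 2 ^ bitsize z)%N.
Proof. by rewrite -bitsize_le. Qed.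

Section BinopBits.
Variables (R : realType) (phi : R).

(** Both powers of two are at least 2, so their product exceeds the absolute value of the result of
    every operation. Additivity of the sizes is what allows costs to be bounded by the size of an
    expression. *)
Lemma bitsize_binop (o : binop) (x y : int) :
  (bitsize (binop_eval phi o x y) <= bitsize x + bitsize y)%N.
Proof.
have hx := bitsizeP x; have hy := bitsizeP y.
have [ex ey] : (2 <= 2 ^ bitsize x)%N /\ (2 <= 2 ^ bitsize y)%N.
  by split; rewrite (@leq_pexp2l 2 1).
rewrite bitsize_le ?addn_gt0 // expnD.
move: (2 ^ _)%N (2 ^ _)%N hx hy ex ey => X Y hx hy ex ey.
case: o => /=; [nia|nia|nia| | |].
- by apply: leq_ltn_trans (lez_div _ _) _; nia.
- by case: (_ <= _) => /=; nia.
- by case: (_ <= _) => /=; nia.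
Qed.
End BinopBits.

Fixpoint esize (t : expr) : nat :=
  match t with
  | Const _ => 1
  | Get _ t1 => (esize t1).+1
  | Bin _ t1 t2 => (esize t1 + esize t2).+1
  end.

Fixpoint small_consts (t : expr) : bool :=
  match t with
  | Const z => (`|z| <= 7)%N
  | Get _ t1 => small_consts t1
  | Bin _ t1 t2 => small_consts t1 && small_consts t2
  end.

(** Constants up to 7 fit in the three bits granted by [3 <= b]; the size bound 40 becomes the
    factor [40 ^ 2 = 1600] of [simple_cost]. *)
Definition simple (t : expr) : bool := small_consts t && (esize t <= 40)%N.

Fixpoint reads (t : expr) : seq nat :=
  match t with
  | Const _ => [::]
  | Get a t1 => a :: reads t1
  | Bin _ t1 t2 => reads t1 ++ reads t2
  end.

Fixpoint mods (c : cmd) : seq nat :=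
  match c with
  | Skip => [::]
  | Assign a _ _ => [:: a]
  | Flip a _ => [:: a]
  | Seq c1 c2 => mods c1 ++ mods c2
  | If _ c1 c2 => mods c1 ++ mods c2
  | While _ c1 => mods c1
  | MaxFlow _ _ _ _ _ _ _ fl => [:: fl]
  end.

Definition agree_off (A : seq nat) (m m' : memory) : Prop :=
  forall a, a \notin A -> m' a =1 m a.

Lemma agree_off_trans A B m1 m2 m3 :
  agree_off A m1 m2 -> agree_off B m2 m3 -> agree_off (A ++ B) m1 m3.
Proof.
by move=> h1 h2 a; rewrite mem_cat negb_or => /andP[hA hB] z; rewrite h2 // h1.
Qed.

Lemma agree_off_sub (A B : seq nat) m m' :
  {subset A <= B} -> agree_off A m m' -> agree_off B m m'.
Proof. by move=> sAB h a hB; apply: h; apply: contra hB; apply: sAB. Qed.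

Lemma agree_off_write a i z m : agree_off [:: a] m (write m a i z).
Proof. by move=> x; rewrite inE => /negPf xa j; rewrite /write xa. Qed.

Section Logic.
Variables (R : realType) (phi : R) (O : network -> seq nat) (b : nat).
Hypothesis b_ge : (3 <= b)%N.

Definition bounded (m : memory) : Prop := forall a i, (bitsize (m a i) <= b)%N.

(** Pays for one assignment: its two simple expressions cost at most [1600 * b] each, and the rest
    absorbs the additive constant. *)
Definition word_cost : nat := 4000 * b.

Lemma eval_agree (A : seq nat) (t : expr) (m m' : memory) :
  agree_off A m m' -> all (fun a => a \notin A) (reads t) ->
  eval phi m' t = eval phi m t.
Proof.
move=> h; elim: t => [z|a t IH|o t1 IH1 t2 IH2] //=.
  by case/andP=> ha /IH->; rewrite h.
by rewrite all_cat => /andP[/IH1-> /IH2->].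
Qed.

(** The value at a node may have [b] bits for each node of its subtree, so summing over all nodes
    gives a cost quadratic in the size. *)
Lemma bounded_eval m t : bounded m -> small_consts t ->
  (bitsize (eval phi m t) <= b * esize t)%N /\ (cost phi m t <= b * esize t ^ 2)%N.
Proof.
move=> hm; elim: t => [z|a t IH|o t1 IH1 t2 IH2] /=.
- move=> hz; rewrite addn0 !muln1; suff h : (bitsize z <= b)%N by [].
  rewrite bitsize_le; last by lia.
  by apply: leq_ltn_trans hz _; apply: leq_trans (leq_pexp2l _ b_ge).
- move=> /IH[h1 h2]; have := hm a (eval phi m t); move: (esize t) h1 h2 => s; nia.
- case/andP=> /IH1[h1 h2] /IH2[h3 h4].
  have := bitsize_binop phi o (eval phi m t1) (eval phi m t2).
  by move: (esize t1) (esize t2) h1 h2 h3 h4 => s1 s2; nia.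
Qed.

Lemma simple_cost m t : bounded m -> simple t -> (cost phi m t <= 1600 * b)%N.
Proof.
move=> hm /andP[hs ht]; have [_ h] := bounded_eval hm hs.
apply: leq_trans h _; rewrite mulnC leq_mul2r; apply/orP; right.
by apply: (@leq_trans (40 ^ 2)%N) => //; rewrite leq_exp2r.
Qed.

Lemma bounded_write m a i z : bounded m -> (`|z| < 2 ^ b)%N -> bounded (write m a i z).
Proof.
move=> hm hz a' i'; rewrite /write; case: ifP => // _.
by rewrite bitsize_le //; lia.
Qed.

(* From memory [m], [c] consumes exactly the coins [w], runs for at most [t]
   elementary steps, and reaches a memory and a list of new calls satisfying
   [Q], whatever the remaining coins, the clock and the past calls. *)
Definition triple (c : cmd) (m : memory) (w : seq bool) (t : nat)
    (Q : memory -> seq nat -> Prop) : Prop :=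
  bounded m -> exists m' ls k0,
    [/\ bounded m', (k0 <= t * word_cost)%N, Q m' ls &
      forall r k l, exec phi O c (State m (w ++ r) k l) (State m' r (k + k0)%N (l ++ ls))].

Lemma triple_conseq c m w t t' (Q Q' : memory -> seq nat -> Prop) :
  triple c m w t Q -> (t <= t')%N ->
  (forall m' ls, bounded m' -> Q m' ls -> Q' m' ls) -> triple c m w t' Q'.
Proof.
move=> h tt hQ hm; have [m' [ls [k0 [h1 h2 h3 h4]]]] := h hm.
exists m', ls, k0; split => //; last by exact: hQ.
by apply: leq_trans h2 _; rewrite leq_mul2r tt orbT.
Qed.

Lemma triple_bounded c m w t Q : (bounded m -> triple c m w t Q) -> triple c m w t Q.
Proof. by move=> h hm; exact: h. Qed.

(** [mods] is syntactic, so that what a command preserves is later decided by computation on array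
    names. *)
Lemma exec_agree c s s' : exec phi O c s s' -> agree_off (mods c) (contents s) (contents s').
Proof.
elim=> //=.
- by move=> *; exact: agree_off_write.
- by move=> *; exact: agree_off_write.
- by move=> c1 c2 s1 s2 s3 _ h1 _ h2; exact: agree_off_trans h1 h2.
- move=> t c1 c2 m r k l s0 _ /=; case: ifP => _; apply: agree_off_sub => x hx;
    by rewrite mem_cat hx ?orbT.
- move=> t c0 m r k l s1 s2 _ _ h1 _ h2.
  by move=> a ha z; rewrite h2 // h1.
- move=> en em es et tl hd cp fl m r k l a; rewrite inE => /negPf ha [] // i.
  by rewrite /= ha.
Qed.

Lemma triple_frame c m w t Q : triple c m w t Q ->
  triple c m w t (fun m' ls => agree_off (mods c) m m' /\ Q m' ls).
Proof.
move=> h hm; have [m' [ls [k0 [h1 h2 h3 h4]]]] := h hm.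
exists m', ls, k0; split => //; split=> //.
exact: (exec_agree (h4 [::] 0%N [::])).
Qed.

Lemma triple_seq c1 c2 m w1 w2 t1 t2 Q :
  triple c1 m w1 t1 (fun m1 l1 => triple c2 m1 w2 t2 (fun m2 l2 => Q m2 (l1 ++ l2))) ->
  triple (Seq c1 c2) m (w1 ++ w2) (t1 + t2) Q.
Proof.
move=> h hm; have [m1 [l1 [k1 [hm1 hk1 h1 e1]]]] := h hm.
have [m2 [l2 [k2 [hm2 hk2 h2 e2]]]] := h1 hm1.
exists m2, (l1 ++ l2), (k1 + k2)%N; split=> //.
  by rewrite mulnDl leq_add.
move=> r k l; apply: exec_seq; first by rewrite -catA; exact: e1.
by rewrite addnA catA; exact: e2.
Qed.

Lemma triple_flip a e m x t (Q : memory -> seq nat -> Prop) :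
  (0 < t)%N -> simple e ->
  Q (write m a (eval phi m e) (nat_of_bool x)%:Z) [::] ->
  triple (Flip a e) m [:: x] t Q.
Proof.
move=> t0 he hQ hm.
exists (write m a (eval phi m e) (nat_of_bool x)%:Z), [::], (cost phi m e).+1; split => //.
- apply: bounded_write => //; apply: (@leq_ltn_trans 1); first by case: x {hQ}.
  by rewrite -{1}(expn0 2) ltn_exp2l //; lia.
- have h := simple_cost hm he; apply: leq_trans (leq_pmull _ t0); rewrite /word_cost; lia.
- by move=> r k l; rewrite cats0; exact: exec_flip.
Qed.

Definition ptriple c m t (Q : memory -> Prop) : Prop :=
  triple c m [::] t (fun m' ls => ls = [::] /\ Q m').

Lemma ptriple_triple c m t Q (Q' : memory -> seq nat -> Prop) :
  ptriple c m t Q -> (forall m', bounded m' -> Q m' -> Q' m' [::]) ->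
  triple c m [::] t Q'.
Proof.
move=> h hQ; apply: triple_conseq h (leqnn _) _ => m' ls hm [-> h].
exact: hQ.
Qed.

Lemma ptriple_conseq c m t t' (Q Q' : memory -> Prop) :
  ptriple c m t Q -> (t <= t')%N -> (forall m', bounded m' -> Q m' -> Q' m') ->
  ptriple c m t' Q'.
Proof.
move=> h tt hQ; apply: triple_conseq h tt _ => m' ls hm [-> h].
by split=> //; exact: hQ.
Qed.

Lemma ptriple_frame c m t Q : ptriple c m t Q ->
  ptriple c m t (fun m' => agree_off (mods c) m m' /\ Q m').
Proof.
move=> /triple_frame h; apply: triple_conseq h (leqnn _) _.
by move=> m' ls _ [h1 [h2 h3]].
Qed.

Lemma ptriple_skip m t (Q : memory -> Prop) : Q m -> ptriple Skip m t Q.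
Proof.
move=> h hm; exists m, [::], 0%N; split=> // r k l.
by rewrite addn0 cats0; exact: exec_skip.
Qed.

Lemma ptriple_assign a e1 e2 m t (Q : memory -> Prop) :
  (0 < t)%N -> simple e1 -> simple e2 -> (`|eval phi m e2| < 2 ^ b)%N ->
  Q (write m a (eval phi m e1) (eval phi m e2)) ->
  ptriple (Assign a e1 e2) m t Q.
Proof.
move=> t0 s1 s2 hz hQ hm.
exists (write m a (eval phi m e1) (eval phi m e2)), [::],
  (cost phi m e1 + cost phi m e2).+1; split => //.
- exact: bounded_write.
- have h1 := simple_cost hm s1; have h2 := simple_cost hm s2.
  by apply: leq_trans (leq_pmull _ t0); rewrite /word_cost; lia.
- by move=> r k l; rewrite cats0; exact: exec_set.
Qed.

Lemma ptriple_seq c1 c2 m t1 t2 Q :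
  ptriple c1 m t1 (fun m1 => ptriple c2 m1 t2 Q) -> ptriple (Seq c1 c2) m (t1 + t2) Q.
Proof.
move=> h; apply: (@triple_seq _ _ _ [::] [::]).
by apply: triple_conseq h (leqnn _) _ => m' ls _ [-> h].
Qed.

(* The agreement hypotheses let the second command be analysed knowing which
   arrays the first one left untouched. *)
Lemma ptriple_seqf c1 c2 m t1 t2 t (Q1 Q : memory -> Prop) :
  ptriple c1 m t1 Q1 -> (t1 + t2 <= t)%N ->
  (forall m1, bounded m1 -> agree_off (mods c1) m m1 -> Q1 m1 -> ptriple c2 m1 t2 Q) ->
  ptriple (Seq c1 c2) m t Q.
Proof.
move=> /ptriple_frame h1 ht h2.
apply: (@ptriple_conseq _ _ (t1 + t2)%N _ Q) => //.
apply: ptriple_seq; apply: ptriple_conseq h1 (leqnn _) _ => m1 hm1 [h3 h4].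
exact: h2.
Qed.

Lemma triple_pseqf c1 c2 m w t1 t2 t (Q1 : memory -> Prop) Q : ptriple c1 m t1 Q1 -> (t1 + t2 <= t)%N ->
  (forall m1, bounded m1 -> agree_off (mods c1) m m1 -> Q1 m1 -> triple c2 m1 w t2 Q) ->
  triple (Seq c1 c2) m w t Q.
Proof.
move=> /ptriple_frame h1 ht h2; apply: (triple_conseq _ ht) => [|m' ls _]; last exact.
rewrite -[w]cat0s; apply/triple_seq/(ptriple_triple h1) => m1 hm1 [h3 h4] /=; exact: h2.
Qed.

Lemma ptriple_aseq a e1 e2 c m t (Q : memory -> Prop) :
  (0 < t)%N -> simple e1 -> simple e2 -> (`|eval phi m e2| < 2 ^ b)%N ->
  ptriple c (write m a (eval phi m e1) (eval phi m e2)) t.-1 Q ->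
  ptriple (Seq (Assign a e1 e2) c) m t Q.
Proof.
move=> t0 s1 s2 hz hQ; rewrite -(prednK t0) -add1n.
exact/ptriple_seq/ptriple_assign.
Qed.

Lemma ptriple_if e c1 c2 m t (Q : memory -> Prop) :
  (0 < t)%N -> simple e ->
  (eval phi m e != 0 -> ptriple c1 m t.-1 Q) ->
  (eval phi m e = 0 -> ptriple c2 m t.-1 Q) ->
  ptriple (If e c1 c2) m t Q.
Proof.
move=> t0 se h1 h2 hm.
have hT : ptriple (if eval phi m e != 0 then c1 else c2) m t.-1 Q.
  by case: ifPn => [/h1|/negPn/eqP/h2]; exact.
have [m' [ls [k0 [hb hk hq he]]]] := hT hm.
exists m', ls, ((cost phi m e).+1 + k0)%N; split => //.
  rewrite -(prednK t0) mulSn leq_add //.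
  by have := simple_cost hm se; rewrite /word_cost; lia.
by move=> r k l; apply: exec_if; rewrite addnA; exact: he.
Qed.

Lemma triple_if e c1 c2 m w t (Q : memory -> seq nat -> Prop) :
  (0 < t)%N -> simple e ->
  (eval phi m e != 0 -> triple c1 m w t.-1 Q) ->
  (eval phi m e = 0 -> triple c2 m w t.-1 Q) ->
  triple (If e c1 c2) m w t Q.
Proof.
move=> t0 se h1 h2 hm.
have hT : triple (if eval phi m e != 0 then c1 else c2) m w t.-1 Q.
  by case: ifPn => [/h1|/negPn/eqP/h2]; exact.
have [m' [ls [k0 [hb hk hq he]]]] := hT hm.
exists m', ls, ((cost phi m e).+1 + k0)%N; split => //.
  rewrite -(prednK t0) mulSn leq_add //.
  by have := simple_cost hm se; rewrite /word_cost; lia.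
by move=> r k l; apply: exec_if; rewrite addnA; exact: he.
Qed.

(* [B] is a budget of steps which every iteration must decrease by at least
   its own cost: it proves termination and the time bound at once. *)
Lemma ptriple_while e c (Inv : nat -> memory -> Prop) (Q : memory -> Prop) m B t :
  simple e -> Inv B m -> (B < t)%N ->
  (forall B m, bounded m -> Inv B m -> eval phi m e != 0 ->
     exists tb B', (tb + B' < B)%N /\ ptriple c m tb (Inv B')) ->
  (forall B m, bounded m -> Inv B m -> eval phi m e = 0 -> Q m) ->
  ptriple (While e c) m t Q.
Proof.
move=> se hI ht hbody hend.
apply: (@ptriple_conseq _ _ B.+1 _ Q) => //.
elim/ltn_ind: B m hI {ht} => B IH m hI hm.
have hc := simple_cost hm se.
case: (eqVneq (eval phi m e) 0) => he.
  exists m, [::], (cost phi m e).+1; split=> //.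
  - by rewrite /word_cost; nia.
  - by split=> //; exact: hend hm hI he.
  - by move=> r k l; rewrite cats0; exact: exec_while_false.
have [tb [B' [hB hb]]] := hbody B m hm hI he.
have [m1 [l1 [k1 [hm1 hk1 [-> h1] e1]]]] := hb hm.
have [|m2 [l2 [k2 [hm2 hk2 [-> h2] e2]]]] := IH B' _ m1 h1 hm1; first by lia.
exists m2, [::], ((cost phi m e).+1 + k1 + k2)%N; split=> //.
  apply: (@leq_trans ((1 + tb + B'.+1) * word_cost)).
    rewrite !mulnDl; apply: leq_add => //; apply: leq_add => //.
    by rewrite /word_cost; lia.
  by rewrite leq_mul2r; apply/orP; right; lia.
move=> r k l; rewrite cats0; apply: exec_while_true; first exact/eqP.
  exact: e1.
by rewrite cats0 !addnA -[X in State m2 _ _ X](cats0 l); exact: e2.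
Qed.

Definition V (a : nat) : expr := Get a (Const 0).
Definition C (z : int) : expr := Const z.
Definition for_loop (i : nat) (K : expr) (c : cmd) : cmd :=
  Seq (Assign i (C 0) (C 0))
    (While (Bin OpLe (Bin OpAdd (V i) (C 1)) K)
       (Seq c (Assign i (C 0) (Bin OpAdd (V i) (C 1))))).

(** Amortised rule: the iterations draw unequal amounts from one budget [B], as in a pass where only
    some vertices are eliminated. The term [3 * N] pays for the test and the increment of each
    iteration. *)
Lemma ptriple_for_budget (i : nat) K c (Inv : nat -> nat -> memory -> Prop) (Q : memory -> Prop)
    m0 (N B t : nat) :
  i \notin mods c -> all (fun a => a \notin i :: mods c) (reads K) ->
  small_consts K && (esize K <= 20)%N ->
  eval phi m0 K = N%:Z -> (N < 2 ^ b)%N ->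
  Inv 0%N B (write m0 i 0 0) -> (3 * N + B + 2 <= t)%N ->
  (forall k B m, (k < N)%N -> bounded m -> Inv k B m -> m i 0 = k%:Z ->
     agree_off (i :: mods c) m0 m ->
     exists tb B', (tb + B' <= B)%N /\
       ptriple c m tb (fun m' => Inv k.+1 B' (write m' i 0 k.+1%:Z))) ->
  (forall B m, Inv N B m -> m i 0 = N%:Z -> agree_off (i :: mods c) m0 m -> Q m) ->
  ptriple (for_loop i K c) m0 t Q.
Proof.
move=> ic rK /andP[sK1 sK2] eK hN hI ht hbody hend.
have t0 : (0 < t)%N by lia.
rewrite /for_loop; apply: ptriple_aseq => //=; first by rewrite expn_gt0.
pose J (B' : nat) (m : memory) := exists k B1, [/\ (k <= N)%N, Inv k B1 m, m i 0 = k%:Z,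
  agree_off (i :: mods c) m0 m & B' = ((N - k) * 3 + B1)%N].
apply: (@ptriple_while _ _ J _ _ (N * 3 + B)).
- by rewrite /simple /= sK1 /=; lia.
- exists 0%N, B; split => //; last by rewrite subn0.
    by rewrite /write !eqxx.
  by move=> a; rewrite inE negb_or => /andP[/negPf ha _] z; rewrite /write ha.
- by lia.
- move=> B' m hm [k [B1 [kN hI' mi ha eB]]] /=.
  rewrite mi (eval_agree ha rK) eK; case: (ltnP k N) => kN'; last first.
    by have -> : (k%:Z + 1 <= N%:Z) = false by lia.
  move=> _; have [tb [B2 [h1 h2]]] := hbody k B1 m kN' hm hI' mi ha.
  exists (tb + 1)%N, ((N - k.+1) * 3 + B2)%N; split; first by lia.
  apply: (@ptriple_seqf _ _ _ tb 1%N) => //; first exact: h2.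
  move=> m1 hm1 ha1 hI1; have mi1 : m1 i 0 = k%:Z by rewrite ha1.
  apply: ptriple_assign => //=; rewrite mi1.
    by lia.
  have -> : (k%:Z + 1) = k.+1%:Z by lia.
  exists k.+1, B2; split => //; first by rewrite /write !eqxx.
  move=> a; rewrite inE negb_or => /andP[/negPf h3 h4] z.
  by rewrite /write h3 /= ha1 // ha // inE negb_or h3.
- move=> B' m hm [k [B1 [kN hI' mi ha eB]]] /=.
  rewrite mi (eval_agree ha rK) eK => h.
  have kN' : k = N by move: h; case: (ltnP k N) => kN' ; lia.
  by rewrite kN' in hI' mi; exact: hend hI' mi ha.
Qed.

Lemma ptriple_for (i : nat) K c (Inv : nat -> memory -> Prop) (Q : memory -> Prop)
    m0 (N tb t : nat) :
  i \notin mods c -> all (fun a => a \notin i :: mods c) (reads K) ->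
  small_consts K && (esize K <= 20)%N ->
  eval phi m0 K = N%:Z -> (N < 2 ^ b)%N ->
  Inv 0%N (write m0 i 0 0) -> (N * (tb + 3) + 2 <= t)%N ->
  (forall k m, (k < N)%N -> bounded m -> Inv k m -> m i 0 = k%:Z ->
     agree_off (i :: mods c) m0 m ->
     ptriple c m tb (fun m' => Inv k.+1 (write m' i 0 k.+1%:Z))) ->
  (forall m, Inv N m -> m i 0 = N%:Z -> agree_off (i :: mods c) m0 m -> Q m) ->
  ptriple (for_loop i K c) m0 t Q.
Proof.
move=> ic rK sK eK hN hI ht hbody hend.
apply: (@ptriple_for_budget i K c
  (fun k B m => Inv k m /\ B = ((N - k) * tb)%N) _ m0 N (N * tb)%N) => //.
- by rewrite subn0.
- by lia.
- move=> k B m kN hm [hI' ->] mi ha.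
  exists tb, ((N - k.+1) * tb)%N; split; first by nia.
  by apply: ptriple_conseq (hbody _ _ kN hm hI' mi ha) (leqnn _) _.
- by move=> B m [h _]; exact: hend.
Qed.

Definition fill (i : nat) (K : expr) (a : nat) (off e : expr) : cmd :=
  for_loop i K (Assign a (Bin OpAdd off (V i)) e).

Lemma ptriple_fill (i : nat) K (a : nat) off e (m0 : memory) (N x t : nat) (v : nat -> int)
    (Q : memory -> Prop) :
  i != a -> all (fun y => y \notin [:: i; a]) (reads K) ->
  all (fun y => y \notin [:: i; a]) (reads off) ->
  small_consts K && (esize K <= 20)%N -> small_consts off && (esize off <= 20)%N ->
  simple e ->
  eval phi m0 K = N%:Z -> eval phi m0 off = x%:Z -> (N < 2 ^ b)%N ->
  (forall k m, (k < N)%N -> m i 0 = k%:Z -> agree_off [:: i; a] m0 m ->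
     eval phi m e = v k) ->
  (forall k, (k < N)%N -> (`|v k| < 2 ^ b)%N) ->
  (N * 4 + 2 <= t)%N ->
  (forall m, m i 0 = N%:Z -> agree_off [:: i; a] m0 m ->
     (forall k, (k < N)%N -> m a (x + k)%N%:Z = v k) ->
     (forall z, (z < x%:Z) || ((x + N)%N%:Z <= z) -> m a z = m0 a z) ->
     Q m) ->
  ptriple (fill i K a off e) m0 t Q.
Proof.
move=> ia rK ro sK so se eK eo hN hv hv2 ht hQ.
have ai : (a == i) = false by rewrite eq_sym; exact: negPf.
apply: (@ptriple_for _ _ _ (fun n m =>
   (forall k, (k < n)%N -> m a (x + k)%N%:Z = v k) /\
   (forall z, (z < x%:Z) || ((x + n)%N%:Z <= z) -> m a z = m0 a z))
   _ m0 N 1%N) => //.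
- by rewrite /= inE.
- by split=> // z _; rewrite /write ai.
- move=> k m kN hm [h1 h2] mi ha.
  have eo' : eval phi m off = x%:Z by rewrite (eval_agree ha).
  have ee : eval phi m e = v k by exact: hv.
  apply: ptriple_assign => //.
  + by case/andP: so => so1 so2; rewrite /simple /= so1 /=; lia.
  + by rewrite ee; exact: hv2.
  rewrite /= eo' mi ee /write eqxx ai /=; split=> [k0|z] hk.
    case: (eqVneq k0 k) => [->|nk]; first by rewrite eqxx.
    by case: eqP => [|_]; [lia|rewrite h1 //; lia].
  by case: eqP => [|_]; [lia|rewrite h2 //; lia].
- by move=> m [h1 h2] mi ha; exact: hQ.
Qed.

Lemma triple_while_false e c m t Q : (0 < t)%N -> simple e ->
  eval phi m e = 0 -> Q m [::] -> triple (While e c) m [::] t Q.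
Proof.
move=> t0 se he hQ hm; exists m, [::], (cost phi m e).+1; split=> //.
  have hc := simple_cost hm se.
  by apply: leq_trans (leq_pmull _ t0); rewrite /word_cost; lia.
by move=> r k l; rewrite cats0; exact: exec_while_false.
Qed.

Lemma triple_while_true e c m w1 w2 t1 t2 Q : simple e -> eval phi m e != 0 ->
  triple c m w1 t1 (fun m1 l1 => triple (While e c) m1 w2 t2 (fun m2 l2 => Q m2 (l1 ++ l2))) ->
  triple (While e c) m (w1 ++ w2) (t1 + t2).+1 Q.
Proof.
move=> se he h hm; have hc := simple_cost hm se.
have [m1 [l1 [k1 [hm1 hk1 h1 e1]]]] := h hm.
have [m2 [l2 [k2 [hm2 hk2 h2 e2]]]] := h1 hm1.
exists m2, (l1 ++ l2), ((cost phi m e).+1 + k1 + k2)%N; split=> //.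
  rewrite -[(t1 + t2).+1]/(1 + t1 + t2)%N !mulnDl.
  by rewrite leq_add // leq_add // /word_cost; lia.
move=> r k l; apply: exec_while_true; first exact/eqP.
  by rewrite -catA; exact: e1.
by rewrite !addnA catA; exact: e2.
Qed.

(** Iteration [k] consumes exactly coin [k], which the coin-free loop rules cannot express. *)
Lemma triple_for_coins (i : nat) K c (Inv : nat -> memory -> Prop)
    (Q : memory -> Prop) m0 (r : seq bool) (tb t : nat) :
  i \notin mods c -> all (fun a => a \notin i :: mods c) (reads K) ->
  small_consts K && (esize K <= 20)%N ->
  eval phi m0 K = (size r)%:Z -> (size r < 2 ^ b)%N ->
  Inv 0%N (write m0 i 0 0) -> (size r * (tb + 2) + 2 <= t)%N ->
  (forall k m, (k < size r)%N -> bounded m -> Inv k m -> m i 0 = k%:Z ->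
     agree_off (i :: mods c) m0 m ->
     triple c m [:: nth false r k] tb
       (fun m' ls => ls = [::] /\ Inv k.+1 (write m' i 0 k.+1%:Z))) ->
  (forall m, Inv (size r) m -> agree_off (i :: mods c) m0 m -> Q m) ->
  triple (for_loop i K c) m0 r t (fun m ls => ls = [::] /\ Q m).
Proof.
move=> ic rK /andP[sK1 sK2] eK hN hI ht hbody hend.
set N := size r in eK hN ht hbody hend *.
set e := Bin OpLe (Bin OpAdd (V i) (C 1)) K.
set c' := Seq c (Assign i (C 0) (Bin OpAdd (V i) (C 1))).
(* Induction on the number [d] of iterations left, the coins still to come being [drop k r]. *)
have loop d : forall k m, (k + d)%N = N -> Inv k m -> m i 0 = k%:Z ->
    agree_off (i :: mods c) m0 m ->
    triple (While e c') m (drop k r) (d * (tb + 2) + 1) (fun m ls => ls = [::] /\ Q m).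
  elim: d => [|d IH] k m kd hk mi ha.
    rewrite drop_oversize; last by rewrite -/N; lia.
    apply: triple_while_false => //; first by rewrite /simple /= sK1 /=; lia.
      by rewrite /= mi (eval_agree ha rK) eK; case: lerP => //; lia.
    by split=> //; apply: hend => //; rewrite -(_ : k = N) //; lia.
  have kN : (k < N)%N by lia.
  have -> : (d.+1 * (tb + 2) + 1 = ((tb + 1) + (d * (tb + 2) + 1)).+1)%N by lia.
  rewrite (drop_nth false) // -[_ :: _]/([:: _] ++ _).
  apply: triple_while_true; first by rewrite /simple /= sK1 /=; lia.
    by rewrite /= mi (eval_agree ha rK) eK; case: lerP => //; lia.
  rewrite /c' -[[:: nth false r k]]cats0.
  apply: triple_seq; apply: triple_bounded => hm.
  apply: triple_conseq (triple_frame (hbody k m kN hm hk mi ha)) (leqnn _) _.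
  move=> m1 l1 hm1 [ha1 [-> hI1]].
  have mi1 : m1 i 0 = k%:Z by rewrite ha1.
  apply: (@ptriple_triple _ _ _ (fun m2 => m2 = write m1 i 0 k.+1%:Z)).
    apply: ptriple_assign => //=; rewrite mi1; first by lia.
    by congr (write _ _ _ _); lia.
  move=> m2 hm2 ->; apply: triple_conseq (IH k.+1 (write m1 i 0 k.+1%:Z) _ hI1 _ _) (leqnn _) _.
  - by lia.
  - by rewrite /write !eqxx.
  - move=> a; rewrite inE negb_or => /andP[/negPf h3 h4] z.
    by rewrite /write h3 /= ha1 // ha // inE negb_or h3.
  - by move=> m3 l3 _ [-> h]; split.
rewrite /for_loop -[r]cat0s.
apply: (@triple_conseq _ _ _ (1 + (N * (tb + 2) + 1))%N _
  (fun m ls => ls = [::] /\ Q m)) => //; last by lia.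
apply: triple_seq.
apply: (@ptriple_triple _ _ _ (fun m2 => m2 = write m0 i 0 0)).
  by apply: ptriple_assign => //=; rewrite expn_gt0.
move=> m2 hm2 ->; rewrite -{1}(drop0 r); apply: loop => //.
  by rewrite /write !eqxx.
by move=> a; rewrite inE negb_or => /andP[/negPf h3 _] z; rewrite /write h3.
Qed.
End Logic.

(** * Maximum flows and minimum cuts *)

Section MaxFlowMinCut.
Variable N : network.
Hypothesis wfN : wf_network N.
Local Notation k := (size (arcs N)).
Local Notation tl i := (arc_nth N i).1.1.
Local Notation hd i := (arc_nth N i).1.2.
Local Notation cp i := (arc_nth N i).2.

Lemma wf_arc i : (i < k)%N -> (tl i < nodes N)%N /\ (hd i < nodes N)%N.
Proof.
move=> hi; case/and4P: wfN => _ _ _ /allP/(_ (arc_nth N i)).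
by rewrite mem_nth // => /(_ isT)/andP[].
Qed.

(** Sum the net outflow over the vertices of [X]: conservation cancels all of them but the source,
    and an arc with both ends on the same side contributes zero. *)
Lemma flow_value_cut f (X : pred nat) : is_flow N f -> X (source N) -> ~~ X (sink N) ->
  flow_value N f =
  \sum_(i < k) (nth 0%N f i)%:Z * ((X (tl i))%:Z - (X (hd i))%:Z).
Proof.
case=> _ _ hcons Xs Xt.
have hs : (source N < nodes N)%N by case/and4P: wfN.
have -> : flow_value N f =
    \sum_(v < nodes N | X v) ((outflow N f v)%:Z - (inflow N f v)%:Z).
  rewrite (bigD1 (Ordinal hs)) //= big1 ?addr0 // => v /andP[Xv vs].
  rewrite hcons ?subrr //; last by apply: contraNneq Xt => <-.
have E (F : nat -> nat) : (forall i, (i < k)%N -> (F i < nodes N)%N) ->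
    \sum_(v < nodes N | X v) (\sum_(i < k | F i == v) nth 0%N f i)%N%:Z =
    \sum_(i < k) (nth 0%N f i)%:Z * (X (F i))%:Z.
  move=> hF; rewrite big_mkcond /=.
  under eq_bigr => v _ do rewrite big_mkcond /= -[X in if _ then X else _]mulr1 -[X in if _ then _ else X](mulr0 (\sum_(i < k) if F i == v then nth 0%N f i else 0)%N%:Z) -fun_if.
  under eq_bigr => v _ do rewrite -natz natr_sum mulr_suml.
  rewrite exchange_big /=; apply: eq_bigr => i _.
  rewrite (bigD1 (Ordinal (hF i (ltn_ord i)))) //= eqxx big1 ?addr0.
    by rewrite natz; case: (X _).
  move=> v; rewrite -val_eqE /= eq_sym => /negPf ->; by rewrite mul0r.
rewrite sumrB /outflow /inflow.
rewrite (E (fun i => tl i)) ?(E (fun i => hd i)); try by move=> i /wf_arc[].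
by rewrite -sumrB; apply: eq_bigr => i _; rewrite mulrBr.
Qed.

Definition net_out (g : nat -> nat) (v : nat) : int :=
  \sum_(i < k) (g i)%:Z * ((tl i == v)%:Z - (hd i == v)%:Z).

Lemma net_outE f v : net_out (nth 0%N f) v = (outflow N f v)%:Z - (inflow N f v)%:Z.
Proof.
rewrite /net_out /outflow /inflow -!natz !natr_sum [X in X - _]big_mkcond [X in _ - X]big_mkcond.
rewrite -sumrB; apply: eq_bigr => i _; rewrite natz.
by case: (_ == _); case: (_ == _); rewrite /= ?mulr0 ?mulr1 ?subr0 ?sub0r ?mulrN1 ?subrr ?mulr0.
Qed.

Definition residual (g : nat -> nat) (x y : nat) : bool :=
  [exists i : 'I_k, [&& tl i == x, hd i == y & (g i < cp i)%N] ||
                    [&& hd i == x, tl i == y & (0 < g i)%N]].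

Definition feasible (g : nat -> nat) : Prop := forall i, (i < k)%N -> (g i <= cp i)%N.

(** Push one unit along the first residual arc and recurse. Simplicity of the path matters: the
    modified arc has [x] as an end while the rest of the path avoids [x], so the residual arcs still
    to be used are unaffected. *)
Lemma augment (g : nat -> nat) (x : nat) (p : seq nat) :
  feasible g -> path (residual g) x p -> uniq (x :: p) ->
  exists g', [/\ feasible g',
    forall v, net_out g' v = net_out g v + (v == x)%:Z - (v == last x p)%:Z &
    forall i, (i < k)%N -> ~~ ((tl i \in x :: p) && (hd i \in x :: p)) -> g' i = g i].
Proof.
elim: p x g => [|y p IH] x g hg; first by move=> _ _; exists g; split=> // v /=; lia.
move=> /= /andP[/existsP[i hi] hp] /andP[]; rewrite inE negb_or => /andP[xy xp] hu.
pose d : int := if [&& tl i == x, hd i == y & (g i < cp i)%N] then 1 else -1.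
pose g1 (j : nat) : nat := if j == i then absz ((g j)%:Z + d) else g j.
have g1i : (g1 i)%:Z = (g i)%:Z + d.
  rewrite /g1 eqxx /d; case: ifP hi => [_ _|_ /= /and3P[_ _]]; lia.
have hg1 : feasible g1.
  move=> j hj; have := hg j hj; case: (eqVneq j i) => [->|ji]; last by rewrite /g1 (negPf ji).
  move: g1i; rewrite /d; case: ifP hi => [/and3P[_ _]|_ /= /and3P[_ _]]; lia.
have hout v : net_out g1 v = net_out g v + (v == x)%:Z - (v == y)%:Z.
  rewrite /net_out (bigD1 i) //= [in RHS](bigD1 i) //= g1i.
  rewrite (eq_bigr (fun j : 'I_k => (g j)%:Z * ((tl j == v)%:Z - (hd j == v)%:Z))); last first.
    by move=> j; rewrite -val_eqE /= /g1 => /negPf ->.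
  move: (\sum_(_ < _ | _) _) => S; rewrite /d.
  case: ifP hi => [/and3P[/eqP-> /eqP-> _] _|_ /= /and3P[/eqP-> /eqP-> _]];
    rewrite !(eq_sym v); case: (x == v); case: (y == v) => /=; lia.
have hp1 : path (residual g1) y p.
  have := hp; apply: (@sub_in_path _ (mem (y :: p))); last by apply/allP.
  move=> u v hu' hv' /existsP[j hj]; apply/existsP; exists j.
  suff -> : g1 j = g j by [].
  rewrite /g1; case: eqP => // /ord_inj ji; move: hi hj; rewrite ji.
  have nx : x \notin y :: p by rewrite inE negb_or xy xp.
  have uv : u \in y :: p /\ v \in y :: p by [].
  case: uv => hu1 hv1 /orP[]/and3P[/eqP e1 /eqP e2 _] /orP[]/and3P[/eqP e3 /eqP e4 _].
  - by move: nx; rewrite -e1 e3 hu1.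
  - by move: nx; rewrite -e1 e4 hv1.
  - by move: nx; rewrite -e1 e4 hv1.
  - by move: nx; rewrite -e1 e3 hu1.
have [g' [h1 h2 h3]] := IH y g1 hg1 hp1 hu.
exists g'; split=> // [v|j hj hn]; first by rewrite h2 hout; lia.
rewrite h3 //; last first.
  by apply: contra hn => /andP[]; rewrite !(in_cons x) => -> ->; rewrite !orbT.
rewrite /g1; case: eqP => // ji; move: hn; rewrite ji.
by case/orP: hi => /and3P[/eqP-> /eqP-> _]; rewrite !inE !eqxx !orbT.
Qed.

(** [X] is what the residual graph reaches from the source. If it contained the sink, a simple
    augmenting path would produce a flow of larger value. *)
Lemma max_flow_min_cut f : is_max_flow N f -> exists X : pred nat,
  [/\ X (source N), ~~ X (sink N) &
    forall i, (i < k)%N ->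
      (X (tl i) -> ~~ X (hd i) -> nth 0%N f i = cp i) /\
      (~~ X (tl i) -> X (hd i) -> nth 0%N f i = 0%N)].
Proof.
move=> [[fs fc fv] fmax]; set g := nth 0%N f.
case/and4P: (wfN) => hs ht hst _.
pose rr := [rel u v : 'I_(nodes N) | residual g u v].
pose X v := [exists u : 'I_(nodes N), (val u == v) && connect rr (Ordinal hs) u].
have Xr u v : (v < nodes N)%N -> X u -> residual g u v -> X v.
  move=> hv /existsP[w /andP[/eqP <- cw]] hr.
  apply/existsP; exists (Ordinal hv); rewrite /= eqxx.
  by apply: connect_trans cw _; exact: connect1.
exists X; split.
- by apply/existsP; exists (Ordinal hs); rewrite eqxx connect0.
- apply/negP => /existsP[u /andP[/eqP ut /connectP[p hp hl]]].
  case: (shortenP hp) hl => p' hp' hu _ hl.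
  have hf : feasible g by move=> i hi; exact: fc.
  have [||g' [h1 h2 _]] := @augment g (source N) (map val p') hf.
  + by have := hp'; rewrite -[source N]/(val (Ordinal hs)) path_map.
  + by rewrite -[source N]/(val (Ordinal hs)) -map_cons map_inj_uniq //; exact: val_inj.
  have lt : last (source N) (map val p') = sink N.
    by rewrite -[source N]/(val (Ordinal hs)) last_map -hl.
  have E v : (outflow N (mkseq g' k) v)%:Z - (inflow N (mkseq g' k) v)%:Z = net_out g' v.
    rewrite -net_outE; apply: eq_bigr => i _; by rewrite nth_mkseq.
  have E' v : (outflow N f v)%:Z - (inflow N f v)%:Z = net_out g v by rewrite -net_outE.
  have := fmax (mkseq g' k); rewrite /flow_value E E' h2 eqxx lt (negPf hst).
  have H : is_flow N (mkseq g' k).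
    split; first by rewrite size_mkseq.
      by move=> i hi; rewrite nth_mkseq //; exact: h1.
    move=> v hv vs vt; have := E v; rewrite h2 (negPf vs) lt (negPf vt) -E' fv //; lia.
  by move=> /(_ H); lia.
- move=> i hi; have [h1 h2] := wf_arc hi; split => [xt xh|xt xh].
    apply/eqP; rewrite eqn_leq fc //= leqNgt; apply: contra xh => hlt.
    by apply: (Xr _ _ h2 xt); apply/existsP; exists (Ordinal hi); rewrite /= !eqxx hlt.
  apply/eqP; rewrite -leqn0 leqNgt; apply: contra xt => hlt.
  by apply: (Xr _ _ h1 xh); apply/existsP; exists (Ordinal hi); rewrite /= !eqxx hlt orbT.
Qed.
End MaxFlowMinCut.

Lemma natz_sumD (I : Type) (r : seq I) (P : pred I) (F : I -> nat) :
  ((\sum_(i <- r | P i) F i)%N)%:Z = \sum_(i <- r | P i) (F i)%:Z.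
Proof. by rewrite -natz natr_sum; apply: eq_bigr => i _; rewrite natz. Qed.

Section ResidualCut.
(* [N2] is the residual network of the flow [f] of [N1], with capacities
   exceeding [n], where every vertex [v < n] can send one unit to a new sink:
   its maximum flows mark exactly the vertices reachable in the residual graph. *)
Variables (N1 N2 : network) (n : nat) (f g : seq nat).
Local Notation K := (size (arcs N1)).
Local Notation tl k := (arc_nth N1 k).1.1.
Local Notation hd k := (arc_nth N1 k).1.2.
Local Notation cp k := (arc_nth N1 k).2.
Hypotheses (wf1 : wf_network N1) (wf2 : wf_network N2).
Hypotheses (nodes1 : nodes N1 = n.+2) (source1 : source N1 = n) (sink1 : sink N1 = n.+1).
Hypotheses (source2 : source N2 = n) (sink2 : sink N2 = n.+2).
Hypothesis size2 : size (arcs N2) = (K + K + n)%N.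
Hypothesis fwd_arc : forall k, (k < K)%N ->
  arc_nth N2 k = (tl k, hd k, if (nth 0%N f k < cp k)%N then n.+1 else 0%N).
Hypothesis bwd_arc : forall k, (k < K)%N ->
  arc_nth N2 (K + k) = (hd k, tl k, if (0 < nth 0%N f k)%N then n.+1 else 0%N).
Hypothesis vtx_arc : forall v, (v < n)%N -> arc_nth N2 (K + K + v) = (v, n.+2, 1%N).
Hypotheses (fmax : is_max_flow N1 f) (gmax : is_max_flow N2 g).

Lemma residual_value (X : pred nat) : X n -> ~~ X n.+2 ->
  flow_value N2 g =
  \sum_(k < K) ((nth 0%N g k)%:Z * ((X (tl k))%:Z - (X (hd k))%:Z) +
                (nth 0%N g (K + k))%:Z * ((X (hd k))%:Z - (X (tl k))%:Z)) +
  \sum_(v < n) (nth 0%N g (K + K + v))%:Z * (X v)%:Z.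
Proof.
move=> Xn Xt; case: gmax => gf _.
rewrite (@flow_value_cut _ wf2 _ X gf) ?source2 ?sink2 // size2 !big_split_ord /=.
rewrite big_split /=; congr (_ + _ + _); apply: eq_bigr => k _.
- by rewrite fwd_arc.
- by rewrite bwd_arc.
- by rewrite vtx_arc //= (negPf Xt) subr0.
Qed.

Lemma g_cap : [/\ forall k, (k < K)%N -> (nth 0 g k <= if (nth 0 f k < cp k)%N then n.+1 else 0)%N,
   forall k, (k < K)%N -> (nth 0 g (K + k) <= if (0 < nth 0 f k)%N then n.+1 else 0)%N
 & forall v, (v < n)%N -> (nth 0 g (K + K + v) <= 1)%N].
Proof.
case: gmax => [[_ h _] _]; split => k hk.
- by have := h k; rewrite size2 fwd_arc //; apply; lia.
- by have := h (K + k)%N; rewrite size2 bwd_arc //; apply; lia.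
- by have := h (K + K + k)%N; rewrite size2 vtx_arc //; apply; lia.
Qed.

Lemma residual_cut : exists X : pred nat,
  [/\ X n, ~~ X n.+1,
    forall k, (k < K)%N ->
      (X (tl k) -> ~~ X (hd k) -> nth 0%N f k = cp k) /\
      (~~ X (tl k) -> X (hd k) -> nth 0%N f k = 0%N) &
    forall v, (v < n)%N -> X v = (nth 0%N g (K + K + v) != 0%N)].
Proof.
have [c1 c2 c3] := g_cap.
have [X1 [X1s X1t hX1]] := max_flow_min_cut wf1 fmax.
have [Y [Ys Yt hY]] := max_flow_min_cut wf2 gmax.
rewrite source1 in X1s; rewrite sink1 in X1t; rewrite source2 in Ys; rewrite sink2 in Yt.
have lt2 k : (k < K)%N -> (tl k < n.+2)%N /\ (hd k < n.+2)%N.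
  by move=> /(wf_arc wf1); rewrite nodes1.
(* Cut around the new sink alone: the value counts the marking units, hence is at most [n]. *)
have valZ : flow_value N2 g = \sum_(v < n) (nth 0%N g (K + K + v))%:Z.
  rewrite (@residual_value (fun v => v != n.+2)) ?eqxx //; last by rewrite neq_ltn ltnS leqnSn.
  rewrite big1 ?add0r => [|k _]; last first.
    by have [h1 h2] := lt2 k (ltn_ord k); rewrite !neq_ltn h1 h2 /=; lia.
  by apply: eq_bigr => v _; rewrite neq_ltn (ltn_trans (ltn_ord v)) //= mulr1.
have val_le : flow_value N2 g <= n%:Z.
  rewrite valZ; apply: (@le_trans _ _ (\sum_(v < n) (1 : int))).
    by apply: ler_sum => v _; have := c3 v (ltn_ord v); lia.
  by rewrite sumr_const card_ord natz.
have valY := residual_value Ys Yt.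
have cutY k : (k < K)%N ->
    (0 <= (nth 0%N g k)%:Z * ((Y (tl k))%:Z - (Y (hd k))%:Z)) /\
    (0 <= (nth 0%N g (K + k))%:Z * ((Y (hd k))%:Z - (Y (tl k))%:Z)).
  move=> hk; have := hY k; have := hY (K + k)%N; rewrite size2 (fwd_arc hk) (bwd_arc hk) /=.
  move=> /(_ ltac:(lia))[_ h2] /(_ ltac:(lia))[_ h4].
  case: (Y (tl k)) h2 h4; case: (Y (hd k)) => /= h2 h4; split; lia.
(* All contributions to the value across [Y] are nonnegative, so none exceeds [n], whereas a
   residual arc leaving [Y] would be saturated with [n.+1] units. *)
have closedY k : (k < K)%N ->
    (nth 0%N g k)%:Z * ((Y (tl k))%:Z - (Y (hd k))%:Z) <= n%:Z /\
    (nth 0%N g (K + k))%:Z * ((Y (hd k))%:Z - (Y (tl k))%:Z) <= n%:Z.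
  move=> hk; have := val_le; rewrite valY (bigD1 (Ordinal hk)) //=.
  have h1 : 0 <= \sum_(v < n) (nth 0%N g (K + K + v))%:Z * (Y v)%:Z.
    by apply: sumr_ge0 => v _; apply: mulr_ge0.
  have h2 : 0 <= \sum_(i < K | i != Ordinal hk)
      ((nth 0%N g i)%:Z * ((Y (tl i))%:Z - (Y (hd i))%:Z) +
       (nth 0%N g (K + i))%:Z * ((Y (hd i))%:Z - (Y (tl i))%:Z)).
    by apply: sumr_ge0 => i _; have [a1 a2] := cutY i (ltn_ord i); exact: addr_ge0.
  have [a1 a2] := cutY k hk; move: h1 h2 a1 a2.
  move: (\sum_(v < n) _) (\sum_(i < K | _) _) => A B h1 h2 a1 a2 h3.
  move: (_ * _) (_ * _) a1 a2 h3 => a c a1 a2 h3; split; lia.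
have {}closedY k : (k < K)%N ->
    (Y (tl k) -> ~~ Y (hd k) -> nth 0%N f k = cp k) /\
    (~~ Y (tl k) -> Y (hd k) -> nth 0%N f k = 0%N).
  move=> hk; have [h1 h2] := closedY k hk.
  have := hY k; have := hY (K + k)%N; rewrite size2 (fwd_arc hk) (bwd_arc hk) /=.
  move=> /(_ ltac:(lia))[h3 _] /(_ ltac:(lia))[h5 _].
  have fk : (nth 0 f k <= cp k)%N by case: fmax => [[_ h _] _]; exact: h.
  split => y1 y2; rewrite ?y1 ?y2 ?(negPf y1) ?(negPf y2) /= in h1 h2 h3 h5.
    by move: h1; rewrite h5 //; case: ltnP => //; lia.
  by move: h2; rewrite h3 //; case: ltnP => //; lia.
have gY v : (v < n)%N -> Y v -> nth 0%N g (K + K + v) = 1%N.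
  move=> hv Yv; have := hY (K + K + v)%N; rewrite size2 vtx_arc //= => /(_ ltac:(lia))[h _].
  exact: h.
have valY2 : flow_value N2 g = \sum_(v < n) (nth 0%N g (K + K + v))%:Z * (Y v)%:Z.
  rewrite valY big1 ?add0r // => k _.
  have hk := ltn_ord k.
  have [p1 p2] := cutY k hk; have [q1 q2] := closedY k hk.
  have := c1 k hk; have := c2 k hk.
  case: (Y (tl k)) p1 p2 q1 q2; case: (Y (hd k)) => /= p1 p2 q1 q2; try lia.
    by rewrite q1 // ltnn; lia.
  by rewrite q2 // ltnn; lia.
have gNY v : (v < n)%N -> ~~ Y v -> nth 0%N g (K + K + v) = 0%N.
  move=> hv Yv; have := valY2; rewrite valZ => /eqP; rewrite -subr_eq0 -sumrB.
  rewrite psumr_eq0 => [/allP/(_ (Ordinal hv))|i _]; last first.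
    by case: (Y i); rewrite ?mulr1 ?mulr0 ?subrr ?subr0.
  by rewrite mem_index_enum /= (negPf Yv) mulr0 subr0 => /(_ isT)/eqP; lia.
(* No arc of positive capacity between the old nodes leaves [X1], so the units that mark vertices of
   [X1] already make up the whole value. *)
have gNX1 v : (v < n)%N -> ~~ X1 v -> nth 0%N g (K + K + v) = 0%N.
  pose X2 u := X1 u && (u != n.+2).
  have := @residual_value X2; rewrite /X2 X1s eqxx andbF.
  have -> : n != n.+2 by rewrite neq_ltn ltnS leqnSn.
  move=> /(_ isT isT) hval hv Xv.
  have lev : flow_value N2 g <= \sum_(v < n) (nth 0%N g (K + K + v))%:Z * (X1 v)%:Z.
    rewrite hval -[X in _ <= X]add0r lerD //; last first.
      apply: ler_sum => u _; have -> : (u : nat) != n.+2.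
        by rewrite neq_ltn (ltn_trans (ltn_ord u)).
      by rewrite andbT.
    apply: sumr_le0 => k _; have hk := ltn_ord k.
    have [h1 h2] := lt2 k hk.
    have -> : tl k != n.+2 by rewrite neq_ltn h1.
    have -> : hd k != n.+2 by rewrite neq_ltn h2.
    rewrite !andbT; have := c1 k hk; have := c2 k hk; have [q1 q2] := hX1 k hk.
    case: (X1 (tl k)) q1 q2; case: (X1 (hd k)) => /= q1 q2; try lia.
      by rewrite q1 // ltnn; lia.
    by rewrite q2 // ltnn; lia.
  have : \sum_(u < n) ((nth 0%N g (K + K + u))%:Z - (nth 0%N g (K + K + u))%:Z * (X1 u)%:Z) == 0.
    rewrite eq_le sumrB subr_le0 -valZ lev /= valZ -sumrB.
    by apply: sumr_ge0 => u _; case: (X1 u); rewrite ?mulr1 ?mulr0 ?subrr ?subr0.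
  rewrite psumr_eq0 => [/allP/(_ (Ordinal hv))|i _]; last first.
    by case: (X1 i); rewrite ?mulr1 ?mulr0 ?subrr ?subr0.
  by rewrite mem_index_enum /= (negPf Xv) mulr0 subr0 => /(_ isT)/eqP; lia.
(* The old sink is excluded by [X1], as nothing prevents [Y] from containing it; on the vertices
   below [n] the marks make the intersection agree with [Y]. *)
exists (fun v => Y v && X1 v); split.
- by rewrite Ys.
- by rewrite (negPf X1t) andbF.
- move=> k hk; have [p1 p2] := closedY k hk; have [q1 q2] := hX1 k hk.
  split; first by case/andP=> a1 a2; rewrite negb_and => /orP[]; [exact: p1|exact: q1].
  by rewrite negb_and => /orP[] a1 /andP[a2 a3]; [exact: p2|exact: q2].
- move=> v hv; case Yv : (Y v) => /=; last by rewrite gNY ?Yv.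
  case Xv : (X1 v); first by rewrite gY.
  by rewrite gNX1 ?Xv.
Qed.
End ResidualCut.

(** * Darts *)

Section Darts.
Variables (n : nat) (e : rel 'I_n).
Hypotheses (e_sym : symmetric e) (e_irr : irreflexive e).

Definition dart_seq : seq ('I_n * 'I_n) :=
  edges e ++ [seq (x.2, x.1) | x <- edges e].
Definition num_darts : nat := (size (edges e) + size (edges e))%N.
Definition dart_tail (i : nat) : nat := nth 0%N [seq nat_of_ord x.1 | x <- dart_seq] i.
Definition dart_head (i : nat) : nat := nth 0%N [seq nat_of_ord x.2 | x <- dart_seq] i.

Lemma size_dart_seq : size dart_seq = num_darts.
Proof. by rewrite size_cat size_map. Qed.

Lemma mem_edges x : (x \in edges e) = (x.1 < x.2)%N && e x.1 x.2.
Proof. by rewrite mem_filter mem_enum andbT. Qed.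

Lemma mem_dart_seq x : (x \in dart_seq) = e x.1 x.2.
Proof.
have E : (x \in [seq (y.2, y.1) | y <- edges e]) = (x.2 < x.1)%N && e x.1 x.2.
  apply/mapP/idP => [[y]|h].
    by rewrite mem_edges => /andP[h1 h2] -> /=; rewrite h1 e_sym.
  by exists (x.2, x.1); [rewrite mem_edges /= e_sym|case: (x)].
rewrite mem_cat mem_edges E -andb_orl.
case: (ltngtP x.1 x.2) => //= /ord_inj ->.
by rewrite e_irr.
Qed.

Lemma uniq_dart_seq : uniq dart_seq.
Proof.
have U : uniq (edges e) by rewrite filter_uniq // enum_uniq.
rewrite cat_uniq map_inj_uniq; last by move=> [a b] [c d] /= [-> ->].
apply/and3P; split=> //; apply/hasPn => x /mapP[y].
by rewrite mem_edges => /andP[h _] -> /=; rewrite mem_edges /= ltnNge ltnW.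
Qed.

Lemma card_darts (P : pred ('I_n * 'I_n)) :
  #|[set x | e x.1 x.2 && P x]%SET| = count P dart_seq.
Proof.
rewrite -size_filter cardE; apply/perm_size/uniq_perm.
- exact: enum_uniq.
- by rewrite filter_uniq // uniq_dart_seq.
- by move=> x; rewrite mem_enum inE mem_filter mem_dart_seq andbC.
Qed.

Lemma count_darts (P : rel nat) :
  count (fun x : 'I_n * 'I_n => P x.1 x.2) dart_seq = (\sum_(i < num_darts) P (dart_tail i) (dart_head i))%N.
Proof.
rewrite -sum1_count big_mkcond /=; case E : dart_seq => [|x0 s0].
  by rewrite -size_dart_seq E big_nil big_ord0.
rewrite -E (big_nth x0) big_mkord size_dart_seq; apply: eq_bigr => i _.
by rewrite /dart_tail /dart_head !(nth_map x0) ?size_dart_seq; case: (P _ _).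
Qed.

Lemma dart_lt i : (i < num_darts)%N -> (dart_tail i < n)%N /\ (dart_head i < n)%N.
Proof.
move=> hi; case E : dart_seq => [|x0 s0]; first by move: hi; rewrite -size_dart_seq E.
by rewrite /dart_tail /dart_head !(nth_map x0) ?size_dart_seq.
Qed.

Lemma vol_darts (U : pred nat) :
  vol e [set v : 'I_n | U v]%SET = (\sum_(i < num_darts) U (dart_tail i))%N.
Proof.
rewrite -(count_darts (fun a _ => U a)) -card_darts /vol /deg.
rewrite (eq_bigr (fun v : 'I_n => \sum_(u : 'I_n | e v u) 1)%N); last first.
  by move=> v _; rewrite -sum1dep_card; apply: eq_bigl => u.
rewrite pair_big_dep /= -sum1dep_card; apply: eq_bigl => -[a b] /=.
by rewrite inE andbC.
Qed.

Lemma boundary_darts (U : pred nat) :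
  boundary e [set v : 'I_n | U v]%SET =
  (\sum_(i < num_darts) (U (dart_tail i) && ~~ U (dart_head i)))%N.
Proof.
rewrite -(count_darts (fun a b => U a && ~~ U b)) -card_darts /boundary.
by apply: eq_card => -[a b]; rewrite !inE /= andbA andbC.
Qed.

Lemma vol_setC_darts (U : pred nat) :
  vol e (~: [set v : 'I_n | U v])%SET = (\sum_(i < num_darts) ~~ U (dart_tail i))%N.
Proof.
rewrite -(vol_darts (fun v => ~~ U v)); congr (vol _ _).
by apply/setP => v; rewrite !inE.
Qed.

Lemma dart_reverse (F : nat -> nat -> nat) :
  (\sum_(i < num_darts) F (dart_tail i) (dart_head i) =
   \sum_(i < num_darts) F (dart_head i) (dart_tail i))%N.
Proof.
have E (G : nat -> nat -> nat) :
    (\sum_(i < num_darts) G (dart_tail i) (dart_head i) = \sum_(x <- dart_seq) G x.1 x.2)%N.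
  case E : dart_seq => [|x0 s0]; first by rewrite -size_dart_seq E big_nil big_ord0.
  rewrite -E (big_nth x0) big_mkord size_dart_seq; apply: eq_bigr => i _.
  by rewrite /dart_tail /dart_head !(nth_map x0) ?size_dart_seq.
rewrite !E (E (fun a b => F b a)) /dart_seq !big_cat !big_map /= addnC.
by [].
Qed.
End Darts.

(** * The flow network of one round *)

Section DartNetwork.
(* A unit source arc into the tail of every dart of [SD], a unit sink arc from
   the tail of every other dart, and an arc of capacity [c] along every dart. *)
Variables (n m c : nat) (dv dw : nat -> nat) (SD : pred nat) (N1 : network).
Local Notation N := (m + m)%N.
Hypothesis dv_lt : forall k, (k < N)%N -> (dv k < n)%N.
Hypothesis dw_lt : forall k, (k < N)%N -> (dw k < n)%N.
Hypothesis half_SD : (\sum_(k < N) SD k = m)%N.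
Hypotheses (nodes1 : nodes N1 = n.+2) (source1 : source N1 = n) (sink1 : sink N1 = n.+1).
Hypothesis size1 : size (arcs N1) = (N + N)%N.
Hypothesis unit_arc : forall k, (k < N)%N -> arc_nth N1 k =
  if SD k then (n, dv k, 1%N) else (dv k, n.+1, 1%N).
Hypothesis dart_arc : forall k, (k < N)%N -> arc_nth N1 (N + k) = (dv k, dw k, c).

Lemma wf_dart_network : wf_network N1.
Proof.
apply/and4P; split; rewrite ?nodes1 ?source1 ?sink1 ?ltnS ?leqnSn //.
  by rewrite neq_ltn ltnSn.
apply/allP => a /(nthP (0, 0, 0)%N)[k]; rewrite size1 => hk <-.
rewrite -/(arc_nth N1 k); case: (ltnP k N) => hk'.
  rewrite unit_arc //; have := dv_lt hk'; case: (SD k) => /=; lia.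
have -> : k = (N + (k - N))%N by lia.
have hk2 : (k - N < N)%N by lia.
by rewrite dart_arc //=; have := dv_lt hk2; have := dw_lt hk2; lia.
Qed.

Lemma dart_network_value f (X : pred nat) : is_flow N1 f -> X n -> ~~ X n.+1 ->
  flow_value N1 f =
  \sum_(k < N) (nth 0%N f k)%:Z * (if SD k then 1 - (X (dv k))%:Z else (X (dv k))%:Z) +
  \sum_(k < N) (nth 0%N f (N + k))%:Z * ((X (dv k))%:Z - (X (dw k))%:Z).
Proof.
move=> hf Xn Xt; rewrite (flow_value_cut wf_dart_network hf (X := X)) ?source1 ?sink1 //.
rewrite size1 big_split_ord /=; congr (_ + _); apply: eq_bigr => k _.
  by rewrite unit_arc //; case: (SD k); rewrite /= ?Xn ?(negPf Xt) ?subr0.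
by rewrite dart_arc.
Qed.

Lemma unit_arc_le1 f k : is_flow N1 f -> (k < N)%N -> (nth 0 f k <= 1)%N.
Proof.
case=> _ h _ hk; have := h k; rewrite size1 unit_arc //.
by case: (SD k) => /=; apply; lia.
Qed.

Lemma dart_network_source f : is_flow N1 f ->
  flow_value N1 f = \sum_(k < N) (nth 0%N f k * SD k)%N%:Z.
Proof.
move=> hf; rewrite (@dart_network_value f (fun v => v == n)) ?eqxx //; last first.
  by rewrite neq_ltn ltnSn orbT.
rewrite [X in _ + X]big1 ?addr0 => [|k _]; last first.
  by have := dv_lt (ltn_ord k); have := dw_lt (ltn_ord k); rewrite !ltn_neqAle => /andP[/negPf-> _] /andP[/negPf-> _]; rewrite subrr mulr0.
apply: eq_bigr => k _; have := dv_lt (ltn_ord k); rewrite ltn_neqAle => /andP[/negPf-> _].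
by case: (SD k); rewrite ?muln1 ?muln0 ?mulr1 ?mulr0 ?subr0.
Qed.

(** The value is [m] when measured at the source, and the cut around the sink must deliver it
    through [m] arcs of capacity 1. *)
Lemma saturated f : is_flow N1 f -> (forall k, (k < N)%N -> SD k -> nth 0%N f k = 1%N) ->
  forall k, (k < N)%N -> nth 0%N f k = 1%N.
Proof.
move=> hf h1 k hk; case Sk : (SD k); first exact: h1.
have := dart_network_source hf.
rewrite (@dart_network_value f (fun v => v != n.+1)) ?eqxx //; last by rewrite neq_ltn ltnSn.
rewrite [X in _ + X]big1 ?addr0 => [|j _]; last first.
  by have := dv_lt (ltn_ord j); have := dw_lt (ltn_ord j) => h2 h3; rewrite !neq_ltn (leqW h2) (leqW h3) subrr mulr0.
move=> E.
have {E} : \sum_(j < N) ((~~ SD j)%:Z - (nth 0%N f j)%:Z * (~~ SD j)%:Z) == 0 :> int.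
  rewrite sumrB subr_eq0; apply/eqP.
  transitivity (\sum_(j < N) (SD j)%:Z).
    have hs : \sum_(j < N) (SD j)%:Z = m%:Z by rewrite -natz_sumD half_SD.
    have : \sum_(j < N) ((SD j)%:Z + (~~ SD j)%:Z) = N%:Z.
      rewrite (eq_bigr (fun _ => 1)) => [|j _]; last by case: (SD j).
      by rewrite sumr_const card_ord natz.
    rewrite big_split /= hs; move: (\sum_(j < N) _) => S; lia.
  rewrite (eq_bigr (fun j : 'I_N => (nth 0%N f j * SD j)%N%:Z)); last first.
    by move=> j _; have := h1 j (ltn_ord j); case: (SD j) => [->|]; rewrite ?muln0.
  rewrite -E; apply: eq_bigr => j _.
  have := dv_lt (ltn_ord j) => h3; rewrite !neq_ltn (leqW h3).
  by case: (SD j) => /=; rewrite ?subrr ?mulr0.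
rewrite psumr_eq0 => [/allP/(_ (Ordinal hk))|j _]; last first.
  by have := unit_arc_le1 hf (ltn_ord j); case: (SD j) => /=; lia.
by rewrite mem_index_enum /= Sk => /(_ isT)/eqP; lia.
Qed.

(** The value is below [m]. Across [X] it equals [c * bd], plus the darts of [SD] outside [X], plus
    the other darts inside. As [SD] and its complement have [m] darts each, [c * bd] is less than
    the number of darts of [SD] inside [X], and less than the number of other darts outside. *)
Lemma unsaturated_cut f (X : pred nat) k0 : is_flow N1 f -> (k0 < N)%N -> SD k0 ->
  nth 0%N f k0 <> 1%N -> X n -> ~~ X n.+1 ->
  (forall k, (k < N + N)%N ->
      (X (arc_nth N1 k).1.1 -> ~~ X (arc_nth N1 k).1.2 -> nth 0%N f k = (arc_nth N1 k).2) /\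
      (~~ X (arc_nth N1 k).1.1 -> X (arc_nth N1 k).1.2 -> nth 0%N f k = 0%N)) ->
  let bd := (\sum_(k < N) (X (dv k) && ~~ X (dw k)))%N in
  (c * bd < \sum_(k < N) X (dv k))%N /\ (c * bd < \sum_(k < N) ~~ X (dv k))%N.
Proof.
move=> hf hk0 S0 f0 Xn Xt hX bd.
have lt_m : flow_value N1 f < m%:Z.
  have hm : m%:Z = \sum_(k < N) (SD k)%:Z by rewrite -natz_sumD half_SD.
  rewrite dart_network_source // [in X in _ < X]hm.
  rewrite (bigD1 (Ordinal hk0)) //= [in X in _ < X](bigD1 (Ordinal hk0)) //= S0.
  apply: ltr_leD; first by have := unit_arc_le1 hf hk0; lia.
  apply: ler_sum => j _; have := unit_arc_le1 hf (ltn_ord j); case: (SD j); lia.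
move: lt_m; rewrite (dart_network_value hf Xn Xt).
have -> : \sum_(k < N) (nth 0%N f (N + k))%:Z * ((X (dv k))%:Z - (X (dw k))%:Z) = (c * bd)%N%:Z.
  rewrite PoszM /bd natz_sumD mulr_sumr; apply: eq_bigr => k _.
  have hk := ltn_ord k.
  have := hX (N + k)%N; rewrite dart_arc //= ltn_add2l => /(_ hk)[h1 h2].
  case: (X (dv k)) h1 h2; case: (X (dw k)) => /= h1 h2; rewrite ?subrr ?mulr0 //.
    by rewrite h1.
  by rewrite h2.
have E (k : 'I_N) : (nth 0%N f k)%:Z * (if SD k then 1 - (X (dv k))%:Z else (X (dv k))%:Z) =
    (SD k && ~~ X (dv k))%:Z + (~~ SD k && X (dv k))%:Z.
  have hk := ltn_ord k; have := hX k; rewrite unit_arc // ltn_addl // => /(_ isT).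
  case: (SD k) => /=; rewrite ?Xn ?(negPf Xt); case: (X (dv k)) => /= -[h1 h2];
    by rewrite ?mulr0 // h1.
rewrite (eq_bigr _ (fun k _ => E k)) big_split /= -!natz_sumD.
have e1 : (\sum_(k < N) (SD k && ~~ X (dv k)) + \sum_(k < N) (SD k && X (dv k)) = m)%N.
  by rewrite -[RHS]half_SD -big_split /=; apply: eq_bigr => j _; case: (SD j); case: (X _).
have e2 : (\sum_(k < N) (SD k && X (dv k)) + \sum_(k < N) (~~ SD k && X (dv k)) = \sum_(k < N) X (dv k))%N.
  by rewrite -big_split /=; apply: eq_bigr => j _; case: (SD j); case: (X _).
have e3 : (\sum_(k < N) X (dv k) + \sum_(k < N) ~~ X (dv k) = m + m)%N.
  rewrite -big_split /= (eq_bigr (fun _ => 1%N)) => [|k _]; last by case: (X _).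
  by rewrite sum1_card card_ord.
move: e1 e2 e3.
move: (\sum_(k < N) (SD k && ~~ X (dv k)))%N (\sum_(k < N) (SD k && X (dv k)))%N.
move: (\sum_(k < N) (~~ SD k && X (dv k)))%N (\sum_(k < N) X (dv k))%N (\sum_(k < N) ~~ X (dv k))%N.
by move: (c * bd)%N => *; split; lia.
Qed.
End DartNetwork.

(** * Expectation over coin flips *)

Section CoinExpectation.
Variable R : realType.
Implicit Types (f g : seq bool -> R) (w : seq bool).

(** Recursion on the first flip makes conditioning on a prefix of the coins, [Ex_cat], immediate. *)
Fixpoint Ex (k : nat) (f : seq bool -> R) : R :=
  if k is k'.+1 then (Ex k' (fun w => f (false :: w)) + Ex k' (fun w => f (true :: w))) / 2
  else f [::].

Lemma Ex_le k f g : (forall w, size w = k -> f w <= g w) -> Ex k f <= Ex k g.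
Proof.
elim: k f g => [|k IH] f g h /=; first exact: h.
by rewrite ler_pM2r ?invr_gt0 ?ltr0n // lerD //; apply: IH => w hw; apply: h; rewrite /= hw.
Qed.

Lemma eq_Ex k f g : (forall w, size w = k -> f w = g w) -> Ex k f = Ex k g.
Proof. by move=> h; apply/eqP; rewrite eq_le !Ex_le // => w hw; rewrite h. Qed.

Lemma Ex_cst k (x : R) : Ex k (fun _ => x) = x.
Proof. by elim: k => //= k ->; field. Qed.

Lemma ExD k f g : Ex k (fun w => f w + g w) = Ex k f + Ex k g.
Proof. by elim: k f g => //= k IH f g; rewrite !IH; field. Qed.

Lemma ExZ k (c : R) f : Ex k (fun w => c * f w) = c * Ex k f.
Proof. by elim: k f => //= k IH f; rewrite !IH; field. Qed.

Lemma Ex_sum k (I : Type) (s : seq I) (F : I -> seq bool -> R) :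
  Ex k (fun w => \sum_(i <- s) F i w) = \sum_(i <- s) Ex k (F i).
Proof.
elim: s => [|i s IH]; first by rewrite big_nil -[RHS](Ex_cst k); apply: eq_Ex => w _; rewrite big_nil.
by rewrite big_cons -IH -ExD; apply: eq_Ex => w _; rewrite big_cons.
Qed.

Lemma Ex_cat a b f : Ex (a + b) f = Ex a (fun r => Ex b (fun w => f (r ++ w))).
Proof. by elim: a f => //= a IH f; rewrite !IH. Qed.

Lemma coin_prob_Ex L (E : seq bool -> Prop) :
  coin_prob R (fun w : L.-tuple bool => E w) = Ex L (fun w => (`[< E w >])%:R).
Proof.
have -> : coin_prob R (fun w : L.-tuple bool => E w) =
    (\sum_(w : L.-tuple bool) (`[< E w >])%:R) / 2 ^+ L.
  by rewrite /coin_prob -sum1dep_card natr_sum big_mkcond; congr (_ / _); apply: eq_bigr => w _; case: `[< _ >].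
elim: L E => [|L IH] E.
  rewrite expr0 divr1 (eq_bigr (fun _ : 0.-tuple bool => (`[< E [::] >])%:R)); last first.
    by move=> w _; rewrite (tuple0 w).
  by rewrite sumr_const card_tuple expn0.
rewrite /= -(IH (fun w => E (false :: w))) -(IH (fun w => E (true :: w))).
have -> : \sum_(w : L.+1.-tuple bool) (`[< E w >])%:R =
    \sum_(p : bool * L.-tuple bool) (`[< E (p.1 :: p.2) >])%:R :> R.
  rewrite (reindex (fun p : bool * L.-tuple bool => [tuple of p.1 :: p.2])) //=.
  exists (fun w : L.+1.-tuple bool => (thead w, behead_tuple w)).
    by move=> [x w] _ /=; congr (_, _); apply: val_inj.
  by move=> w _; rewrite [in RHS](tuple_eta w); apply: val_inj.
rewrite -(pair_bigA _ (fun x (w : L.-tuple bool) => (`[< E (x :: w) >])%:R)) /=.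
by rewrite big_bool /= exprS invfM; field; rewrite expf_neq0 // pnatr_eq0.
Qed.

Definition sgn (x : bool) : R := if x then 1 else -1.

Definition lin (N : nat) (a : nat -> R) (r : seq bool) : R :=
  \sum_(i < N) a i * sgn (nth false r i).

Lemma lin_cons N a x r : lin N.+1 a (x :: r) = a 0%N * sgn x + lin N (fun i => a i.+1) r.
Proof. by rewrite /lin big_ord_recl. Qed.

Lemma Ex_lin N a : Ex N (lin N a) = 0.
Proof.
elim: N a => [|N IH] a /=; first by rewrite /lin big_ord0.
rewrite (eq_Ex (fun w _ => lin_cons N a false w)) (eq_Ex (fun w _ => lin_cons N a true w)).
by rewrite !ExD !Ex_cst !IH /sgn; field.
Qed.

Lemma Ex_lin_sqr N a : Ex N (fun r => lin N a r ^+ 2) = \sum_(i < N) a i ^+ 2.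
Proof.
elim: N a => [|N IH] a /=; first by rewrite /lin !big_ord0 expr0n.
have E x : Ex N (fun w => lin N.+1 a (x :: w) ^+ 2) =
    a 0%N ^+ 2 + \sum_(i < N) a i.+1 ^+ 2.
  rewrite (@eq_Ex _ _ (fun w => a 0%N ^+ 2 +
     ((2 * a 0%N * sgn x) * lin N (fun i => a i.+1) w + lin N (fun i => a i.+1) w ^+ 2))).
    by rewrite !ExD Ex_cst ExZ Ex_lin mulr0 add0r IH.
  by move=> w _; rewrite lin_cons /sgn; case: x; ring.
by rewrite !E big_ord_recl /=; field.
Qed.

(** The classical exponent is [x ^+ 2 / 2]; the weaker constant 2 avoids power series. When [x ^+ 2]
    exceeds [1 / 2], both [x] and [- x] are at most [2 * x ^+ 2]. Otherwise [expR x <= 1 / (1 - x)]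
    and its mirror image average to [1 / (1 - x ^+ 2)]. *)
Lemma cosh_le (x : R) : (expR x + expR (- x)) / 2 <= expR (2 * x ^+ 2).
Proof.
case: (ltP 2^-1 (x ^+ 2)) => hx.
  suff h : expR x <= expR (2 * x ^+ 2) /\ expR (- x) <= expR (2 * x ^+ 2) by lra.
  by split; rewrite ler_expR; nra.
have hb : -1 < x < 1 by apply/andP; split; nra.
case/andP: hb => h1 h2.
have e1 : expR x <= (1 - x)^-1.
  rewrite -[expR x]invrK -expRN lef_pV2 ?posrE ?expR_gt0 ?subr_gt0 //.
  exact: expR_ge1Dx.
have e2 : expR (- x) <= (1 + x)^-1.
  rewrite expRN lef_pV2 ?posrE ?expR_gt0 //; last by lra.
  exact: expR_ge1Dx.
have e3 : ((1 - x)^-1 + (1 + x)^-1) / 2 <= 1 + 2 * x ^+ 2.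
  have -> : ((1 - x)^-1 + (1 + x)^-1) / 2 = (1 - x ^+ 2)^-1.
    by field; apply/and3P; split; apply: lt0r_neq0; nra.
  rewrite -[X in X <= _]mul1r ler_pdivrMr; nra.
have := expR_ge1Dx (2 * x ^+ 2); lra.
Qed.

Lemma Ex_mgf N a (y : R) :
  Ex N (fun r => expR (y * lin N a r)) <= expR (2 * y ^+ 2 * \sum_(i < N) a i ^+ 2).
Proof.
elim: N a => [|N IH] a /=; first by rewrite /lin !big_ord0 !mulr0.
have E x : Ex N (fun w => expR (y * lin N.+1 a (x :: w))) =
    expR (y * a 0%N * sgn x) * Ex N (fun r => expR (y * lin N (fun i => a i.+1) r)).
  by rewrite -ExZ; apply: eq_Ex => w _; rewrite lin_cons mulrDr expRD mulrA.
rewrite (E false) (E true) -mulrDl mulrAC big_ord_recl mulrDr expRD ler_pM //.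
- by rewrite divr_ge0 ?addr_ge0 ?expR_ge0 ?ler0n.
- by rewrite -[X in X <= _](Ex_cst N); apply: Ex_le => w _; exact: expR_ge0.
- have := cosh_le (y * a 0%N); rewrite /sgn mulrN1 mulr1 exprMn mulrA addrC; exact.
Qed.

(** Chernoff bound: each sign of the deviation is handled by the exponential moment at [y] or at
    [- y]. *)
Lemma lin_tail N (a : nat -> R) (s : R) : 0 < s ->
  Ex N (fun r => (s * \sum_(i < N) a i ^+ 2 < lin N a r ^+ 2)%R%:R) <= 2 * expR (- (s / 8)).
Proof.
move=> s0; set A := \sum_(i < N) _.
have A0 : 0 <= A by apply: sumr_ge0 => i _; exact: sqr_ge0.
case: (eqVneq A 0) => [Az|An].
  rewrite (@eq_Ex _ _ (fun=> 0)) ?Ex_cst ?mulr_ge0 ?expR_ge0 // => r _.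
  have az (i : 'I_N) : a i = 0.
    have /eqP := Az; rewrite /A psumr_eq0 => [/allP/(_ i)|j _]; last exact: sqr_ge0.
    by rewrite mem_index_enum sqrf_eq0 => /(_ isT)/eqP.
  have -> : lin N a r = 0 by rewrite /lin big1 // => i _; rewrite az mul0r.
  by rewrite Az mulr0 expr0n ltxx.
have Ap : 0 < A by rewrite lt_neqAle eq_sym An.
pose t := Num.sqrt (s * A); have t2 : t ^+ 2 = s * A by rewrite sqr_sqrtr // mulr_ge0 // ltW.
have t0 : 0 <= t by exact: sqrtr_ge0.
(* Minimises [2 * y ^+ 2 * A - y * t]; the minimum is [s / 8 - s / 4]. *)
pose y := t / (4 * A).
have y0 : 0 <= y by rewrite divr_ge0 // mulr_ge0.
have yt : y * t = s / 4.
  by rewrite /y mulrAC -expr2 t2; field; rewrite An.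
have y2 : 2 * y ^+ 2 * A = s / 8.
  by rewrite /y exprMn t2; field; rewrite An.
apply: (@le_trans _ _ (Ex N (fun r => expR (- (s / 4)) * expR (y * lin N a r) +
    expR (- (s / 4)) * expR (- y * lin N a r)))).
  apply: Ex_le => r _; set x := lin N a r; rewrite -!expRD.
  case: ltP => hx; last by rewrite addr_ge0 ?expR_ge0.
  have e1 := expR_ge0 (- (s / 4) + y * x); have e2 := expR_ge0 (- (s / 4) + - y * x).
  case: (lerP 0 x) => x0.
    have tx : t < x by rewrite -(@ltr_pXn2r _ 2) ?nnegrE // t2.
    suff : 1 <= expR (- (s / 4) + y * x) by rewrite /=; lra.
    by rewrite -[X in X <= _]expR0 ler_expR -yt; nra.
  have tx : t < - x by rewrite -(@ltr_pXn2r _ 2) ?nnegrE ?sqrrN ?t2 // oppr_ge0 ltW.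
  suff : 1 <= expR (- (s / 4) + - y * x) by rewrite /=; lra.
  by rewrite -[X in X <= _]expR0 ler_expR -yt; nra.
rewrite ExD !ExZ -mulrDr.
have h1 := Ex_mgf N a y; have h2 := Ex_mgf N a (- y).
rewrite sqrrN -/A y2 in h2; rewrite -/A y2 in h1.
have -> : 2 * expR (- (s / 8)) = expR (- (s / 4)) * (expR (s / 8) + expR (s / 8)).
  have -> : - (s / 8) = - (s / 4) + s / 8 by field.
  by rewrite expRD; ring.
by rewrite ler_wpM2l ?expR_ge0 // lerD.
Qed.
End CoinExpectation.

(** * The averaging walk *)

Section Walk.
Variables (R : realType) (N : nat).
Implicit Types (M : nat -> nat -> R) (pi : nat -> nat).

Definition involution_on pi : Prop :=
  forall i, (i < N)%N -> (pi i < N)%N /\ pi (pi i) = i.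

Lemma sum_involution (V : nmodType) pi (F : nat -> V) (P : pred nat) : involution_on pi ->
  \sum_(i < N | P i) F i = \sum_(i < N | P (pi i)) F (pi i).
Proof.
move=> h; pose f (i : 'I_N) : 'I_N := Ordinal (h i (ltn_ord i)).1.
rewrite (reindex_inj (h := f)) //= => i j /(congr1 val) /= E; apply: val_inj.
by rewrite /= -(h i (ltn_ord i)).2 E (h j (ltn_ord j)).2.
Qed.

Definition avg pi M : nat -> nat -> R := fun i j => (M i j + M (pi i) j) / 2.

Definition psi M : R := \sum_(i < N) \sum_(j < N) (M i j - N%:R^-1) ^+ 2.

Definition stochastic M : Prop :=
  [/\ forall i j, 0 <= M i j,
      forall i, (i < N)%N -> \sum_(j < N) M i j = 1 &
      forall j, (j < N)%N -> \sum_(i < N) M i j = 1].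

Lemma stochastic_avg pi M : involution_on pi -> stochastic M -> stochastic (avg pi M).
Proof.
move=> hpi [h1 h2 h3]; split.
- by move=> i j; rewrite divr_ge0 // addr_ge0.
- move=> i hi; rewrite -mulr_suml big_split /= h2 // h2; [by field|exact: (hpi _ hi).1].
- move=> j hj; rewrite -mulr_suml big_split /=.
  by rewrite -(@sum_involution _ pi (fun i => M i j) xpredT) // h3 //; field.
Qed.

(** The parallelogram identity for the deviations of rows [i] and [pi i], after writing [psi M] as
    half of its sum with its reindexing by [pi]. *)
Lemma psi_avg pi M : involution_on pi ->
  psi (avg pi M) = psi M - (\sum_(i < N) \sum_(j < N) (M i j - M (pi i) j) ^+ 2) / 4.
Proof.
move=> hpi; have E : psi M = \sum_(i < N) \sum_(j < N) (M (pi i) j - N%:R^-1) ^+ 2.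
  exact: (@sum_involution _ pi (fun i => \sum_(j < N) (M i j - N%:R^-1) ^+ 2) xpredT hpi).
have -> : psi M = (psi M + psi M) / 2 by field.
rewrite {2}E /psi -big_split /= !mulr_suml -sumrB; apply: eq_bigr => i _.
rewrite -big_split /= !mulr_suml -sumrB; apply: eq_bigr => j _.
by rewrite /avg; move: (N%:R^-1) => z; field.
Qed.

Lemma psi_ge0 M : 0 <= psi M.
Proof. by apply: sumr_ge0 => i _; apply: sumr_ge0 => j _; exact: sqr_ge0. Qed.

(* One round: any potential bounded by that of the walk averaged along a perfect
   matching across a median cut of the random projection decreases on average. *)
Section Round.
Variables (M : nat -> nat -> R) (s : R) (F : seq bool -> R).
Hypotheses (hM : stochastic M) (N0 : (0 < N)%N) (s0 : 0 < s).
Hypothesis s_big : 2 * expR (- (s / 8)) * (N%:R * N.+1%:R) <= (2 * N%:R)^-1.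

(** Either end may be the lower one: only the separation by [eta] matters. *)
Definition median_matching (u : nat -> R) (pi : nat -> nat) : Prop :=
  involution_on pi /\
  exists eta : R, forall i, (i < N)%N -> (u i <= eta <= u (pi i)) || (u (pi i) <= eta <= u i).

Hypothesis hF : forall r, size r = N ->
  F r <= 0 \/ exists2 pi, median_matching (fun i => lin N (M i) r) pi & F r <= psi (avg pi M).

(** Index [N] stands for the uniform row, so that [dif] covers both the differences of two rows and
    the deviation of a row from uniform. *)
Let row (i : nat) : nat -> R := if (i < N)%N then M i else fun=> N%:R^-1.
Let dif (i j : nat) : nat -> R := fun k => row i k - row j k.
Let nrm (a : nat -> R) : R := \sum_(k < N) a k ^+ 2.
Let bad (i j : nat) (r : seq bool) : R := (s * nrm (dif i j) < lin N (dif i j) r ^+ 2)%R%:R.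

Let lin_dif i j r : lin N (dif i j) r = lin N (row i) r - lin N (row j) r.
Proof. by rewrite /lin -sumrB; apply: eq_bigr => k _; rewrite /dif mulrBl. Qed.

Let psiE : psi M = \sum_(i < N) nrm (dif i N).
Proof.
by apply: eq_bigr => i _; apply: eq_bigr => j _; rewrite /dif /row ltn_ord ltnn.
Qed.

Let spread (r : seq bool) : R := \sum_(i < N) lin N (dif i N) r ^+ 2.

Let Ex_spread : Ex N spread = psi M.
Proof. by rewrite Ex_sum psiE; apply: eq_bigr => i _; rewrite Ex_lin_sqr. Qed.

(** Cauchy-Schwarz, through the identity of Lagrange. This worst case is what is charged to a bad
    outcome of the coins. *)
Let spread_le r : spread r <= N%:R * psi M.
Proof.
rewrite psiE mulr_sumr; apply: ler_sum => i _; move: (dif i N) => a.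
rewrite /lin /nrm.
have -> : N%:R = \sum_(k < N) (sgn R (nth false r k)) ^+ 2.
  rewrite (eq_bigr (fun=> 1)) => [|k _]; last by rewrite /sgn; case: ifP; rewrite ?sqrrN expr1n.
  by rewrite sumr_const card_ord.
pose b k := sgn R (nth false r k).
have H : 0 <= \sum_(k < N) \sum_(l < N) (a k * b l - a l * b k) ^+ 2.
  by apply: sumr_ge0 => k _; apply: sumr_ge0 => l _; exact: sqr_ge0.
have E : \sum_(k < N) \sum_(l < N) (a k * b l - a l * b k) ^+ 2 =
   2 * ((\sum_(k < N) b k ^+ 2) * (\sum_(k < N) a k ^+ 2) - (\sum_(k < N) a k * b k) ^+ 2).
  transitivity (\sum_(k < N) \sum_(l < N) (a k ^+ 2 * b l ^+ 2) +
     \sum_(k < N) \sum_(l < N) (b k ^+ 2 * a l ^+ 2) -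
     2 * \sum_(k < N) \sum_(l < N) ((a k * b k) * (a l * b l))).
    rewrite mulr_sumr -sumrN -!big_split /=; apply: eq_bigr => k _.
    rewrite mulr_sumr -sumrN -!big_split /=; apply: eq_bigr => l _; ring.
  by rewrite -!big_distrlr /=; ring.
rewrite E in H; rewrite /b in H; lra.
Qed.

Let sum_lin_dif r : \sum_(i < N) lin N (dif i N) r = 0.
Proof.
rewrite exchange_big /= big1 // => k _; rewrite -mulr_suml sumrB /row ltnn.
rewrite (eq_bigr (fun i : 'I_N => M i k)); last by move=> i _; rewrite ltn_ord.
have -> : \sum_(i < N) (N%:R^-1 : R) = 1.
  by rewrite sumr_const card_ord -[LHS]mulr_natl divff // pnatr_eq0 -lt0n.
by case: hM => _ _ -> //; rewrite subrr mul0r.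
Qed.

(** If [eta] lies between [x] and [y], then [(x - y) ^+ 2] is at least
    [(x - eta) ^+ 2 + (y - eta) ^+ 2]. By [sum_lin_dif] the projections have mean [ub], so measuring
    squares from [eta] instead of [ub] only increases their sum. *)
Let median_spread r pi : size r = N -> median_matching (fun i => lin N (M i) r) pi ->
  2 * spread r <= \sum_(i < N) lin N (dif i (pi i)) r ^+ 2.
Proof.
move=> hr [hpi [eta heta]]; pose ub := lin N (row N) r.
have D (i : 'I_N) : lin N (M i) r = lin N (dif i N) r + ub.
  by rewrite lin_dif {1}/row ltn_ord /ub subrK.
have low (i : 'I_N) : (lin N (dif i N) r + (ub - eta)) ^+ 2 +
   (lin N (dif (pi i) N) r + (ub - eta)) ^+ 2 <= lin N (dif i (pi i)) r ^+ 2.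
  have [hp _] := hpi i (ltn_ord i); have := heta i (ltn_ord i).
  rewrite -[pi i]/(nat_of_ord (Ordinal hp)) !D !lin_dif.
  move: (lin N (row i) r) (lin N (row _) r) => x y.
  by rewrite -/ub => /orP[]/andP[h1 h2]; nra.
apply: le_trans (ler_sum _ (fun i _ => low i)).
rewrite big_split /= -(@sum_involution _ pi (fun i => (lin N (dif i N) r + (ub - eta)) ^+ 2) xpredT) //.
rewrite -mulr2n -[X in _ <= X]mulr_natl ler_pM2l ?ltr0n //.
rewrite (eq_bigr (fun i : 'I_N => lin N (dif i N) r ^+ 2 +
   (2 * (ub - eta) * lin N (dif i N) r + (ub - eta) ^+ 2))); last by move=> i _; ring.
rewrite big_split /= lerDl big_split /= -mulr_sumr sum_lin_dif mulr0 add0r.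
by apply: sumr_ge0 => i _; exact: sqr_ge0.
Qed.

Let nbad (r : seq bool) : R := \sum_(i < N) \sum_(j < N.+1) bad i j r.

Let nbad_cases r : 1 <= nbad r \/
  forall i j, (i < N)%N -> (j < N.+1)%N -> lin N (dif i j) r ^+ 2 <= s * nrm (dif i j).
Proof.
have bad0 i j : 0 <= bad i j r by rewrite ler0n.
case: (pselect (exists i j, [/\ (i < N)%N, (j < N.+1)%N &
    s * nrm (dif i j) < lin N (dif i j) r ^+ 2])) => [[i [j [hi hj hb]]]|hn].
  left; rewrite /nbad (bigD1 (Ordinal hi)) //= (bigD1 (Ordinal hj)) //= {1}/bad hb.
  by rewrite -addrA lerDl addr_ge0 ?sumr_ge0 // => k _; rewrite sumr_ge0.
right=> i j hi hj; rewrite leNgt; apply/negP => hb; apply: hn.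
by exists i, j.
Qed.

(** Without a bad pair, a squared row difference is at least its squared projection divided by [s],
    and [psi_avg] with [median_spread] yields a drop of [spread r / (2 * s)]. With a bad pair, the
    potential at least does not grow, and the term in [nbad] pays for [spread r]. *)
Let round_pointwise r : size r = N ->
  F r <= psi M + (2 * s)^-1 * (N%:R * psi M * nbad r - spread r).
Proof.
move=> hr; have p0 := psi_ge0 M.
have s2 : 0 < (2 * s)^-1 by rewrite invr_gt0 mulr_gt0.
have avg_le pi : median_matching (fun i => lin N (M i) r) pi -> psi (avg pi M) <= psi M.
  move=> [hpi _]; rewrite psi_avg // gerBl divr_ge0 // sumr_ge0 // => i _.
  by rewrite sumr_ge0 // => j _; exact: sqr_ge0.
case: (nbad_cases r) => hb.
  have Fle : F r <= psi M.
    by case: (hF hr) => [/le_trans|[pi /avg_le h1 h2]]; [exact|exact: le_trans h1].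
  apply: le_trans Fle _; rewrite lerDl mulr_ge0 ?subr_ge0 ?(ltW s2) //.
  apply: le_trans (spread_le r) _; rewrite ler_peMr // mulr_ge0 //.
have nb0 : 0 <= nbad r.
  by rewrite /nbad sumr_ge0 // => i _; rewrite sumr_ge0.
suff : F r <= psi M - (2 * s)^-1 * spread r.
  move/le_trans; apply; rewrite mulrBr addrA lerB // lerDl.
  by rewrite mulr_ge0 ?(ltW s2) // mulr_ge0 // mulr_ge0.
case: (hF hr) => [h0|[pi hpi h1]].
  apply: le_trans h0 _; rewrite subr_ge0.
  have h : spread r <= s * psi M.
    by rewrite psiE mulr_sumr; apply: ler_sum => i _; exact: hb.
  have : (2 * s)^-1 * spread r <= (2 * s)^-1 * (s * psi M) by rewrite ler_pM2l.
  have -> : (2 * s)^-1 * (s * psi M) = psi M / 2 by field; rewrite gt_eqF.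
  lra.
apply: le_trans h1 _; rewrite psi_avg; last by case: hpi.
rewrite lerB //; have := median_spread hr hpi.
have h : \sum_(i < N) lin N (dif i (pi i)) r ^+ 2 <=
    s * \sum_(i < N) \sum_(j < N) (M i j - M (pi i) j) ^+ 2.
  rewrite mulr_sumr; apply: ler_sum => i _.
  case: hpi => hpi _; have [hp _] := hpi i (ltn_ord i).
  apply: le_trans (hb i (pi i) _ _) _ => //; first exact: ltnW.
  rewrite ler_pM2l // /nrm (eq_bigr (fun j : 'I_N => (M i j - M (pi i) j) ^+ 2)) // => j _.
  by rewrite /dif /row ltn_ord hp.
move=> h2; have {h2}h : 2 * spread r <= s * \sum_(i < N) \sum_(j < N) (M i j - M (pi i) j) ^+ 2.
  exact: le_trans h2 h.
move: h; move: (\sum_(i < N) _) => S h.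
rewrite mulrC ler_pdivrMr ?mulr_gt0 //; lra.
Qed.

(** The mean of [spread] is [psi M], that of the bad term at most [psi M / 2]; the remaining
    [psi M / 2], divided by [2 * s], is the gain. *)
Lemma expected_drop : Ex N F <= (1 - (4 * s)^-1) * psi M.
Proof.
apply: le_trans (Ex_le round_pointwise) _.
rewrite ExD Ex_cst ExZ.
have -> : Ex N (fun r => N%:R * psi M * nbad r - spread r) =
    N%:R * psi M * Ex N nbad - psi M.
  rewrite (@eq_Ex _ _ _ (fun r => N%:R * psi M * nbad r + -1 * spread r)).
    by rewrite ExD !ExZ Ex_spread mulN1r.
  by move=> r _; rewrite mulN1r.
(* Union bound over the [N * N.+1] pairs, those with the uniform row included. *)
have hb : Ex N nbad <= (2 * N%:R)^-1.
  apply: le_trans s_big; rewrite Ex_sum.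
  apply: le_trans (_ : \sum_(i < N) \sum_(j < N.+1) 2 * expR (- (s / 8)) <= _).
    apply: ler_sum => i _; rewrite Ex_sum; apply: ler_sum => j _; exact: lin_tail.
  by rewrite !sumr_const !card_ord -mulrnA -[leLHS]mulr_natr natrM [X in _ * X <= _]mulrC.
have p0 := psi_ge0 M.
have Np : 0 < N%:R :> R by rewrite ltr0n.
have h : N%:R * psi M * Ex N nbad <= psi M / 2.
  apply: le_trans (ler_wpM2l _ hb) _; first by rewrite mulr_ge0 // ltW.
  have -> : N%:R * psi M / (2 * N%:R) = psi M / 2 by field; rewrite gt_eqF.
  by [].
have s2 : 0 < (2 * s)^-1 by rewrite invr_gt0 mulr_gt0.
apply: (@le_trans _ _ (psi M + (2 * s)^-1 * (- (psi M / 2)))).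
  by rewrite lerD2l ler_pM2l //; lra.
have -> : (1 - (4 * s)^-1) * psi M = psi M + (2 * s)^-1 * (- (psi M / 2)).
  by field; rewrite gt_eqF.
by [].
Qed.
End Round.

(** Entry [i j] is the amount now at [i] that started at [j]. *)
Definition walk (pis : seq (nat -> nat)) : nat -> nat -> R :=
  foldl (fun M pi => avg pi M) (fun i j => (i == j)%:R) pis.

Definition involutions (pis : seq (nat -> nat)) : Prop :=
  forall k, (k < size pis)%N -> involution_on (nth id pis k).

Lemma involutions_rcons pis pi : involutions (rcons pis pi) -> involutions pis /\ involution_on pi.
Proof.
move=> h; split=> [k hk|]; first by have := h k; rewrite size_rcons ltnS nth_rcons hk; apply; exact: ltnW.
by have := h (size pis); rewrite size_rcons ltnS leqnn nth_rcons ltnn eqxx => /(_ isT).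
Qed.

Lemma walk_rcons pis pi : walk (rcons pis pi) = avg pi (walk pis).
Proof. by rewrite /walk foldl_rcons. Qed.

Lemma stochastic_walk pis : involutions pis -> stochastic (walk pis).
Proof.
elim/last_ind: pis => [|pis pi IH /involutions_rcons[h1 h2]]; last first.
  by rewrite walk_rcons; apply: stochastic_avg => //; exact: IH.
move=> _; rewrite /walk /=; split=> [i j|i hi|j hj]; first by rewrite ler0n.
  rewrite (bigD1 (Ordinal hi)) //= eqxx big1 ?addr0 // => j.
  by rewrite -val_eqE /= eq_sym => /negPf->.
rewrite (bigD1 (Ordinal hj)) //= eqxx big1 ?addr0 // => i.
by rewrite -val_eqE /= => /negPf->.
Qed.

Lemma psi_walk0 : (0 < N)%N -> psi (walk [::]) <= N%:R.
Proof.
move=> N0; rewrite /psi /walk /=.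
have Np : 0 < N%:R :> R by rewrite ltr0n.
rewrite -[leRHS]mulr1 -[in leRHS](card_ord N) mulr_natl -sumr_const; apply: ler_sum => i _.
rewrite (eq_bigr (fun j : 'I_N => (i == j)%:R * (1 - 2 * N%:R^-1) + N%:R^-1 ^+ 2)); last first.
  by move=> j _; rewrite -val_eqE; case: (_ == _) => /=; ring.
rewrite big_split /= -mulr_suml.
rewrite (bigD1 i) //= eqxx big1 => [|j]; last by rewrite eq_sym => /negPf->.
have -> : \sum_(j < N) (N%:R^-1 ^+ 2 : R) = N%:R^-1.
  by rewrite sumr_const card_ord -[LHS]mulr_natl; field; rewrite gt_eqF.
have : 0 <= N%:R^-1 :> R by rewrite invr_ge0 ltW.
rewrite /= addr0 mul1r; lra.
Qed.

(* Mass starting in [A] only leaves [A] along matched pairs that [A] separates,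
   at most half a unit for each; once the walk is mixed, a constant fraction of
   it must have left. *)
Lemma mixing_cut pis (A : pred nat) (X : nat) : (0 < N)%N -> involutions pis ->
  (forall k, (k < size pis)%N -> (\sum_(i < N) (A i != A (nth id pis k i)) <= X)%N) ->
  psi (walk pis) <= (4 * N%:R ^+ 2)^-1 ->
  (\sum_(i < N) A i)%N%:R * (\sum_(i < N) ~~ A i)%N%:R <= N%:R * (size pis)%:R * X%:R :> R.
Proof.
move=> N0 hinv hX hpsi.
pose mass (M : nat -> nat -> R) i := \sum_(j < N | A j) M i j.
have Np : 0 < N%:R :> R by rewrite ltr0n.
have upper : \sum_(i < N | ~~ A i) mass (walk pis) i <= (size pis)%:R * X%:R / 2.
  move: hinv hX; clear hpsi; elim/last_ind: pis => [_ _|pis pi IH /involutions_rcons[h1 h2] hX].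
    rewrite mul0r mul0r big1 // => i Ai; rewrite /mass big1 // => j Aj.
    by rewrite /walk /=; case: eqP => // ij; move: Ai; rewrite ij Aj.
  have {}IH := IH h1.
  have {}IH : \sum_(i < N | ~~ A i) mass (walk pis) i <= (size pis)%:R * X%:R / 2.
    apply: IH => k hk; have := hX k; rewrite size_rcons ltnS nth_rcons hk.
    by apply; exact: ltnW.
  have {}hX : (\sum_(i < N) (A i != A (pi i)) <= X)%N.
    by have := hX (size pis); rewrite size_rcons ltnS leqnn nth_rcons ltnn eqxx; apply.
  have hs := stochastic_walk h1; set M := walk pis in IH hs *.
  have mass0 i : 0 <= mass M i by apply: sumr_ge0 => j _; case: hs.
  have mass1 i : (i < N)%N -> mass M i <= 1.
    move=> hi; case: hs => h3 h4 _; rewrite -(h4 i hi) /mass [leRHS](bigID (fun j : 'I_N => A j)) /=.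
    by rewrite lerDl sumr_ge0.
  rewrite walk_rcons size_rcons -/M.
  have -> : \sum_(i < N | ~~ A i) mass (avg pi M) i =
     (\sum_(i < N | ~~ A i) mass M i + \sum_(i < N | ~~ A i) mass M (pi i)) / 2.
    rewrite -big_split mulr_suml; apply: eq_bigr => i _ /=.
    by rewrite -big_split /= mulr_suml; apply: eq_bigr.
  have : \sum_(i < N | ~~ A i) mass M (pi i) <= \sum_(i < N | ~~ A i) mass M i + X%:R.
    rewrite (bigID (fun i : 'I_N => A (pi i))) /= addrC lerD //.
      rewrite (@sum_involution _ pi (mass M) (fun i => ~~ A i)) //.
      rewrite [leRHS](bigID (fun i : 'I_N => A i)) /= -[leLHS]add0r lerD ?sumr_ge0 //.
      by rewrite (eq_bigl (fun i : 'I_N => ~~ A (pi i) && ~~ A i)) // => i; rewrite andbC.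
    apply: (@le_trans _ _ (\sum_(i < N) (A i != A (pi i))%:R)); last first.
      by rewrite -natr_sum ler_nat.
    rewrite big_mkcond; apply: ler_sum => i _.
    by have := mass1 _ (h2 i (ltn_ord i)).1; case: (A i); case: (A (pi i)).
  have -> : (size pis).+1%:R = (size pis)%:R + 1 :> R by rewrite -natr1.
  move: IH; lra.
(* An entry further than [1 / (2 N)] from [1 / N] would alone exceed the bound on the potential, so
   every entry is at least half of its uniform value. *)
have lower i j : (i < N)%N -> (j < N)%N -> (2 * N%:R)^-1 <= walk pis i j.
  move=> hi hj; have h : (walk pis i j - N%:R^-1) ^+ 2 <= (4 * N%:R ^+ 2)^-1.
    apply: le_trans hpsi; rewrite /psi (bigD1 (Ordinal hi)) //= (bigD1 (Ordinal hj)) //=.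
    rewrite -addrA lerDl addr_ge0 ?sumr_ge0 // => k _; rewrite ?sqr_ge0 ?sumr_ge0 // => l _.
    exact: sqr_ge0.
  have e : N%:R^-1 = 2 * (2 * N%:R)^-1 :> R by field; rewrite gt_eqF.
  have e2 : (4 * N%:R ^+ 2)^-1 = (2 * N%:R)^-1 ^+ 2 :> R by field; rewrite gt_eqF.
  have e3 : 0 < (2 * N%:R)^-1 :> R by rewrite invr_gt0 mulr_gt0.
  move: h; rewrite e e2; nra.
have lower2 : (\sum_(i < N) A i)%N%:R * (\sum_(i < N) ~~ A i)%N%:R * (2 * N%:R)^-1 <=
    \sum_(i < N | ~~ A i) mass (walk pis) i.
  have E (P : pred nat) : (\sum_(i < N) P i)%N%:R = \sum_(i < N | P i) 1 :> R.
    by rewrite natr_sum [RHS]big_mkcond; apply: eq_bigr => i _; case: (P i).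
  rewrite (E A) (E (fun i => ~~ A i)) mulrC mulrA mulr_sumr; apply: ler_sum => i _.
  rewrite mulr1 mulr_sumr; apply: ler_sum => j _; rewrite mulr1; exact: lower.
have := le_trans lower2 upper; rewrite ler_pdivrMr ?mulr_gt0 // => /le_trans; apply.
by rewrite le_eqVlt; apply/orP; left; apply/eqP; field.
Qed.
End Walk.

(** * Splitting a flow into paths *)

(** Additions stand on both sides because subtraction of naturals truncates; [s] lists the few
    places that an update of the heap changes. *)
Lemma sum_update (F F' : nat -> nat) (n : nat) (s : seq nat) : uniq s ->
  all (fun h => h < n)%N s -> (forall h, (h < n)%N -> h \notin s -> F' h = F h) ->
  (\sum_(h < n) F' h + \sum_(h <- s) F h = \sum_(h < n) F h + \sum_(h <- s) F' h)%N.
Proof.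
move=> us /allP ls hF.
have E (G : nat -> nat) : (\sum_(h < n) G h =
    \sum_(h <- s) G h + \sum_(h <- [seq h <- iota 0 n | h \notin s]) G h)%N.
  rewrite -(big_mkord xpredT G) /index_iota subn0 (bigID (fun h => h \in s)) /= big_filter.
  congr (_ + _)%N; rewrite -big_filter; apply: perm_big; apply: uniq_perm => //.
    by rewrite filter_uniq // iota_uniq.
  by move=> h; rewrite mem_filter mem_iota /= add0n; case hs : (h \in s); rewrite //= ls.
have e : (\sum_(h <- [seq h <- iota 0 n | h \notin s]) F' h =
          \sum_(h <- [seq h <- iota 0 n | h \notin s]) F h)%N.
  by apply: eq_big_seq => h; rewrite mem_filter mem_iota add0n => /andP[h1 /andP[_ h2]]; exact: hF.
rewrite (E F) (E F') e; move: (\sum_(h <- s) F h)%N (\sum_(h <- s) F' h)%N => S1 S2.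
by rewrite addnAC [in RHS]addnAC (addnC S1).
Qed.

Record heap := Heap {
  am : nat -> nat; mt : nat -> nat; vt : nat -> nat; si : nat -> bool; fr : nat }.

Section Heap.
(* Half-arcs: [h] carries [am h] units at place [vt h] (a vertex when below [n],
   otherwise the source or the sink), leaves it when [si h] and enters it
   otherwise, and is paired with the opposite half [mt h].  A half of amount [0]
   is dead.  [Tm] are the terminal halves, located by [home] at the vertex of
   their dart. *)
Variables (n K : nat) (Tm : pred nat) (home : nat -> nat) (X : pred nat -> nat).

Definition loc (H : heap) (h : nat) : nat := if (vt H h < n)%N then vt H h else home h.

Definition side_sum (H : heap) (w : nat) (s : bool) : nat :=
  (\sum_(h < fr H) ((vt H h == w) && (si H h == s)) * am H h)%N.

(** Every flow between mates is counted at both halves. Once only terminals are live, this counts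
    each matched pair of darts separated by [U] twice. *)
Definition crossing (H : heap) (U : pred nat) : nat :=
  (\sum_(h < fr H) am H h * (U (loc H h) != U (loc H (mt H h))))%N.

Record hinv (H : heap) : Prop := HInv {
  h_mate : forall h, (h < fr H)%N -> (0 < am H h)%N ->
    [/\ (mt H h < fr H)%N, mt H (mt H h) = h, am H (mt H h) = am H h &
        si H (mt H h) = ~~ si H h];
  h_place : forall h, (h < fr H)%N -> (vt H h < n.+2)%N;
  h_cons : forall w, (w < n)%N -> side_sum H w true = side_sum H w false;
  h_cut : forall U, (crossing H U <= X U)%N;
  h_term : forall h, (h < fr H)%N -> (0 < am H h)%N -> (n <= vt H h)%N -> am H h = 1%N /\ Tm h;
  h_termP : forall h, Tm h -> [/\ (h < fr H)%N, am H h = 1%N & (n <= vt H h)%N];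
  h_side : forall h, (h < K + K)%N -> si H h = (h < K)%N;
  h_fresh : (K + K <= fr H)%N }.

Definition kill (H : heap) (p : nat) : heap :=
  Heap (fun h => if (h == p) || (h == mt H p) then 0%N else am H h) (mt H) (vt H) (si H) (fr H).

(** Afterwards [a] and [b] are mates carrying [x]; [q] and the new half [z], placed like [b], are
    mates carrying the excess [y - x], which may be zero. *)
Definition link (H : heap) (p q : nat) : heap :=
  let a := mt H p in let b := mt H q in let z := fr H in
  let x := am H p in let y := am H q in
  Heap
   (fun h => if h == p then 0%N else if (h == q) || (h == z) then (y - x)%N
             else if h == b then x else am H h)
   (fun h => if h == z then q else if h == q then z else if h == b then a
             else if h == a then b else mt H h)
   (fun h => if h == z then vt H b else vt H h)
   (fun h => if h == z then si H b else si H h)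
   z.+1.

Lemma hinv_kill H p : hinv H -> (p < fr H)%N -> (0 < am H p)%N -> (vt H p < n)%N ->
  vt H (mt H p) = vt H p -> hinv (kill H p).
Proof.
move=> hI hp ap vp va; have [ha maa ama sia] := h_mate hI hp ap.
set a := mt H p in ha maa ama sia va *.
have pa : p != a by apply/eqP => E; move: sia; rewrite -E; case: (si H p).
split => /=; try by case: hI.
- move=> h hh; case: ifP => // hn h0; have [h1 h2 h3 h4] := h_mate hI hh h0.
  split=> //; rewrite -/a; case: ifP => // /orP[]/eqP E.
    by move: hn; rewrite -h2 E eqxx orbT.
  by move: hn; rewrite -h2 E maa eqxx.
- move=> w hw; have := h_cons hI hw; rewrite /side_sum /=.
  have U s := @sum_update
     (fun h => ((vt H h == w) && (si H h == s)) * am H h)%N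
     (fun h => ((vt H h == w) && (si H h == s)) * (if (h == p) || (h == mt H p) then 0 else am H h))%N
     (fr H) [:: p; a].
  have {U}U s := U s ltac:(by rewrite /= inE pa) ltac:(by rewrite /= hp ha)
    ltac:(by move=> h _; rewrite !inE negb_or => /andP[/negPf-> /negPf->]).
  have := U true; have := U false; rewrite !big_cons !big_nil -/a !eqxx !orbT /= va ama sia !muln0.
  case: (vt H p == w); case: (si H p) => /=; lia.
- move=> U; apply: leq_trans (h_cut hI U); apply: leq_sum => h _.
  by apply: leq_mul => //=; case: (_ || _).
- move=> h hh; case: ifP => // _; exact: h_term hI _ hh.
- move=> h /(h_termP hI)[h1 h2 h3]; split=> //; case: ifP => // /orP[]/eqP E; move: h3.
    by rewrite E leqNgt vp.
  by rewrite E -/a va leqNgt vp.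
Qed.

(** At the vertex, [am H p] units disappear from each side, so conservation persists. For the cut
    bound, the route from one mate through the vertex to the other becomes a direct pair: [U]
    separates its ends only if it separates one of them from the vertex. *)
Lemma hinv_link H p q : hinv H -> (p < fr H)%N -> (q < fr H)%N -> (0 < am H p)%N ->
  (am H p <= am H q)%N -> (vt H p < n)%N -> vt H q = vt H p -> si H p = ~~ si H q ->
  vt H (mt H p) != vt H p -> vt H (mt H q) != vt H p -> hinv (link H p q).
Proof.
move=> hI hp hq ap apq vp vq sp va vb.
have aq : (0 < am H q)%N by exact: leq_trans apq.
have [ha maa ama sia] := h_mate hI hp ap.
have [hb mbb amb sib] := h_mate hI hq aq.
set a := mt H p in ha maa ama sia va *; set b := mt H q in hb mbb amb sib vb *.
have pq : p == q = false by apply/eqP => E; move: sp; rewrite E; case: (si H q).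
have pa : p == a = false by apply/eqP => E; move: sia; rewrite -E; case: (si H p).
have qb : q == b = false by apply/eqP => E; move: sib; rewrite -E; case: (si H q).
have qa : q == a = false by apply/eqP => E; move: va; rewrite -E vq eqxx.
have pb : p == b = false by apply/eqP => E; move: vb; rewrite -E eqxx.
have ab : a == b = false by apply/eqP => E; move: sia; rewrite E sib sp; case: (si H q).
have lt_z h : (h < fr H)%N -> h == fr H = false by move=> h1; rewrite ltn_eqF.
have [zp zq za zb] := And4 (lt_z _ hp) (lt_z _ hq) (lt_z _ ha) (lt_z _ hb).
have sym x y : (x == y :> nat) = false -> (y == x) = false by rewrite eq_sym.
(* A terminal carries a single unit, so a splice next to it leaves no excess, and the new half never
   has to be located by its own [home]. *)
have tb : (n <= vt H b)%N -> am H p = 1%N /\ am H q = 1%N.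
  by move=> h; have [] := h_term hI hb _ h; rewrite ?amb //; lia.
split.
- move=> h; rewrite /= ltnS leq_eqVlt => /orP[/eqP->|hh].
    rewrite eqxx (sym _ _ zp) orbT -/a -/b => h0; rewrite (sym _ _ pq) zq eqxx /=.
    by split; rewrite ?ltnS ?(ltnW hq) ?sib ?negbK.
  rewrite (lt_z h hh) -/a -/b; case: (eqVneq h p) => [//|hnp].
  rewrite orbF; case: (eqVneq h q) => [->|hnq] /=.
    by rewrite eqxx (sym _ _ zp) orbT sib => h0; split.
  case: (eqVneq h b) => [-> _|hnb].
    rewrite za (sym _ _ qa) ab eqxx (sym _ _ pa) /=; split=> //; first exact: ltnW.
    by rewrite sia sib sp.
  case: (eqVneq h a) => [-> _|hna].
    rewrite zb (sym _ _ qb) eqxx (sym _ _ pb) /=; split=> //; first exact: ltnW.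
    by rewrite sia sib sp !negbK.
  move=> h0; have [h1 h2 h3 h4] := h_mate hI hh h0.
  have n1 : mt H h == p = false by apply/eqP => E; move: hna; rewrite -h2 E eqxx.
  have n2 : mt H h == q = false by apply/eqP => E; move: hnb; rewrite -h2 E eqxx.
  have n3 : mt H h == a = false by apply/eqP => E; move: hnp; rewrite -h2 E maa eqxx.
  have n4 : mt H h == b = false by apply/eqP => E; move: hnq; rewrite -h2 E mbb eqxx.
  by rewrite (lt_z _ h1) n1 n2 n3 n4 /=; split=> //; exact: ltnW.
- move=> h; rewrite /= ltnS leq_eqVlt => /orP[/eqP->|hh].
    by rewrite eqxx; exact: h_place hI _ hb.
  by rewrite (lt_z h hh); exact: h_place hI _ hh.
- move=> w hw; have := h_cons hI hw; rewrite /side_sum /= !big_ord_recr /= eqxx orbT -/b (sym _ _ zp).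
  have E s : (\sum_(h < fr H) ((((if h == fr H :> nat then vt H b else vt H h) == w) &&
      ((if h == fr H :> nat then si H b else si H h) == s)) *
      (if h == p :> nat then 0 else if (h == q :> nat) || (h == fr H :> nat) then am H q - am H p
       else if h == b :> nat then am H p else am H h)) =
      \sum_(h < fr H) (((vt H h == w) && (si H h == s)) *
      (if h == p :> nat then 0 else if (h == q :> nat) then am H q - am H p
       else if h == b :> nat then am H p else am H h)))%N.
    by apply: eq_bigr => h _; rewrite (lt_z h (ltn_ord h)) orbF.
  rewrite !{}E.
  have U s := @sum_update
     (fun h => ((vt H h == w) && (si H h == s)) * am H h)%N
     (fun h => ((vt H h == w) && (si H h == s)) * (if h == p then 0 else if h == q then am H q - am H p else if h == b then am H p else am H h))%N
     (fr H) [:: p; q; b].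
  have {U}U s := U s ltac:(by rewrite /= !inE pq pb qb) ltac:(by rewrite /= hp hq hb)
    ltac:(by move=> h _; rewrite !inE !negb_or => /and3P[/negPf-> /negPf-> /negPf->]).
  have := U true; have := U false; rewrite !big_cons !big_nil !eqxx ?pq (sym _ _ pq) (sym _ _ pb) (sym _ _ qb) /= vq amb sib sp.
  move: vb; case: (eqVneq (vt H p) w) => [->|_].
    by move=> /negPf->; case: (si H q) => /=; lia.
  by move=> _; case: (vt H b == w); case: (si H q) => /=; lia.
- move=> U; apply: leq_trans (h_cut hI U).
  pose G' h := (am (link H p q) h *
    (U (loc (link H p q) h) != U (loc (link H p q) (mt (link H p q) h))))%N.
  have -> : crossing (link H p q) U = (\sum_(h < fr H) G' h + G' (fr H))%N.
    by rewrite /crossing big_ord_recr.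
  pose G h := (am H h * (U (loc H h) != U (loc H (mt H h))))%N.
  have lz h : (h < fr H)%N -> loc (link H p q) h = loc H h by move=> hh; rewrite /loc /= (lt_z h hh).
  have la : loc H p = vt H p by rewrite /loc vp.
  have lq : loc H q = vt H p by rewrite /loc vq vp.
  have lzz : (0 < am H q - am H p)%N -> loc (link H p q) (fr H) = loc H b.
    move=> h; rewrite /loc /= eqxx -/b; case: ltnP => // h1.
    by have [E1 E2] := tb h1; move: h; rewrite E1 E2.
  have U1 : (\sum_(h < fr H) G' h + \sum_(h <- [:: p; q; a; b]) G h =
             \sum_(h < fr H) G h + \sum_(h <- [:: p; q; a; b]) G' h)%N.
    apply: sum_update.
    - by rewrite /= !inE pq pa pb qa qb ab.
    - by rewrite /= hp hq ha hb.
    - move=> h hh; rewrite !inE !negb_or => /and4P[/negPf n1 /negPf n2 /negPf n3 /negPf n4].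
      rewrite /G' /G /= -/a -/b n1 n2 n3 n4 (lt_z h hh) /=; case: (posnP (am H h)) => [->//|h0].
      by have [h1 _ _ _] := h_mate hI hh h0; rewrite !lz.
  move: U1; rewrite !big_cons !big_nil.
  have -> : G p = (am H p * (U (vt H p) != U (loc H a)))%N by rewrite /G la.
  have -> : G q = (am H q * (U (vt H p) != U (loc H b)))%N by rewrite /G lq.
  have -> : G a = (am H p * (U (loc H a) != U (vt H p)))%N by rewrite /G maa la ama.
  have -> : G b = (am H q * (U (loc H b) != U (vt H p)))%N by rewrite /G mbb lq amb.
  have -> : G' p = 0%N by rewrite /G' /= eqxx.
  have -> : G' q = ((am H q - am H p) * (U (vt H p) != U (loc H b)))%N.
    rewrite /G' /= -/a -/b (sym _ _ pq) eqxx zq /= lz // lq.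
    by case: (posnP (am H q - am H p)) => [->//|/lzz ->].
  have -> : G' a = (am H p * (U (loc H a) != U (loc H b)))%N.
    by rewrite /G' /= -/a -/b (sym _ _ pa) (sym _ _ qa) za ab eqxx /= !lz // ama.
  have -> : G' b = (am H p * (U (loc H b) != U (loc H a)))%N.
    by rewrite /G' /= -/a -/b (sym _ _ pb) (sym _ _ qb) zb eqxx /= !lz.
  have -> : G' (fr H) = ((am H q - am H p) * (U (loc H b) != U (vt H p)))%N.
    rewrite /G' /= -/a -/b eqxx (sym _ _ zp) orbT /=; case: (posnP (am H q - am H p)) => [->//|/lzz ->].
    by rewrite lz // lq.
  have -> : crossing H U = (\sum_(h < fr H) G h)%N by [].
  move: (\sum_(h < fr H) G' h)%N (\sum_(h < fr H) G h)%N => S1 S2.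
  case: (U (vt H p)); case: (U (loc H a)); case: (U (loc H b)) => /=; lia.
- move=> h; rewrite /= ltnS leq_eqVlt => /orP[/eqP->|hh].
    by rewrite eqxx (sym _ _ zp) orbT -/b => h0 /tb[E1 E2]; move: h0; rewrite E1 E2.
  rewrite (lt_z h hh) -/b orbF; case: (eqVneq h p) => [//|hnp].
  case: (eqVneq h q) => [-> _|hnq]; first by rewrite vq leqNgt vp.
  case: (eqVneq h b) => [->|hnb]; last exact: h_term hI _ hh.
  by move=> _ h1; have [-> _] := tb h1; split=> //; have [] := h_term hI hb _ h1; rewrite ?amb.
- move=> h /(h_termP hI)[h1 h2 h3]; rewrite /= (lt_z h h1) -/b orbF; split=> //; first exact: ltnW.
  case: eqP => [E|_]; first by move: h3; rewrite E leqNgt vp.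
  case: eqP => [E|_]; first by move: h3; rewrite E vq leqNgt vp.
  by case: eqP => // E; move: h3; rewrite E => /tb[].
- move=> h hh; rewrite /= lt_z; first exact: h_side hI _ hh.
  exact: leq_trans hh (h_fresh hI).
- exact: leq_trans (h_fresh hI) _.
Qed.
End Heap.

Fixpoint chain (nx : int -> int) (x : int) (L : seq nat) : Prop :=
  if L is h :: L' then x = h%:Z /\ chain nx (nx h%:Z) L' else x = -1.

Lemma chain_ext nx nx' x L : (forall h, h \in L -> nx' h%:Z = nx h%:Z) ->
  chain nx x L -> chain nx' x L.
Proof.
elim: L x => [|h L IH] x //= E [-> hc]; split=> //.
rewrite E ?mem_head //; apply: IH => // k hk; apply: E; by rewrite inE hk orbT.
Qed.

(** Inserting right behind [b], wherever [b] occurs, takes constant time and leaves the head of the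
    list alone. *)
Lemma chain_insert nx nx' x L b z : chain nx x L -> b \in L -> z \notin L -> uniq L ->
  nx' z%:Z = nx b%:Z -> nx' b%:Z = z%:Z ->
  (forall h, h \in L -> h != b -> nx' h%:Z = nx h%:Z) ->
  exists L', [/\ chain nx' x L', uniq L' & L' =i z :: L].
Proof.
elim: L x => [|h L IH] x //= [-> hc]; rewrite !inE negb_or => hb /andP[zh zL] /andP[hL uL] E1 E2 E3.
case: (eqVneq b h) hb => [bh _|bh /= bL].
  exists (h :: z :: L); rewrite /= -bh E2 E1; split.
  - split=> //; split=> //; rewrite bh; apply: chain_ext hc => k hk.
    by apply: E3; rewrite ?inE ?hk ?orbT // bh; apply: contraNneq hL => <-.
  - by rewrite inE negb_or bh eq_sym zh hL zL uL.
  - by move=> k; rewrite !inE orbCA.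
have [|L' [h1 h2 h3]] := IH _ hc bL zL uL E1 E2.
  by move=> k hk; apply: E3; rewrite inE hk orbT.
exists (h :: L'); split=> /=.
- by split=> //; rewrite E3 ?mem_head // eq_sym.
- by rewrite h2 h3 inE negb_or eq_sym zh hL.
- by move=> k; rewrite inE h3 !inE orbCA.
Qed.

(** * Random projection and median *)

Notation Add := (Bin OpAdd) (only parsing).
Notation Sub := (Bin OpSub) (only parsing).
Notation Mul := (Bin OpMul) (only parsing).
Notation Div := (Bin OpDiv) (only parsing).
Notation Le := (Bin OpLe) (only parsing).
Notation "c1 ;; c2" := (Seq c1 c2) (at level 90, right associativity, only parsing).

Notation aOUT := 3%N (only parsing).
Notation aCUT := 4%N (only parsing).
Notation aNP := 7%N (only parsing).
Notation aCC := 8%N (only parsing).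
Notation aNN := 9%N (only parsing).
Notation aT := 10%N (only parsing).
Notation aI := 11%N (only parsing).
Notation at_ := 12%N (only parsing).
Notation aS := 13%N (only parsing).
Notation aDV := 14%N (only parsing).
Notation aDW := 15%N (only parsing).
Notation aU := 18%N (only parsing).
Notation aV := 19%N (only parsing).
Notation aWD := 20%N (only parsing).
Notation aKEY := 21%N (only parsing).
Notation aLO := 22%N (only parsing).
Notation aW := 23%N (only parsing).
Notation aCNT := 24%N (only parsing).
Notation aSD := 25%N (only parsing).
Notation aPI := 35%N (only parsing).

Definition flip_cmd : cmd :=
  for_loop aI (V aNN) (Flip aU (V aI) ;;
    Assign aU (V aI) (Sub (Add (Get aU (V aI)) (Get aU (V aI))) (C 1))).

(* The averages stay unnormalised: after [s] matchings they are [2 ^ s] times the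
   true ones, and [aWD] holds [2 ^ s * NP]. *)
Definition apply_cmd : cmd :=
  Assign aWD (C 0) (V aNP) ;;
  for_loop aS (V at_)
    (fill aI (V aNN) aV (C 0)
       (Add (Get aU (V aI)) (Get aU (Get aPI (Add (Mul (V aS) (V aNN)) (V aI))))) ;;
     fill aI (V aNN) aU (C 0) (Get aV (V aI)) ;;
     Assign aWD (C 0) (Add (V aWD) (V aWD))).

Definition count_cmd : cmd :=
  Assign aCNT (C 0) (C 0) ;;
  for_loop aI (V aNN) (Assign aCNT (C 0)
    (Add (V aCNT) (Le (Add (Get aKEY (V aI)) (C 1)) (Add (V aLO) (V aW))))).

(* The keys [u_i * NP + i] are distinct since [i < NP], so that the bisection ends
   at a threshold with exactly [m] keys below it. *)
Definition median_cmd : cmd :=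
  fill aI (V aNN) aKEY (C 0) (Add (Mul (Get aU (V aI)) (V aNP)) (V aI)) ;;
  Assign aLO (C 0) (Sub (C 0) (Add (V aWD) (V aWD))) ;;
  Assign aW (C 0) (Mul (C 4) (V aWD)) ;;
  While (Le (C 2) (V aW))
    (Assign aW (C 0) (Div (V aW) (C 2)) ;;
     count_cmd ;;
     If (Le (V aCNT) (Get 0 (C 1)))
       (Assign aLO (C 0) (Add (V aLO) (V aW))) Skip) ;;
  fill aI (V aNN) aSD (C 0) (Le (Add (Get aKEY (V aI)) (C 1)) (V aLO)).

(** * Numerical parameters and memory invariants *)

Record params := Params {
  p_n : nat; p_m : nat; p_k : nat; p_c : nat; p_T : nat; p_dv : nat -> nat; p_dw : nat -> nat }.
Definition p_N (P : params) : nat := (p_m P + p_m P)%N.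
Definition p_NP (P : params) : nat := (2 ^ p_k P)%N.

(** [ok_b1] leaves room in a word for the numbers of nodes and half-arcs, [ok_b2] for the keys of
    the median search, [ok_b3] for the round counter. *)
Record params_ok (b : nat) (P : params) : Prop := {
  ok_b : (3 <= b)%N;
  ok_n : (0 < p_n P <= p_NP P)%N;
  ok_m : (0 < p_m P)%N;
  ok_N : (p_N P <= p_NP P)%N;
  ok_c : (0 < p_c P <= 2 * p_NP P)%N;
  ok_dv : forall i, (i < p_N P)%N -> (p_dv P i < p_n P)%N;
  ok_dw : forall i, (i < p_N P)%N -> (p_dw P i < p_n P)%N;
  ok_b1 : (100 * (p_NP P + 10) * (p_NP P + 10) < 2 ^ b)%N;
  ok_b2 : (16 * 2 ^ p_T P * p_NP P < 2 ^ b)%N;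
  ok_b3 : ((p_T P + 2) * (p_N P + 2) < 2 ^ b)%N }.

Record static (P : params) (m : memory) : Prop := {
  st_n : m 0%N 0 = (p_n P)%:Z;
  st_m : m 0%N 1 = (p_m P)%:Z;
  st_OUT : m aOUT 0 = 0;
  st_CUT : forall z, m aCUT z = 0;
  st_NP : m aNP 0 = (p_NP P)%:Z;
  st_CC : m aCC 0 = (p_c P)%:Z;
  st_NN : m aNN 0 = (p_N P)%:Z;
  st_T : m aT 0 = (p_T P)%:Z;
  st_DV : forall i, (i < p_N P)%N -> m aDV i%:Z = (p_dv P i)%:Z;
  st_DW : forall i, (i < p_N P)%N -> m aDW i%:Z = (p_dw P i)%:Z }.

Lemma static_agree P A m m' : agree_off A m m' ->
  all (fun a => a \notin A) [:: 0; 3; 4; 7; 8; 9; 10; 14; 15]%N -> static P m -> static P m'.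
Proof.
move=> h /allP hA [h1 h2 h3 h4 h5 h6 h7 h8 h9 h10].
split; move=> *; rewrite h ?hA //; by [apply: h4|apply: h9|apply: h10].
Qed.

Lemma static_write P m a i z : a \notin [:: 0; 3; 4; 7; 8; 9; 10; 14; 15]%N ->
  static P m -> static P (write m a i z).
Proof.
move=> ha; apply: static_agree; first exact: agree_off_write.
by apply/allP => x hx; rewrite inE; apply: contraNneq ha => <-.
Qed.

Record matchings (P : params) (m : memory) (pis : seq (nat -> nat)) : Prop := {
  ma_t : m at_ 0 = (size pis)%:Z;
  ma_T : (size pis <= p_T P)%N;
  ma_inv : involutions (p_N P) pis;
  ma_PI : forall s i, (s < size pis)%N -> (i < p_N P)%N ->
    m aPI (s * p_N P + i)%N%:Z = (nth id pis s i)%:Z }.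

Lemma matchings_agree P A m m' pis : agree_off A m m' ->
  all (fun a => a \notin A) [:: 12; 35]%N -> matchings P m pis -> matchings P m' pis.
Proof.
move=> h /allP hA [h1 h2 h3 h4].
by split=> // *; rewrite h ?hA //; exact: h4.
Qed.

Lemma matchings_write P m a i z pis : a \notin [:: 12; 35]%N ->
  matchings P m pis -> matchings P (write m a i z) pis.
Proof.
move=> ha; apply: matchings_agree; first exact: agree_off_write.
by apply/allP => x hx; rewrite inE; apply: contraNneq ha => <-.
Qed.

Definition coin_sign (x : bool) : int := if x then 1 else -1.

(** Sums replace averages so that the values stay integral; [projection_lin] recovers the walk after
    division by a power of two. *)
Definition projection (pis : seq (nat -> nat)) (r : seq bool) : nat -> int :=
  foldl (fun u pi i => u i + u (pi i)) (fun i => coin_sign (nth false r i)) pis.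

Lemma projection_bound N pis r i : involutions N pis -> (i < N)%N ->
  (`|projection pis r i| <= 2 ^ size pis)%N.
Proof.
elim/last_ind: pis i => [|pis pi IH] i.
  by rewrite /projection /= /coin_sign; case: (nth _ _ _).
move=> /involutions_rcons[h1 h2] hi; rewrite /projection foldl_rcons size_rcons expnS.
by have := IH i h1 hi; have := IH (pi i) h1 (h2 i hi).1; rewrite /projection; lia.
Qed.

Lemma projection_take pis r s : (s < size pis)%N ->
  projection (take s.+1 pis) r =
  fun i => projection (take s pis) r i + projection (take s pis) r (nth id pis s i).
Proof. by move=> hs; rewrite (take_nth id) // /projection foldl_rcons. Qed.

Section Projection.
Variables (R : realType) (phi : R) (O : network -> seq nat) (b : nat) (P : params).
Hypothesis hP : params_ok b P.
Local Notation ptriple := (ptriple phi O b).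
Local Notation triple := (triple phi O b).
Local Notation N := (p_N P).
Local Notation NP := (p_NP P).

Lemma b_ge3 : (3 <= b)%N. Proof. by case: hP. Qed.

Lemma pow_b8 : (8 <= 2 ^ b)%N.
Proof. by rewrite (@leq_exp2l 2 3) // b_ge3. Qed.

Lemma N_lt : (N < 2 ^ b)%N.
Proof. by case: hP => _ _ _ h _ _ _ h1 _ _; nia. Qed.

Lemma flip_spec m r : size r = N -> static P m ->
  triple flip_cmd m r (5 * N + 2)%N (fun m' ls => ls = [::] /\
    (agree_off [:: aI; aU] m m' /\
    (forall i, (i < N)%N -> m' aU i%:Z = coin_sign (nth false r i)))).
Proof.
move=> hr hm; have b3 := b_ge3.
apply: (@triple_for_coins _ phi O b b3 aI _ _
  (fun k m' => forall i, (i < k)%N -> m' aU i%:Z = coin_sign (nth false r i)) _ _ _ 3) => //.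
- by rewrite hr /= (st_NN hm).
- by rewrite hr N_lt.
- by rewrite hr; lia.
- move=> k m1 hk _ hI mk _; rewrite -[[:: _]]cats0.
  apply: (@triple_conseq _ _ _ _ _ _ _ (1 + 1)%N _
    (fun m' ls => ls = [::] /\ forall i, (i < k.+1)%N -> m' aU i%:Z = coin_sign (nth false r i))) => //.
    apply: triple_seq; apply: triple_flip => //=.
    apply: ptriple_assign => //=; rewrite /write /= !mk !eqxx /=.
      by have := pow_b8; case: (nth _ _ _); lia.
    move=> i; rewrite ltnS leq_eqVlt => /orP[/eqP->|hi].
      by rewrite !eqxx /=; case: (nth _ _ _).
    have -> : (i%:Z == k%:Z) = false by lia.
    exact: hI.
- rewrite hr => m' hI ha; split=> //.
  by apply: agree_off_sub ha => x; rewrite !inE orbb.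
Qed.

Lemma apply_spec m pis r : static P m -> matchings P m pis ->
  (forall i, (i < N)%N -> m aU i%:Z = coin_sign (nth false r i)) ->
  ptriple apply_cmd m ((8 * N + 20) * (p_T P + 1)) (fun m' =>
    (forall i, (i < N)%N -> m' aU i%:Z = projection pis r i) /\
    m' aWD 0 = (2 ^ size pis * NP)%N%:Z).
Proof.
move=> hm hpi hU; have b3 := b_ge3.
have [_ _ m0 hN _ hdv _ hb1 hb2 hb3] := hP.
have hT := ma_T hpi.
have pT : (2 ^ size pis <= 2 ^ p_T P)%N by rewrite leq_exp2l.
have bnd s i : (s <= size pis)%N -> (i < N)%N -> (`|projection (take s pis) r i| * 2 <= 2 * 2 ^ p_T P)%N.
  move=> hs hi; have := @projection_bound N (take s pis) r i.
  rewrite size_takel // => /(_ _ hi) h; rewrite mulnC leq_mul2l /=.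
  apply: leq_trans (h _) _; last by rewrite leq_exp2l //; exact: leq_trans hT.
  move=> k hk; rewrite nth_take //; last by move: hk; rewrite size_takel.
  by apply: (ma_inv hpi); move: hk; rewrite size_takel // => /leq_trans; apply.
have NPpos : (0 < NP)%N by rewrite expn_gt0.
have hT2 : (16 * 2 ^ p_T P < 2 ^ b)%N by apply: leq_ltn_trans hb2; rewrite leq_pmulr.
apply: ptriple_aseq => //=; first by lia.
  by rewrite (st_NP hm); nia.
rewrite (st_NP hm).
apply: (@ptriple_for _ phi O b b3 aS _ _ (fun s m' =>
   (forall i, (i < N)%N -> m' aU i%:Z = projection (take s pis) r i) /\
   m' aWD 0 = (2 ^ s * NP)%N%:Z) _ _ (size pis) (8 * N + 6)%N) => //.
- by rewrite /write /= (ma_t hpi).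
- by apply: leq_ltn_trans _ hb3; nia.
- by split=> [i hi|]; rewrite /write /= ?take0 ?mul1n //; exact: hU.
- by nia.
- move=> s m1 hs hm1 [h1 h2] ms ha.
  have hst : static P m1.
    by apply: (static_agree ha) => //; exact: static_write.
  have hma : matchings P m1 pis.
    by apply: (matchings_agree ha) => //; exact: matchings_write.
  have hpis i : (i < N)%N -> (nth id pis s i < N)%N by move=> hi; case: (ma_inv hpi hs hi).
  apply: (ptriple_seqf (t1 := 4 * N + 2) (t2 := 4 * N + 4) (Q1 := fun m2 => forall i, (i < N)%N ->
      m2 aV i%:Z = projection (take s.+1 pis) r i)).
    apply: (@ptriple_fill _ phi O b b3 aI (V aNN) aV (C 0) _ _ N 0%N _ (projection (take s.+1 pis) r)) => //.
    - by rewrite /= (st_NN hst).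
    - exact: N_lt.
    - move=> k m2 hk mk ha2 /=; rewrite mk !ha2 //= ms (st_NN hst) -PoszM -PoszD.
      by rewrite (ma_PI hma) // h1 // h1 ?hpis // projection_take.
    - by move=> k hk; have := bnd s.+1 k hs hk; lia.
    - by lia.
  by lia.
  move=> m2 hm2 ha2 hV.
  apply: (ptriple_seqf (t1 := 4 * N + 2) (t2 := 1) (Q1 := fun m3 => forall i, (i < N)%N ->
      m3 aU i%:Z = projection (take s.+1 pis) r i)).
    apply: (@ptriple_fill _ phi O b b3 aI (V aNN) aU (C 0) _ _ N 0%N _ (projection (take s.+1 pis) r)) => //.
    - by rewrite /= ha2 //= (st_NN hst).
    - exact: N_lt.
    - by move=> k m3 hk mk ha3 /=; rewrite mk ha3 //= hV.
    - by move=> k hk; have := bnd s.+1 k hs hk; lia.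
    - by lia.
  by lia.
  move=> m3 hm3 ha3 hU3; have e3 : m3 aWD 0 = (2 ^ s * NP)%N%:Z by rewrite ha3 //= ha2.
  have p2 : (2 ^ s * 2 <= 2 ^ p_T P)%N by rewrite mulnC -expnS leq_exp2l //; lia.
  apply: ptriple_assign => //=; rewrite e3 -PoszD; first by rewrite absz_nat; nia.
  split=> [i hi|]; rewrite /write /=; first exact: hU3.
  by rewrite expnS; lia.
- by move=> m1 [h1 h2] _ _; rewrite -{1}(take_size pis).
Qed.

Definition rank (key : nat -> int) (x : int) : nat := (\sum_(i < N) (key i + 1 <= x)%R)%N.

Lemma count_spec m key lo w : static P m ->
  (forall i, (i < N)%N -> m aKEY i%:Z = key i) -> m aLO 0 = lo -> m aW 0 = w ->
  ptriple count_cmd m (4 * N + 4)%N (fun m' => m' aCNT 0 = (rank key (lo + w))%:Z).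
Proof.
move=> hm hk hlo hw; have b3 := b_ge3; have hN := N_lt; have b8 := pow_b8.
apply: ptriple_aseq => //=; try by lia.
apply: (@ptriple_for _ phi O b b3 aI _ _ (fun j m' =>
   m' aCNT 0 = (\sum_(i < j) (key i + 1 <= lo + w)%R)%N%:Z) _ _ N 1%N) => //.
- by rewrite /write /= (st_NN hm).
- by rewrite /write /= big_ord0.
- by rewrite /=; lia.
move=> j m1 hj hm1 h1 mj ha.
have ek : m1 aKEY j%:Z = key j by rewrite ha // /write /= hk.
have elo : m1 aLO 0 = lo by rewrite ha.
have ew : m1 aW 0 = w by rewrite ha.
have hle : (\sum_(i < j) (key i + 1 <= lo + w)%R <= j)%N.
  by rewrite -[leqRHS]card_ord -sum1_card; apply: leq_sum => i _; case: (_ <= _).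
apply: ptriple_assign => //=; rewrite h1 mj ek elo ew.
  by case: (_ <= _); lia.
by rewrite /write /= big_ord_recr /=; case: (_ <= _); lia.
Qed.

(** The bisection maintains [rank key lo <= p_m P < rank key (lo + 2 ^ j)]. At width 1 the
    distinctness of the keys lets the rank grow by at most one, which forces
    [rank key lo = p_m P]. *)
Lemma median_spec m u t : static P m -> (t <= p_T P)%N ->
  (forall i, (i < N)%N -> m aU i%:Z = u i) ->
  (forall i, (i < N)%N -> (`|u i| <= 2 ^ t)%N) -> m aWD 0 = (2 ^ t * NP)%N%:Z ->
  ptriple median_cmd m ((4 * N + 20) * (p_k P + t + 5))%N (fun m' =>
    exists SD : pred nat, exists eta : int,
      [/\ forall i, (i < N)%N -> m' aSD i%:Z = (SD i : nat)%:Z,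
          (\sum_(i < N) SD i = p_m P)%N &
          forall i, (i < N)%N -> if SD i then u i <= eta else eta <= u i]).
Proof.
move=> hm ht hu hub hwd; have b3 := b_ge3; have hN := N_lt; have b8 := pow_b8.
have [_ /andP[n0 hn] m0 hNP _ _ _ hb1 hb2 hb3] := hP.
have NPpos : (0 < NP)%N by rewrite expn_gt0.
set WD := (2 ^ t * NP)%N in hwd.
have tpos : (0 < 2 ^ t)%N by rewrite expn_gt0.
have WDb : (16 * WD < 2 ^ b)%N.
  apply: leq_ltn_trans hb2; rewrite /WD mulnA leq_mul2r leq_mul2l leq_exp2l // ht.
  by rewrite !orbT.
have NPWD : (NP <= WD)%N by rewrite leq_pmull.
pose key (i : nat) : int := u i * NP%:Z + i%:Z.
have keyb i : (i < N)%N -> - WD%:Z <= key i /\ key i + 1 <= 2 * WD%:Z.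
  move=> hi; have hX := hub i hi; rewrite /key.
  have h1 : - (2 ^ t)%N%:Z * NP%:Z <= u i * NP%:Z by rewrite ler_wpM2r //; lia.
  have h2 : u i * NP%:Z <= (2 ^ t)%N%:Z * NP%:Z by rewrite ler_wpM2r //; lia.
  move: h1 h2; rewrite mulNr -PoszM -/WD; move: (u i * NP%:Z) => y h1 h2.
  by split; lia.
have key_lt (x y : int) (i : nat) : (i < NP)%N -> x < y -> x * NP%:Z + i%:Z < y * NP%:Z.
  move=> hi xy; apply: (@lt_le_trans _ _ ((x + 1) * NP%:Z)); first by rewrite mulrDl mul1r; lia.
  by rewrite ler_wpM2r //; lia.
apply: (ptriple_seqf (t1 := 4 * N + 2) (t2 := (4 * N + 20) * (p_k P + t + 4)) (Q1 := fun m1 =>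
    forall i, (i < N)%N -> m1 aKEY i%:Z = key i)).
  apply: (@ptriple_fill _ phi O b b3 aI (V aNN) aKEY (C 0) _ _ N 0%N _ key) => //.
  - by rewrite /= (st_NN hm).
  - by move=> k m1 hk mk ha /=; rewrite mk !ha //= (st_NP hm) hu.
  - by move=> k hk; have := keyb k hk; lia.
  - by lia.
  by lia.
move=> m1 hm1 ha1 hkey.
have hs1 : static P m1 by exact: (static_agree ha1).
have wd1 : m1 aWD 0 = WD%:Z by rewrite ha1.
apply: ptriple_aseq => //=; first by lia.
  by rewrite wd1; lia.
rewrite wd1; set lo0 := 0 - _.
apply: ptriple_aseq => //=; first by lia.
  by rewrite /write /= wd1; lia.
rewrite (_ : write m1 aLO 0 lo0 aWD 0 = WD%:Z); last by rewrite /write /= wd1.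
set m2 := write _ _ _ _.
have hs2 : static P m2 by do 2 (apply: static_write => //).
have hkey2 i : (i < N)%N -> m2 aKEY i%:Z = key i by exact: hkey.
have elo2 : m2 aLO 0 = lo0 by [].
(* [WD] is a power of two, so the width [4 * WD] can be halved exactly down to 1. *)
have ew2 : m2 aW 0 = (2 ^ (p_k P + t + 2))%N%:Z.
  by rewrite /m2 /write /= /WD !expnD; rewrite /p_NP; lia.
have rank_lo : (rank key lo0 <= p_m P)%N.
  rewrite /rank big1 // => i _; have [h1 _] := keyb i (ltn_ord i).
  by have -> : (key i + 1 <= lo0) = false by rewrite /lo0; lia.
have rank_hi : (p_m P < rank key (lo0 + (2 ^ (p_k P + t + 2))%N%:Z))%N.
  have -> : rank key (lo0 + (2 ^ (p_k P + t + 2))%N%:Z) = N.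
    rewrite /rank (eq_bigr (fun=> 1%N)) ?sum1_card ?card_ord // => i _.
    have [_ h2] := keyb i (ltn_ord i).
    have e : (2 ^ (p_k P + t + 2))%N = (4 * WD)%N by rewrite !expnD /WD /p_NP; lia.
    by have -> : (key i + 1 <= lo0 + (2 ^ (p_k P + t + 2))%N%:Z) = true by rewrite e /lo0; lia.
  by rewrite /p_N; lia.
have lob : - (2 * WD)%N%:Z <= lo0 /\ lo0 + (2 ^ (p_k P + t + 2))%N%:Z <= (2 * WD)%N%:Z.
  have e : (2 ^ (p_k P + t + 2))%N = (4 * WD)%N by rewrite !expnD /WD /p_NP; lia.
  by rewrite e /lo0; lia.
clearbody m2 lo0.
apply: (ptriple_seqf (t1 := (p_k P + t + 2) * (4 * N + 8) + 1) (t2 := 4 * N + 2) (Q1 := fun m3 =>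
   static P m3 /\ (forall i, (i < N)%N -> m3 aKEY i%:Z = key i) /\
   exists lo : int, [/\ m3 aLO 0 = lo, rank key lo = p_m P, - (2 * WD)%N%:Z <= lo & lo <= (2 * WD)%N%:Z])).
- apply: (@ptriple_while _ _ _ _ b3 _ _ (fun B m3 => exists j (lo : int),
    [/\ static P m3, forall i, (i < N)%N -> m3 aKEY i%:Z = key i, m3 aLO 0 = lo,
      m3 aW 0 = (2 ^ j)%N%:Z & [/\ (rank key lo <= p_m P)%N, (p_m P < rank key (lo + (2 ^ j)%N%:Z))%N,
      - (2 * WD)%N%:Z <= lo, lo + (2 ^ j)%N%:Z <= (2 * WD)%N%:Z & B = (j * (4 * N + 8))%N]]) _ _ ((p_k P + t + 2) * (4 * N + 8))) => //.
  + by exists (p_k P + t + 2)%N, lo0; split=> //; case: lob.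
  + by lia.
  + move=> B m3 hm3 [j [lo [hs3 hk3 elo ew [r1 r2 l1 l2 ->]]]] /=.
    rewrite ew; case: j ew r2 l2 => [|j] ew r2 l2 //= _.
    have ej : (2 ^ j.+1 = 2 * 2 ^ j)%N by rewrite expnS.
    have jp : (0 < 2 ^ j)%N by rewrite expn_gt0.
    exists (4 * N + 7)%N, (j * (4 * N + 8))%N; split; first by lia.
    have ed : ((2 ^ j.+1)%N%:Z %/ 2)%Z = (2 ^ j)%N%:Z.
      by rewrite ej PoszM mulKz.
    apply: ptriple_aseq => //=; rewrite ?ew ?ed; try lia.
    set m4 := write _ _ _ _.
    have hs4 : static P m4 by exact: static_write.
    apply: (ptriple_seqf (t1 := 4 * N + 4) (t2 := 2)); first exact: (@count_spec m4 key lo (2 ^ j)%N%:Z).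
      by lia.
    move=> m5 hm5 ha5 hc5.
    have hs5 : static P m5 by exact: (static_agree ha5).
    have hk5 i : (i < N)%N -> m5 aKEY i%:Z = key i by move=> hi; rewrite ha5 //; exact: hk3.
    have lo5 : m5 aLO 0 = lo by rewrite ha5.
    have w5 : m5 aW 0 = (2 ^ j)%N%:Z by rewrite ha5.
    apply: ptriple_if => //=; rewrite hc5 (st_m hs5).
      case: lerP => // hr _; apply: ptriple_assign => //=; rewrite lo5 w5; first by lia.
      exists j, (lo + (2 ^ j)%N%:Z); split=> //; first exact: static_write.
      split=> //; try lia.
      by have -> : lo + (2 ^ j)%N%:Z + (2 ^ j)%N%:Z = lo + (2 ^ j.+1)%N%:Z by lia.
    case: lerP => // hr _; apply: ptriple_skip.
    by exists j, lo; split=> //; split=> //; lia.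
  + move=> B m3 hm3 [j [lo [hs3 hk3 elo ew [r1 r2 l1 l2 _]]]] /=.
    rewrite ew; case: j ew r2 l2 => [|j] ew r2 l2; last first.
      have jp : (0 < 2 ^ j)%N by rewrite expn_gt0.
      by have -> : ((2 : int) <= (2 ^ j.+1)%N%:Z) = true by rewrite expnS; lia.
    move=> _; split=> //; split=> //; exists lo; split=> //; last by lia.
    apply/eqP; rewrite eqn_leq r1 /=.
    suff : (rank key (lo + 1) <= rank key lo + 1)%N by move: r2; rewrite expn0 (_ : lo + 1%N%:Z = lo + 1) //; lia.
    have inj (i j : 'I_N) : key i = key j -> i = j.
      rewrite /key => E; apply: val_inj => /=.
      have hi := ltn_ord i; have hj := ltn_ord j.
      have k1 := key_lt (u i) (u j) i (leq_trans hi hNP).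
      have k2 := key_lt (u j) (u i) j (leq_trans hj hNP).
      by case: (ltrgtP (u i) (u j)) => [/k1|/k2|e]; lia.
    case: (pselect (exists i : 'I_N, key i = lo)) => [[i0 e0]|nex].
      have h : (\sum_(i < N | i != i0) (key i + 1 <= lo + 1)%R <=
                \sum_(i < N | i != i0) (key i + 1 <= lo)%R)%N.
        apply: leq_sum => i hi; have ne : key i <> lo by rewrite -e0 => /inj E; rewrite E eqxx in hi.
        by rewrite (_ : (key i + 1 <= lo + 1) = (key i + 1 <= lo)) //; apply/idP/idP; lia.
      rewrite /rank (bigD1 i0) //= [in leqRHS](bigD1 i0) //=.
      rewrite addnAC; apply: leq_add h.
      by case: (key i0 + 1 <= lo + 1); case: (key i0 + 1 <= lo).
    apply: leq_trans (leq_addr _ _); apply: leq_sum => i _.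
    have ne : key i <> lo by move=> E; apply: nex; exists i.
    by rewrite (_ : (key i + 1 <= lo + 1) = (key i + 1 <= lo)) //; apply/idP/idP; lia.
- by lia.
move=> m3 hm3 ha3 [hs3 [hk3 [lo [elo er l1 l2]]]].
apply: (@ptriple_fill _ phi O b b3 aI (V aNN) aSD (C 0) _ _ N 0%N _
   (fun i => ((key i + 1 <= lo)%R : nat)%:Z)) => //.
- by rewrite /= (st_NN hs3).
- by move=> k m4 hk mk ha /=; rewrite mk !ha //= hk3 // elo.
- by move=> k hk; case: (_ <= _); lia.
- by lia.
move=> m4 _ ha4 h4 _.
(* A key is [u i * NP + i] with [i < NP], so dividing the bound [lo - 1] on the selected keys by
   [NP] gives a threshold for [u] itself. *)
exists (fun i => key i + 1 <= lo), ((lo - 1) %/ NP%:Z)%Z; split=> // i hi.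
have q := divz_eq (lo - 1) NP%:Z.
have q1 : 0 <= ((lo - 1) %% NP%:Z)%Z by rewrite modz_ge0 //; lia.
have q2 : ((lo - 1) %% NP%:Z)%Z < NP%:Z by rewrite ltz_pmod //; lia.
move: ((lo - 1) %/ NP%:Z)%Z ((lo - 1) %% NP%:Z)%Z q q1 q2 => Q1 Q2 q q1 q2.
have k1 := key_lt (u i) Q1 i (leq_trans hi hNP).
have k2 := key_lt Q1 (u i) `|Q2|%N.
rewrite /key; case: lerP => h.
  by rewrite leNgt; apply/negP => /k2; lia.
by rewrite leNgt; apply/negP => /k1; lia.
Qed.
End Projection.

(** * Flow and cut of a round *)

Notation aF := 29%N (only parsing).
Notation aOK := 30%N (only parsing).
Notation aTL := 26%N (only parsing).
Notation aHD := 27%N (only parsing).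
Notation aCP := 28%N (only parsing).
Notation bTL := 31%N (only parsing).
Notation bHD := 32%N (only parsing).
Notation bCP := 33%N (only parsing).
Notation aG := 34%N (only parsing).

(** Reads an array back through commands that did not touch it; [isT] settles by computation that
    its name is not among the modified ones. *)
Ltac peel := repeat match goal with
  | H : agree_off _ _ ?m |- context [?m ?a ?z] => rewrite (H a isT z)
  end.

(** * Proof rule for a call to the solver *)

Section MaxFlowRule.
Variables (R : realType) (phi : R) (O : network -> seq nat) (b : nat).
Hypothesis b_ge : (3 <= b)%N.

Lemma network_length_read m en em es et tl hd cp : bounded b m ->
  (network_length (read_network phi m en em es et tl hd cp) <=
   `|eval phi m en| + `|eval phi m em| * (3 * b))%N.
Proof.
move=> hm; rewrite /network_length /= leq_add2l big_map.
set k := `|eval phi m em|%N.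
apply: (@leq_trans (\sum_(i <- iota 0 k) 3 * b)%N); last first.
  by rewrite big_const_seq count_predT size_iota iter_addn_0 mulnC.
apply: leq_sum => i _ /=; have := hm tl i%:Z; have := hm hd i%:Z; have := hm cp i%:Z.
by rewrite /bitsize !absz_nat; lia.
Qed.

Lemma arc_read m en em es et tl hd cp k : (k < `|eval phi m em|)%N ->
  arc_nth (read_network phi m en em es et tl hd cp) k =
  (`|m tl k%:Z|, `|m hd k%:Z|, `|m cp k%:Z|)%N.
Proof. by move=> hk; rewrite /arc_nth (nth_map 0%N) ?size_iota // nth_iota. Qed.

(** Storing the answer keeps the memory bounded because a flow is below the capacities, which were
    themselves read from bounded cells. *)
Lemma triple_maxflow en em es et tl hd cp fl m t (Q : memory -> seq nat -> Prop) :
  (1 < t)%N -> all simple [:: en; em; es; et] ->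
  let Nw := read_network phi m en em es et tl hd cp in
  max_flow_solver O -> wf_network Nw ->
  (forall m', agree_off [:: fl] m m' -> is_max_flow Nw (O Nw) ->
     (forall i, (i < `|eval phi m em|)%N -> m' fl i%:Z = (nth 0%N (O Nw) i)%:Z) ->
     (network_length Nw <= `|eval phi m en| + `|eval phi m em| * (3 * b))%N ->
     Q m' [:: network_length Nw]) ->
  triple phi O b (MaxFlow en em es et tl hd cp fl) m [::] t Q.
Proof.
move=> t1 /and5P[s1 s2 s3 s4 _] Nw hO wf hQ hm.
have hf := hO _ wf.
exists (write_seq m fl `|eval phi m em|%N (O Nw)), [:: network_length Nw],
  (cost phi m en + cost phi m em + cost phi m es + cost phi m et).+1; split.
- move=> a [i|i] /=; last exact: hm.
  case: ifP => [/andP[_ hi]|_]; last exact: hm.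
  case: hf => [[_ hc _] _]; have := hc i; rewrite size_map size_iota => /(_ hi).
  rewrite arc_read //= => hle.
  have := hm cp i%:Z; rewrite !bitsize_le //; try by lia.
- have h1 := simple_cost phi b_ge hm s1; have h2 := simple_cost phi b_ge hm s2.
  have h3 := simple_cost phi b_ge hm s3; have h4 := simple_cost phi b_ge hm s4.
  apply: (@leq_trans (2 * word_cost b)); last by rewrite leq_mul2r t1 orbT.
  by rewrite /word_cost; lia.
- apply: hQ => //.
  + by move=> a; rewrite inE => /negPf ha [] // i; rewrite /= ha.
  + by move=> i hi; rewrite /= eqxx hi.
  + exact: network_length_read.
- by move=> r k l; rewrite cats1; exact: exec_maxflow.
Qed.
End MaxFlowRule.

(** The second clause allows one array to be filled in several segments. *)
Definition filled (a x N : nat) (v : nat -> int) (m m' : memory) : Prop :=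
  (forall k, (k < N)%N -> m' a (x + k)%N%:Z = v k) /\
  (forall z, (z < x%:Z) || ((x + N)%N%:Z <= z) -> m' a z = m a z).

Lemma filled_val a x N v m m' k : filled a x N v m m' -> (x <= k < x + N)%N ->
  m' a k%:Z = v (k - x)%N.
Proof. by case=> h _ /andP[h1 h2]; have -> : k = (x + (k - x))%N; [lia|rewrite h; [congr v|]; lia]. Qed.

Lemma filled_out a x N v m m' k : filled a x N v m m' -> (k < x)%N || (x + N <= k)%N ->
  m' a k%:Z = m a k%:Z.
Proof. by case=> _ h hk; apply: h; lia. Qed.

(* Node [n] is the source and node [n + 1] the sink. *)
Definition network_cmd : cmd :=
  fill aI (V aNN) aTL (C 0)
    (Add (Mul (Get aSD (V aI)) (V 0)) (Mul (Sub (C 1) (Get aSD (V aI))) (Get aDV (V aI)))) ;;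
  fill aI (V aNN) aTL (V aNN) (Get aDV (V aI)) ;;
  fill aI (V aNN) aHD (C 0)
    (Add (Mul (Get aSD (V aI)) (Get aDV (V aI))) (Mul (Sub (C 1) (Get aSD (V aI))) (Add (V 0) (C 1)))) ;;
  fill aI (V aNN) aHD (V aNN) (Get aDW (V aI)) ;;
  fill aI (V aNN) aCP (C 0) (C 1) ;;
  fill aI (V aNN) aCP (V aNN) (V aCC).

Definition flow_cmd : cmd :=
  MaxFlow (Add (V 0) (C 2)) (Add (V aNN) (V aNN)) (V 0) (Add (V 0) (C 1)) aTL aHD aCP aF.

Definition check_cmd : cmd :=
  Assign aOK (C 0) (C 1) ;;
  for_loop aI (V aNN)
    (If (Mul (Get aSD (V aI)) (Sub (C 1) (Get aF (V aI)))) (Assign aOK (C 0) (C 0)) Skip).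

(** Comparisons evaluate to 0 or 1, so multiplying one by [n + 1] switches a residual arc on or off
    without branching. *)
Definition residual_cmd : cmd :=
  let K := Add (V aNN) (V aNN) in
  fill aI K bTL (C 0) (Get aTL (V aI)) ;;
  fill aI K bTL K (Get aHD (V aI)) ;;
  fill aI (V 0) bTL (Add K K) (V aI) ;;
  fill aI K bHD (C 0) (Get aHD (V aI)) ;;
  fill aI K bHD K (Get aTL (V aI)) ;;
  fill aI (V 0) bHD (Add K K) (Add (V 0) (C 2)) ;;
  fill aI K bCP (C 0) (Mul (Le (Add (Get aF (V aI)) (C 1)) (Get aCP (V aI))) (Add (V 0) (C 1))) ;;
  fill aI K bCP K (Mul (Le (C 1) (Get aF (V aI))) (Add (V 0) (C 1))) ;;
  fill aI (V 0) bCP (Add K K) (C 1).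

Definition reach_cmd : cmd :=
  let K := Add (V aNN) (V aNN) in
  MaxFlow (Add (V 0) (C 3)) (Add (Add K K) (V 0)) (V 0) (Add (V 0) (C 2)) bTL bHD bCP aG.

Definition output_cmd : cmd :=
  let K := Add (V aNN) (V aNN) in
  fill aI (V 0) aCUT (C 0) (Get aG (Add (Add K K) (V aI))).

Record dart_net (P : params) (SD : pred nat) (Nw : network) : Prop := {
  dn_nodes : nodes Nw = (p_n P).+2;
  dn_source : source Nw = p_n P;
  dn_sink : sink Nw = (p_n P).+1;
  dn_size : size (arcs Nw) = (p_N P + p_N P)%N;
  dn_unit : forall k, (k < p_N P)%N -> arc_nth Nw k =
    if SD k then (p_n P, p_dv P k, 1%N) else (p_dv P k, (p_n P).+1, 1%N);
  dn_dart : forall k, (k < p_N P)%N -> arc_nth Nw (p_N P + k) = (p_dv P k, p_dw P k, p_c P);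
  dn_half : (\sum_(k < p_N P) SD k = p_m P)%N }.

Section Filled.
Variables (R : realType) (phi : R) (O : network -> seq nat) (b : nat).
Hypothesis b3 : (3 <= b)%N.
Local Notation ptriple := (ptriple phi O b).

Lemma ptriple_filled (i : nat) K (a : nat) off e (m0 : memory) (M x t : nat) (v : nat -> int) :
  [&& i != a, all (fun y => y \notin [:: i; a]) (reads K),
    all (fun y => y \notin [:: i; a]) (reads off),
    small_consts K && (esize K <= 20)%N, small_consts off && (esize off <= 20)%N & simple e] ->
  eval phi m0 K = M%:Z -> eval phi m0 off = x%:Z -> (M < 2 ^ b)%N ->
  (forall k m, (k < M)%N -> m i 0 = k%:Z -> agree_off [:: i; a] m0 m ->
     eval phi m e = v k) ->
  (forall k, (k < M)%N -> (`|v k| < 2 ^ b)%N) -> (M * 4 + 2 <= t)%N ->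
  ptriple (fill i K a off e) m0 t (filled a x M v m0).
Proof.
case/and5P=> h1 h2 h3 h4 /andP[h5 h6] *.
by apply: (@ptriple_fill _ phi O b b3 _ _ _ _ _ _ M x _ v) => // m _ _ ? ?; split.
Qed.

End Filled.

Section NetworkPhase.
Variables (R : realType) (phi : R) (O : network -> seq nat) (b : nat) (P : params).
Hypothesis hP : params_ok b P.
Hypothesis hO : max_flow_solver O.
Local Notation ptriple := (ptriple phi O b).
Local Notation triple := (triple phi O b).
Local Notation N := (p_N P).
Local Notation n := (p_n P).
Local Notation NP := (p_NP P).
Let b3 := b_ge3 hP.

Lemma small_facts : [/\ (n + 10 < 2 ^ b)%N, (8 * N + n + 10 < 2 ^ b)%N, (p_c P < 2 ^ b)%N & (N < 2 ^ b)%N].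
Proof.
have [_ /andP[n0 hn] m0 hNP /andP[c0 hc] _ _ hb1 hb2 hb3] := hP.
by split; nia.
Qed.

Record net_arrays (SD : pred nat) (m : memory) : Prop := {
  na_TL1 : forall k, (k < N)%N -> m aTL k%:Z = (if SD k then n else p_dv P k)%:Z;
  na_TL2 : forall k, (k < N)%N -> m aTL (N + k)%N%:Z = (p_dv P k)%:Z;
  na_HD1 : forall k, (k < N)%N -> m aHD k%:Z = (if SD k then p_dv P k else n.+1)%:Z;
  na_HD2 : forall k, (k < N)%N -> m aHD (N + k)%N%:Z = (p_dw P k)%:Z;
  na_CP1 : forall k, (k < N)%N -> m aCP k%:Z = 1;
  na_CP2 : forall k, (k < N)%N -> m aCP (N + k)%N%:Z = (p_c P)%:Z }.

Lemma network_spec m (SD : pred nat) : static P m ->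
  (forall i, (i < N)%N -> m aSD i%:Z = (SD i : nat)%:Z) ->
  ptriple network_cmd m (24 * N + 12) (net_arrays SD).
Proof.
move=> hm hSD.
have [hn1 hn2 hc1 hN] := small_facts.
have hdv := ok_dv hP; have hdw := ok_dw hP.
have E (k t : nat) : (t + (k * (4 * N + 2)) <= t + k * (4 * N + 2))%N by [].
apply: (ptriple_seqf (t1 := 4 * N + 2) (t2 := 5 * (4 * N + 2))
   (Q1 := filled aTL 0 N (fun k => (if SD k then n else p_dv P k)%:Z) m)); [|lia|].
  apply: (ptriple_filled O b3) => //=; [exact: st_NN| |by move=> k hk; have := hdv k hk; case: (SD k); lia|lia].
  move=> k m1 hk mk ha; rewrite mk; peel; rewrite hSD // (st_n hm) (st_DV hm) //.
  by case: (SD k); rewrite /= ?mul1r ?mul0r ?subrr ?mul0r ?addr0 ?add0r ?subr0 ?mul1r.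
move=> m1 _ ha1 f1; have hs1 : static P m1 by exact: (static_agree ha1).
apply: (ptriple_seqf (t1 := 4 * N + 2) (t2 := 4 * (4 * N + 2))
   (Q1 := filled aTL N N (fun k => (p_dv P k)%:Z) m1)); [|lia|].
  apply: (ptriple_filled O b3) => //=; [exact: st_NN|exact: st_NN| |by move=> k hk; have := hdv k hk; lia|lia].
  by move=> k m2 hk mk ha; rewrite mk; peel; rewrite (st_DV hm).
move=> m2 _ ha2 f2; have hs2 : static P m2 by exact: (static_agree ha2).
apply: (ptriple_seqf (t1 := 4 * N + 2) (t2 := 3 * (4 * N + 2))
   (Q1 := filled aHD 0 N (fun k => (if SD k then p_dv P k else n.+1)%:Z) m2)); [|lia|].
  apply: (ptriple_filled O b3) => //=; [exact: st_NN| |by move=> k hk; have := hdv k hk; case: (SD k); lia|lia].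
  move=> k m3 hk mk ha; rewrite mk; peel; rewrite hSD // (st_n hm) (st_DV hm) //.
  by case: (SD k) => /=; lia.
move=> m3 _ ha3 f3; have hs3 : static P m3 by exact: (static_agree ha3).
apply: (ptriple_seqf (t1 := 4 * N + 2) (t2 := 2 * (4 * N + 2))
   (Q1 := filled aHD N N (fun k => (p_dw P k)%:Z) m3)); [|lia|].
  apply: (ptriple_filled O b3) => //=; [exact: st_NN|exact: st_NN| |by move=> k hk; have := hdw k hk; lia|lia].
  by move=> k m4 hk mk ha; rewrite mk; peel; rewrite (st_DW hm).
move=> m4 _ ha4 f4; have hs4 : static P m4 by exact: (static_agree ha4).
apply: (ptriple_seqf (t1 := 4 * N + 2) (t2 := 1 * (4 * N + 2))
   (Q1 := filled aCP 0 N (fun k => 1) m4)); [|lia|].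
  by apply: (ptriple_filled O b3) => //=; try (exact: st_NN); lia.
move=> m5 _ ha5 f5; have hs5 : static P m5 by exact: (static_agree ha5).
apply: (ptriple_conseq (t := 4 * N + 2)); first (apply: ptriple_frame;
  apply: (@ptriple_filled _ phi O b b3 _ _ _ _ _ m5 N N _ (fun k => (p_c P)%:Z)) => //=); try exact: st_NN.
- by move=> k m6 hk mk ha; peel; rewrite (st_CC hm).
- by lia.
- by lia.
move=> m6 _ [ha6 f6]; split=> k hk.
- by peel; rewrite (filled_out f2) ?hk // (filled_val f1) ?subn0.
- by peel; rewrite (filled_val f2) ?addKn //; lia.
- by peel; rewrite (filled_out f4) ?hk // (filled_val f3) ?subn0.
- by peel; rewrite (filled_val f4) ?addKn //; lia.
- by rewrite (filled_out f6) ?hk // (filled_val f5).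
- by rewrite (filled_val f6) ?addKn //; lia.
Qed.

Lemma flow_spec m (SD : pred nat) : static P m -> net_arrays SD m ->
  (\sum_(k < N) SD k = p_m P)%N ->
  triple flow_cmd m [::] 2 (fun m' ls => exists Nw, [/\ dart_net P SD Nw,
    is_max_flow Nw (O Nw), agree_off [:: aF] m m',
    forall k, (k < N + N)%N -> m' aF k%:Z = (nth 0%N (O Nw) k)%:Z &
    exists2 l, ls = [:: l] & (l <= 3 * b * (n + 2 * N + 3))%N]).
Proof.
move=> hm [h1 h2 h3 h4 h5 h6] half.
have hdv := ok_dv hP; have hdw := ok_dw hP.
have en : absz (eval phi m (Add (V 0) (C 2))) = n.+2 by rewrite /= (st_n hm); lia.
have es : absz (eval phi m (V 0)) = n by rewrite /= (st_n hm).
have et : absz (eval phi m (Add (V 0) (C 1))) = n.+1 by rewrite /= (st_n hm); lia.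
have em : absz (eval phi m (Add (V aNN) (V aNN))) = (N + N)%N by rewrite /= (st_NN hm); lia.
set Nw := read_network phi m (Add (V 0) (C 2)) (Add (V aNN) (V aNN)) (V 0) (Add (V 0) (C 1)) aTL aHD aCP.
have hd : dart_net P SD Nw.
  split=> //.
  - by rewrite size_map size_iota em.
  - move=> k hk; rewrite /Nw arc_read; last by rewrite em ltn_addl.
    rewrite h1 // h3 // h5 //.
    by case: (SD k).
  - move=> k hk; rewrite /Nw arc_read; last by rewrite em ltn_add2l.
    by rewrite h2 // h4 // h6.
have wf : wf_network Nw.
  by case: hd => a1 a2 a3 a4 a5 a6 _; exact: (wf_dart_network hdv hdw half a1 a2 a3 a4 a5 a6).
apply: (triple_maxflow b3) => //.
rewrite -/Nw em en => m' ha hmax hval hlen; exists Nw; split=> //.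
exists (network_length Nw) => //; apply: leq_trans hlen _; nia.
Qed.

Lemma check_spec m (SD : pred nat) (f : nat -> nat) : static P m ->
  (forall i, (i < N)%N -> m aSD i%:Z = (SD i : nat)%:Z) ->
  (forall k, (k < N)%N -> m aF k%:Z = (f k)%:Z) ->
  ptriple check_cmd m (5 * N + 3)%N (fun m' => (m' aOK 0 = 0 \/ m' aOK 0 = 1) /\
     (m' aOK 0 != 0 <-> forall k, (k < N)%N -> SD k -> f k = 1%N)).
Proof.
move=> hm hSD hF; have [hn1 hn2 hc1 hN] := small_facts.
apply: (ptriple_aseq b3) => //=; try by lia.
apply: (@ptriple_for _ phi O b b3 aI _ _ (fun j m' => (m' aOK 0 = 0 \/ m' aOK 0 = 1) /\
     (m' aOK 0 != 0 <-> forall k, (k < j)%N -> SD k -> f k = 1%N)) _ _ N 2%N) => //.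
- by rewrite /write /= (st_NN hm).
- by split; [right|].
- by rewrite /=; lia.
move=> j m1 hj hm1 [h1 h2] mj ha.
have eS : m1 aSD j%:Z = (SD j : nat)%:Z by rewrite ha // /write /= hSD.
have eF : m1 aF j%:Z = (f j)%:Z by rewrite ha // /write /= hF.
apply: (ptriple_if b3) => //=; rewrite mj eS eF => hc.
  apply: (ptriple_assign _ b3) => //=; rewrite ?expn_gt0 // /write /=; split; first by left.
  split=> // h; have := h j (ltnSn j); case: (SD j) hc => [hc|] //=; last by rewrite mul0r.
  by move=> /(_ isT) e; move: hc; rewrite e subrr mulr0.
apply: ptriple_skip; rewrite /write /=; split=> //.
apply: iff_trans h2 _; split=> h k.
  rewrite ltnS leq_eqVlt => /orP[/eqP->|]; last exact: h.
  by move=> Sj; move: hc; rewrite Sj; lia.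
by move=> hk; apply: h; exact: ltnW.
Qed.

Lemma net_arrays_arc m SD Nw : net_arrays SD m -> dart_net P SD Nw ->
  forall k, (k < N + N)%N -> [/\ m aTL k%:Z = (arc_nth Nw k).1.1%:Z,
    m aHD k%:Z = (arc_nth Nw k).1.2%:Z & m aCP k%:Z = (arc_nth Nw k).2%:Z].
Proof.
move=> [h1 h2 h3 h4 h5 h6] [_ _ _ _ d1 d2 _] k hk; case: (ltnP k N) => hk'.
  by rewrite d1 // h1 // h3 // h5 //; case: (SD k).
have hk2 : (k - N < N)%N by lia.
by rewrite -(subnKC hk') d2 // h2 // h4 // h6.
Qed.

Record residual_arrays (Nw : network) (f : nat -> nat) (m : memory) : Prop := {
  ra_TL1 : forall k, (k < N + N)%N -> m bTL k%:Z = (arc_nth Nw k).1.1%:Z;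
  ra_TL2 : forall k, (k < N + N)%N -> m bTL (N + N + k)%N%:Z = (arc_nth Nw k).1.2%:Z;
  ra_TL3 : forall v, (v < n)%N -> m bTL (N + N + (N + N) + v)%N%:Z = v%:Z;
  ra_HD1 : forall k, (k < N + N)%N -> m bHD k%:Z = (arc_nth Nw k).1.2%:Z;
  ra_HD2 : forall k, (k < N + N)%N -> m bHD (N + N + k)%N%:Z = (arc_nth Nw k).1.1%:Z;
  ra_HD3 : forall v, (v < n)%N -> m bHD (N + N + (N + N) + v)%N%:Z = n.+2%:Z;
  ra_CP1 : forall k, (k < N + N)%N ->
    m bCP k%:Z = (if (f k < (arc_nth Nw k).2)%N then n.+1 else 0%N)%:Z;
  ra_CP2 : forall k, (k < N + N)%N ->
    m bCP (N + N + k)%N%:Z = (if (0 < f k)%N then n.+1 else 0%N)%:Z;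
  ra_CP3 : forall v, (v < n)%N -> m bCP (N + N + (N + N) + v)%N%:Z = 1 }.

Lemma residual_spec m SD Nw (f : nat -> nat) : static P m -> net_arrays SD m ->
  dart_net P SD Nw -> (forall k, (k < N + N)%N -> m aF k%:Z = (f k)%:Z) ->
  ptriple residual_cmd m (48 * N + 12 * n + 18) (residual_arrays Nw f).
Proof.
move=> hm hna hdn hF.
have [hn1 hn2 hc1 hN] := small_facts.
have hdv := ok_dv hP; have hdw := ok_dw hP.
have harc := net_arrays_arc hna hdn.
have hlt k : (k < N + N)%N -> ((arc_nth Nw k).1.1 < n.+2)%N /\ ((arc_nth Nw k).1.2 < n.+2)%N.
  move=> hk; case: hdn => _ _ _ _ d1 d2 _; case: (ltnP k N) => hk'.
    by rewrite d1 //; have := hdv k hk'; case: (SD k) => /=; lia.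
  have hk2 : (k - N < N)%N by lia.
  by rewrite -(subnKC hk') d2 //=; have := hdv _ hk2; have := hdw _ hk2; lia.
have eK m' : static P m' -> eval phi m' (Add (V aNN) (V aNN)) = (N + N)%N%:Z.
  by move=> h /=; rewrite (st_NN h).
have eKK m' : static P m' -> eval phi m' (Add (Add (V aNN) (V aNN)) (Add (V aNN) (V aNN))) = (N + N + (N + N))%N%:Z.
  by move=> h /=; rewrite (st_NN h).
have en m' : static P m' -> eval phi m' (V 0) = n%:Z by move=> h; exact: st_n.
rewrite /residual_cmd.
apply: (ptriple_seqf (t1 := 4 * (N + N) + 2) (t2 := 40 * N + 12 * n + 16)
   (Q1 := filled bTL 0 (N + N) (fun k => (arc_nth Nw k).1.1%:Z) m)); [|lia|].
  apply: (ptriple_filled O b3) => //; try solve [exact: en | exact: eK | exact: eKK | lia].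
    by move=> k m1 hk mk ha /=; rewrite mk; peel; case: (harc k hk).
  by move=> k hk; case: (hlt k hk); lia.
move=> m1 _ ha1 f1; have hs1 : static P m1 by exact: (static_agree ha1).
apply: (ptriple_seqf (t1 := 4 * (N + N) + 2) (t2 := 32 * N + 12 * n + 14)
   (Q1 := filled bTL (N + N) (N + N) (fun k => (arc_nth Nw k).1.2%:Z) m1)); [|lia|].
  apply: (ptriple_filled O b3) => //; try solve [exact: en | exact: eK | exact: eKK | lia].
    by move=> k m2 hk mk ha /=; rewrite mk; peel; case: (harc k hk).
  by move=> k hk; case: (hlt k hk); lia.
move=> m2 _ ha2 f2; have hs2 : static P m2 by exact: (static_agree ha2).
apply: (ptriple_seqf (t1 := 4 * n + 2) (t2 := 32 * N + 8 * n + 12)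
   (Q1 := filled bTL (N + N + (N + N)) n (fun k => k%:Z) m2)); [|lia|].
  apply: (ptriple_filled O b3) => //; try solve [exact: en | exact: eK | exact: eKK | lia].
move=> m3 _ ha3 f3; have hs3 : static P m3 by exact: (static_agree ha3).
apply: (ptriple_seqf (t1 := 4 * (N + N) + 2) (t2 := 24 * N + 8 * n + 10)
   (Q1 := filled bHD 0 (N + N) (fun k => (arc_nth Nw k).1.2%:Z) m3)); [|lia|].
  apply: (ptriple_filled O b3) => //; try solve [exact: en | exact: eK | exact: eKK | lia].
    by move=> k m4 hk mk ha /=; rewrite mk; peel; case: (harc k hk).
  by move=> k hk; case: (hlt k hk); lia.
move=> m4 _ ha4 f4; have hs4 : static P m4 by exact: (static_agree ha4).
apply: (ptriple_seqf (t1 := 4 * (N + N) + 2) (t2 := 16 * N + 8 * n + 8)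
   (Q1 := filled bHD (N + N) (N + N) (fun k => (arc_nth Nw k).1.1%:Z) m4)); [|lia|].
  apply: (ptriple_filled O b3) => //; try solve [exact: en | exact: eK | exact: eKK | lia].
    by move=> k m5 hk mk ha /=; rewrite mk; peel; case: (harc k hk).
  by move=> k hk; case: (hlt k hk); lia.
move=> m5 _ ha5 f5; have hs5 : static P m5 by exact: (static_agree ha5).
apply: (ptriple_seqf (t1 := 4 * n + 2) (t2 := 16 * N + 4 * n + 6)
   (Q1 := filled bHD (N + N + (N + N)) n (fun k => n.+2%:Z) m5)); [|lia|].
  apply: (ptriple_filled O b3) => //; try solve [exact: en | exact: eK | exact: eKK | lia].
    by move=> k m6 hk mk ha /=; peel; rewrite (st_n hm); lia.
move=> m6 _ ha6 f6; have hs6 : static P m6 by exact: (static_agree ha6).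
apply: (ptriple_seqf (t1 := 4 * (N + N) + 2) (t2 := 8 * N + 4 * n + 4)
   (Q1 := filled bCP 0 (N + N) (fun k => (if (f k < (arc_nth Nw k).2)%N then n.+1 else 0%N)%:Z) m6)); [|lia|].
  apply: (ptriple_filled O b3) => //; try solve [exact: en | exact: eK | exact: eKK | lia].
    move=> k m7 hk mk ha /=; rewrite mk; peel; case: (harc k hk) => _ _ ->; rewrite hF // (st_n hm).
    by case: ltnP; case: lerP => /=; lia.
  by move=> k hk; case: ifP; lia.
move=> m7 _ ha7 f7; have hs7 : static P m7 by exact: (static_agree ha7).
apply: (ptriple_seqf (t1 := 4 * (N + N) + 2) (t2 := 4 * n + 2)
   (Q1 := filled bCP (N + N) (N + N) (fun k => (if (0 < f k)%N then n.+1 else 0%N)%:Z) m7)); [|lia|].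
  apply: (ptriple_filled O b3) => //; try solve [exact: en | exact: eK | exact: eKK | lia].
    move=> k m8 hk mk ha /=; rewrite mk; peel; rewrite hF // (st_n hm).
    by case: ltnP; case: lerP => /=; lia.
  by move=> k hk; case: ifP; lia.
move=> m8 _ ha8 f8; have hs8 : static P m8 by exact: (static_agree ha8).
apply: (ptriple_conseq (t := 4 * n + 2)); first (apply: ptriple_frame;
  apply: (@ptriple_filled _ phi O b b3 _ _ _ _ _ m8 n (N + N + (N + N)) _ (fun k => 1)) => //); try lia.
- exact: en.
- exact: eKK.
move=> m9 _ [ha9 f9]; split=> k hk.
- by peel; rewrite (filled_out f3) ?(filled_out f2) ?(filled_val f1) ?subn0 //; lia.
- by peel; rewrite (filled_out f3) ?(filled_val f2) ?addKn //; lia.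
- by peel; rewrite (filled_val f3) ?addKn //; lia.
- by peel; rewrite (filled_out f6) ?(filled_out f5) ?(filled_val f4) ?subn0 //; lia.
- by peel; rewrite (filled_out f6) ?(filled_val f5) ?addKn //; lia.
- by peel; rewrite (filled_val f6) ?addKn //; lia.
- by rewrite (filled_out f9) ?(filled_out f8) ?(filled_val f7) ?subn0 //; lia.
- by rewrite (filled_out f9) ?(filled_val f8) ?addKn //; lia.
- by rewrite (filled_val f9) ?addKn //; lia.
Qed.

Definition separated (X : pred nat) : Prop :=
  let bd := (\sum_(k < N) (X (p_dv P k) && ~~ X (p_dw P k)))%N in
  (p_c P * bd < \sum_(k < N) X (p_dv P k))%N /\ (p_c P * bd < \sum_(k < N) ~~ X (p_dv P k))%N.

(** By [residual_cut], the second flow marks a set of vertices that is tight for the first one;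
    since some source arc is not saturated, [unsaturated_cut] applies to that set. *)
Lemma cut_spec m SD Nw (fl : seq nat) : static P m -> net_arrays SD m ->
  dart_net P SD Nw -> is_max_flow Nw fl ->
  (forall k, (k < N + N)%N -> m aF k%:Z = (nth 0%N fl k)%:Z) ->
  ~ (forall k, (k < N)%N -> SD k -> nth 0%N fl k = 1%N) ->
  triple (residual_cmd ;; reach_cmd ;; output_cmd) m [::] (48 * N + 16 * n + 30) (fun m' ls =>
    (exists2 l, ls = [:: l] & (l <= 3 * b * (4 * N + 2 * n + 3))%N) /\
    exists X : pred nat, separated X /\ forall v, (v < n)%N -> (m' aCUT v%:Z != 0) = X v).
Proof.
move=> hm hna hdn hfl hF hun; have [hn1 hn2 hc1 hN] := small_facts.
have -> : (48 * N + 16 * n + 30 = (48 * N + 12 * n + 18) + (2 + (4 * n + 10)))%N by lia.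
apply: (@triple_seq _ _ _ _ _ _ _ [::] [::]).
apply: ptriple_triple (ptriple_frame (residual_spec hm hna hdn hF)) _.
move=> m1 _ [ha1 hra]; have hs1 : static P m1 by exact: (static_agree ha1).
apply: (@triple_seq _ _ _ _ _ _ _ [::] [::]).
pose K := Add (V aNN) (V aNN).
have en : absz (eval phi m1 (Add (V 0) (C 3))) = n.+3 by rewrite /= (st_n hs1); lia.
have es : absz (eval phi m1 (V 0)) = n by rewrite /= (st_n hs1).
have et : absz (eval phi m1 (Add (V 0) (C 2))) = n.+2 by rewrite /= (st_n hs1); lia.
have em : absz (eval phi m1 (Add (Add K K) (V 0))) = (N + N + (N + N) + n)%N.
  by rewrite /= (st_NN hs1) (st_n hs1); lia.
set N2 := read_network phi m1 (Add (V 0) (C 3)) (Add (Add K K) (V 0)) (V 0) (Add (V 0) (C 2)) bTL bHD bCP.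
have wf1 : wf_network Nw.
  by case: hdn => a1 a2 a3 a4 a5 a6 a7; exact: (wf_dart_network (ok_dv hP) (ok_dw hP) a7 a1 a2 a3 a4 a5 a6).
have sz1 := dn_size hdn.
have hlt k : (k < N + N)%N -> ((arc_nth Nw k).1.1 < n.+2)%N /\ ((arc_nth Nw k).1.2 < n.+2)%N.
  by rewrite -sz1 => /(wf_arc wf1); rewrite (dn_nodes hdn).
have fwd k : (k < N + N)%N -> arc_nth N2 k = ((arc_nth Nw k).1.1, (arc_nth Nw k).1.2,
    if (nth 0%N fl k < (arc_nth Nw k).2)%N then n.+1 else 0%N).
  move=> hk; rewrite /N2 arc_read ?em; last by lia.
  by rewrite (ra_TL1 hra) // (ra_HD1 hra) // (ra_CP1 hra).
have bwd k : (k < N + N)%N -> arc_nth N2 (N + N + k) = ((arc_nth Nw k).1.2, (arc_nth Nw k).1.1,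
    if (0 < nth 0%N fl k)%N then n.+1 else 0%N).
  move=> hk; rewrite /N2 arc_read ?em; last by lia.
  by rewrite (ra_TL2 hra) // (ra_HD2 hra) // (ra_CP2 hra).
have vtx v : (v < n)%N -> arc_nth N2 (N + N + (N + N) + v) = (v, n.+2, 1%N).
  move=> hk; rewrite /N2 arc_read ?em; last by lia.
  by rewrite (ra_TL3 hra) // (ra_HD3 hra) // (ra_CP3 hra).
have sz2 : size (arcs N2) = (N + N + (N + N) + n)%N by rewrite size_map size_iota em.
have wf2 : wf_network N2.
  have nd : nodes N2 = n.+3 by exact: en.
  have sd : source N2 = n by exact: es.
  have td : sink N2 = n.+2 by exact: et.
  apply/and4P; split; rewrite ?nd ?sd ?td //; try lia.
  apply/allP => a /(nthP (0, 0, 0)%N)[k hk <-].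
  rewrite -/(arc_nth N2 k).
  have {}hk : (k < N + N + (N + N) + n)%N by rewrite -sz2.
  case: (ltnP k (N + N)) => h1.
    by rewrite fwd //=; have := hlt k h1; lia.
  case: (ltnP k (N + N + (N + N))) => h2.
    have h3 : (k - (N + N) < N + N)%N by lia.
    by rewrite -(subnKC h1) bwd //=; have := hlt _ h3; lia.
  have h3 : (k - (N + N + (N + N)) < n)%N by lia.
  by rewrite -(subnKC h2) vtx //=; lia.
apply: (triple_maxflow b3) => //.
rewrite -/K -/N2 em en => m2 ha2 hmax hG hlen.
have hs2 : static P m2 by exact: (static_agree ha2).
have nodes1 := dn_nodes hdn; have source1 := dn_source hdn; have sink1 := dn_sink hdn.
have [X [Xs Xt hX hXv]] : exists X : pred nat,
  [/\ X n, ~~ X n.+1,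
    forall k, (k < size (arcs Nw))%N ->
      (X (arc_nth Nw k).1.1 -> ~~ X (arc_nth Nw k).1.2 -> nth 0%N fl k = (arc_nth Nw k).2) /\
      (~~ X (arc_nth Nw k).1.1 -> X (arc_nth Nw k).1.2 -> nth 0%N fl k = 0%N) &
    forall v, (v < n)%N -> X v = (nth 0%N (O N2) (size (arcs Nw) + size (arcs Nw) + v) != 0%N)].
  apply: (@residual_cut Nw N2 n fl (O N2)); rewrite ?sz1 //.
rewrite sz1 in hX hXv.
apply: (ptriple_triple (t := 4 * n + 10) (Q := fun m3 => forall v, (v < n)%N -> (m3 aCUT v%:Z != 0) = X v)).
  apply: (@ptriple_conseq _ _ _ _ _ _ (4 * n + 2) _ (filled aCUT 0 n
    (fun v => (nth 0%N (O N2) (N + N + (N + N) + v))%:Z) m2)); [|lia|].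
  apply: (ptriple_filled O b3) => //; try solve [exact: st_n | lia].
  + move=> v m3 hv mv ha3 /=; rewrite mv; peel; rewrite (st_NN hm) -!PoszD hG //; lia.
  + move=> v hv; case: hmax => [[_ hc _] _]; have := hc (N + N + (N + N) + v)%N.
    by rewrite sz2 vtx //=; lia.
  move=> m3 _ f3 v hv; rewrite (filled_val f3) ?subn0 ?hXv //; lia.
move=> m3 _ hc; split; first by exists (network_length N2) => //; apply: leq_trans hlen _; nia.
exists X; split=> //.
have [k0 [hk0 S0 f0]] : exists k0, [/\ (k0 < N)%N, SD k0 & nth 0%N fl k0 <> 1%N].
  apply: contrapT => hn; apply: hun => k hk Sk; apply: contrapT => h; apply: hn.
  by exists k.
case: hdn => a1 a2 a3 a4 a5 a6 a7.
exact: (unsaturated_cut (ok_dv hP) (ok_dw hP) a7 a1 a2 a3 a4 a5 a6 (proj1 hfl) hk0 S0 f0 Xs Xt hX).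
Qed.
End NetworkPhase.

(** * Eliminating a vertex from a flow *)

Notation aMT := 36%N (only parsing).
Notation aVT := 37%N (only parsing).
Notation aAM := 38%N (only parsing).
Notation aSI := 39%N (only parsing).
Notation aNX := 40%N (only parsing).
Notation aHE := 41%N (only parsing).
Notation aDG := 42%N (only parsing).
Notation aAL := 43%N (only parsing).
Notation aFR := 44%N (only parsing).
Notation aTH := 45%N (only parsing).
Notation aVI := 46%N (only parsing).
Notation aPA := 47%N (only parsing).
Notation aPB := 48%N (only parsing).
Notation aP := 49%N (only parsing).
Notation aQ := 50%N (only parsing).
Notation aA := 51%N (only parsing).
Notation aB := 52%N (only parsing).
Notation aZ := 53%N (only parsing).

(* The half [aP], whose amount is at most that of [aQ], is spliced with [aQ]: their
   mates become mates of each other, and the new half [aZ] takes the excess. *)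
Definition link_cmd : cmd :=
  Assign aA (C 0) (Get aMT (V aP)) ;;
  Assign aB (C 0) (Get aMT (V aQ)) ;;
  Assign aZ (C 0) (V aFR) ;;
  Assign aNX (V aZ) (Get aNX (V aB)) ;;
  Assign aNX (V aB) (V aZ) ;;
  Assign aVT (V aZ) (Get aVT (V aB)) ;;
  Assign aSI (V aZ) (Get aSI (V aB)) ;;
  Assign aDG (Get aVT (V aB)) (Add (Get aDG (Get aVT (V aB))) (C 1)) ;;
  Assign aAM (V aZ) (Sub (Get aAM (V aQ)) (Get aAM (V aP))) ;;
  Assign aAM (V aQ) (Get aAM (V aZ)) ;;
  Assign aAM (V aB) (Get aAM (V aP)) ;;
  Assign aAM (V aP) (C 0) ;;
  Assign aMT (V aZ) (V aQ) ;;
  Assign aMT (V aQ) (V aZ) ;;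
  Assign aMT (V aB) (V aA) ;;
  Assign aMT (V aA) (V aB) ;;
  Assign aFR (C 0) (Add (V aZ) (C 1)).

Definition kill_cmd (a : nat) : cmd :=
  Assign aAM (Get aMT (V a)) (C 0) ;; Assign aAM (V a) (C 0).

(** The machine has no equality test; a product of two comparisons replaces it. *)
Definition at_vertex (a : nat) : expr :=
  Mul (Le (Get aVT (Get aMT (V a))) (V aVI)) (Le (V aVI) (Get aVT (Get aMT (V a)))).

(* [aPA] looks for a live entering half at the vertex [aVI] and [aPB] for a live
   leaving one; the flow through both is rerouted past the vertex, and loops are
   discarded. *)
Definition elim_body : cmd :=
  If (Add (Le (Get aAM (V aPA)) (C 0)) (Get aSI (V aPA)))
    (Assign aPA (C 0) (Get aNX (V aPA)))
  (If (Add (Le (Get aAM (V aPB)) (C 0)) (Sub (C 1) (Get aSI (V aPB))))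
    (Assign aPB (C 0) (Get aNX (V aPB)))
  (If (at_vertex aPA) (kill_cmd aPA)
  (If (at_vertex aPB) (kill_cmd aPB)
    (If (Le (Get aAM (V aPA)) (Get aAM (V aPB)))
        (Assign aP (C 0) (V aPA) ;; Assign aQ (C 0) (V aPB))
        (Assign aP (C 0) (V aPB) ;; Assign aQ (C 0) (V aPA)) ;;
     link_cmd)))).

Definition elim_cmd : cmd :=
  Assign aAL (V aVI) (C 0) ;;
  Assign aPA (C 0) (Get aHE (V aVI)) ;;
  Assign aPB (C 0) (V aPA) ;;
  While (Mul (Le (C 0) (V aPA)) (Le (C 0) (V aPB))) elim_body.

(** * Progress measures for the elimination of a vertex *)

Section HeapCounts.
Variables (H : heap).

(** Dead halves count as well: they stay in the lists that are scanned, so running times are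
    measured by [degree]. *)
Definition degree (w : nat) : nat := (\sum_(h < fr H) (vt H h == w))%N.
Definition live (w : nat) : nat := (\sum_(h < fr H) ((vt H h == w) && (0 < am H h)))%N.
Definition dead (w : nat) : Prop := forall h, (h < fr H)%N -> vt H h = w -> am H h = 0%N.

Lemma live_le_degree w : (live w <= degree w)%N.
Proof. by apply: leq_sum => h _; case: (_ == _); case: (_ < _)%N. Qed.

Lemma degree_le_fr w : (degree w <= fr H)%N.
Proof.
by rewrite -[leqRHS]card_ord -sum1_card; apply: leq_sum => h _; case: (_ == _).
Qed.
End HeapCounts.

Section HeapSteps.
Variables (n K : nat) (Tm : pred nat) (home : nat -> nat) (X : pred nat -> nat).
Local Notation hinv := (hinv n K Tm home X).

Lemma live_kill H p : (p < fr H)%N -> (0 < am H p)%N ->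
  (live (kill H p) (vt H p) < live H (vt H p))%N.
Proof.
move=> hp ap; rewrite /live /= (bigD1 (Ordinal hp)) //= [in ltnRHS](bigD1 (Ordinal hp)) //=.
rewrite !eqxx ap /= ?andbF ?add0n ?add1n ltnS; apply: leq_sum => h _.
by case: (_ == _); case: ifP => //=; rewrite ltnn.
Qed.

Lemma dead_kill H p w : dead H w -> dead (kill H p) w.
Proof. by move=> h x hx hv /=; rewrite (h x hx hv) if_same. Qed.

Section Link.
Variables (H : heap) (p q : nat).
Hypotheses (hI : hinv H) (hp : (p < fr H)%N) (hq : (q < fr H)%N) (ap : (0 < am H p)%N).
Hypotheses (apq : (am H p <= am H q)%N) (vq : vt H q = vt H p).
Hypothesis (vb : vt H (mt H q) != vt H p).

Lemma link_am_le h : (h < fr H)%N -> (am (link H p q) h <= am H h)%N.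
Proof.
move=> hh /=; case: eqP => // _; rewrite (ltn_eqF hh) orbF.
case: eqP => [->|_]; first exact: leq_subr.
case: eqP => [->|_] //.
by case: (h_mate hI hq (leq_trans ap apq)) => _ _ -> _.
Qed.

(** [p] dies, no other amount at this vertex grows, and the new half is placed beside the mate of
    [q], which lies elsewhere. *)
Lemma live_link : (live (link H p q) (vt H p) < live H (vt H p))%N.
Proof.
rewrite /live /= big_ord_recr /= eqxx (negPf vb) /= addn0.
rewrite (bigD1 (Ordinal hp)) //= [in ltnRHS](bigD1 (Ordinal hp)) //=.
rewrite !eqxx ap /= ?andbF ?add0n ?add1n ltnS; apply: leq_sum => h _.
rewrite (ltn_eqF (ltn_ord h)); case: (_ == _) => //=.
have := link_am_le (ltn_ord h); rewrite /= (ltn_eqF (ltn_ord h)) => hle.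
by case: ltnP => // h0; rewrite (leq_trans h0 hle).
Qed.

Lemma degree_link w : degree (link H p q) w = (degree H w + (vt H (mt H q) == w))%N.
Proof.
rewrite /degree /= big_ord_recr /= eqxx; congr (_ + _)%N; apply: eq_bigr => h _.
by rewrite (ltn_eqF (ltn_ord h)).
Qed.

(** The new half joins the place of a live half, never a dead vertex: what has been eliminated stays
    eliminated. *)
Lemma dead_link w : dead H w -> dead (link H p q) w.
Proof.
move=> hd h; rewrite [fr _]/= ltnS leq_eqVlt => /orP[/eqP->|hh].
  rewrite /= eqxx => hv; case: (h_mate hI hq (leq_trans ap apq)) => h1 _ h2 _.
  by have := hd _ h1 hv; rewrite h2 => e; move: ap apq; rewrite e; lia.
rewrite [vt _ _]/= (ltn_eqF hh) => hv; have := link_am_le hh; rewrite (hd h hh hv).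
by rewrite leqn0 => /eqP.
Qed.
End Link.

(* By conservation of flow at [w]. *)
Lemma dead_side H w s : hinv H -> (w < n)%N ->
  (forall h, (h < fr H)%N -> vt H h = w -> si H h = s -> am H h = 0%N) -> dead H w.
Proof.
move=> hI hw hs h hh hv.
have z : side_sum H w s = 0%N.
  rewrite /side_sum big1 // => k _; case: (eqVneq (vt H k) w) => // e.
  by case: (eqVneq (si H k) s) => // e2; rewrite hs ?muln0.
case: (eqVneq (si H h) s) => [|ns]; first exact: hs.
have : side_sum H w (~~ s) = 0%N by move: (h_cons hI hw) z; case: (s) => /= ->.
rewrite /side_sum (bigD1 (Ordinal hh)) //= hv eqxx.
have -> : si H h == ~~ s by move: ns; case: (si H h); case: (s).
by rewrite mul1n => /eqP; rewrite addn_eq0 => /andP[/eqP].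
Qed.
End HeapSteps.

(** * Half-arcs in memory and the elimination loop *)

Record heap_rep (n : nat) (H : heap) (m : memory) : Prop := {
  hr_am : forall h, (h < fr H)%N -> m aAM h%:Z = (am H h)%:Z;
  hr_mt : forall h, (h < fr H)%N -> m aMT h%:Z = (mt H h)%:Z;
  hr_vt : forall h, (h < fr H)%N -> m aVT h%:Z = (vt H h)%:Z;
  hr_si : forall h, (h < fr H)%N -> m aSI h%:Z = (si H h : nat)%:Z;
  hr_fr : m aFR 0 = (fr H)%:Z;
  hr_dg : forall w, (w < n.+2)%N -> m aDG w%:Z = (degree H w)%:Z;
  hr_list : forall w, (w < n.+2)%N -> exists L, [/\ chain (m aNX) (m aHE w%:Z) L, uniq L &
     forall h, (h \in L) = (h < fr H)%N && (vt H h == w)] }.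

Lemma heap_rep_agree n H A m m' : agree_off A m m' ->
  all (fun a => a \notin A) [:: 36; 37; 38; 39; 40; 41; 42; 44]%N ->
  heap_rep n H m -> heap_rep n H m'.
Proof.
move=> h /allP hA [h1 h2 h3 h4 h5 h6 h7].
split; try by move=> *; rewrite h ?hA //; auto.
move=> w hw; have [L [hc hu hL]] := h7 w hw; exists L; split=> //.
by rewrite h ?hA //; apply: chain_ext hc => x _; rewrite h ?hA.
Qed.

Lemma heap_rep_write n H m a i z : a \notin [:: 36; 37; 38; 39; 40; 41; 42; 44]%N ->
  heap_rep n H m -> heap_rep n H (write m a i z).
Proof.
move=> ha; apply: heap_rep_agree; first exact: agree_off_write.
by apply/allP => x hx; rewrite inE; apply: contraNneq ha => <-.
Qed.

Lemma rep_link n K Tm home X H p q m m2 : hinv n K Tm home X H -> heap_rep n H m ->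
  (p < fr H)%N -> (q < fr H)%N -> (0 < am H p)%N -> (am H p <= am H q)%N ->
  vt H q = vt H p -> si H p = ~~ si H q -> vt H (mt H p) != vt H p -> vt H (mt H q) != vt H p ->
  (forall x, m2 aHE x = m aHE x) ->
  (forall x, m2 aNX x = if x == (mt H q)%:Z then (fr H)%:Z else
      if x == (fr H)%:Z then m aNX (mt H q)%:Z else m aNX x) ->
  (forall x, m2 aVT x = if x == (fr H)%:Z then m aVT (mt H q)%:Z else m aVT x) ->
  (forall x, m2 aSI x = if x == (fr H)%:Z then m aSI (mt H q)%:Z else m aSI x) ->
  (forall x, m2 aDG x = if x == m aVT (mt H q)%:Z then m aDG x + 1 else m aDG x) ->
  (forall x, m2 aAM x = if x == p%:Z then 0 else if x == (mt H q)%:Z then m aAM p%:Z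
      else if (x == q%:Z) || (x == (fr H)%:Z) then m aAM q%:Z - m aAM p%:Z else m aAM x) ->
  (forall x, m2 aMT x = if x == (mt H p)%:Z then (mt H q)%:Z else if x == (mt H q)%:Z then (mt H p)%:Z
      else if x == q%:Z then (fr H)%:Z else if x == (fr H)%:Z then q%:Z else m aMT x) ->
  m2 aFR 0 = (fr H).+1%:Z -> heap_rep n (link H p q) m2.
Proof.
move=> hI hr hp hq hap apq vq sp vmp vmq HE NX VT SI DG AM MT FR.
have aq : (0 < am H q)%N by exact: leq_trans apq.
have [mp_lt mmp amp smp] := h_mate hI hp hap.
have [mq_lt mmq amq smq] := h_mate hI hq aq.
have hplace := h_place hI mq_lt.
have zne h : (h < fr H)%N -> (fr H == h) = false by move=> hh; rewrite gtn_eqF.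
have zs := (zne _ hp, zne _ hq, zne _ mp_lt, zne _ mq_lt).
have qc : (q == mt H q) = false by apply/eqP => E; move: vmq; rewrite -E vq eqxx.
have qa : (q == mt H p) = false by apply/eqP => E; move: vmp; rewrite -E vq eqxx.
have ca : (mt H q == mt H p) = false.
  by apply/eqP => E; move: smq; rewrite E smp sp; case: (si H q).
split => /=.
+ move=> h; rewrite ltnS leq_eqVlt AM !eqz_nat => /orP[/eqP->|hh].
    by rewrite !zs eqxx ?orbT !(hr_am hr) // subzn.
  rewrite (ltn_eqF hh) !orbF; case: (eqVneq h p) => // _.
  case: (eqVneq h q) => [->|_]; last by case: eqP => _; rewrite (hr_am hr).
  by rewrite qc !(hr_am hr) // subzn.
+ move=> h; rewrite ltnS leq_eqVlt MT !eqz_nat => /orP[/eqP->|hh].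
    by rewrite !zs eqxx.
  rewrite (ltn_eqF hh); case: (eqVneq h q) => [->|hnq]; first by rewrite qa qc.
  case: (eqVneq h (mt H q)) => [->|_]; first by rewrite ca.
  by case: eqP => // _; rewrite (hr_mt hr).
+ move=> h; rewrite ltnS leq_eqVlt VT !eqz_nat => /orP[/eqP->|hh].
    by rewrite eqxx (hr_vt hr).
  by rewrite (ltn_eqF hh) (hr_vt hr).
+ move=> h; rewrite ltnS leq_eqVlt SI !eqz_nat => /orP[/eqP->|hh].
    by rewrite eqxx (hr_si hr).
  by rewrite (ltn_eqF hh) (hr_si hr).
+ by rewrite FR.
+ move=> w hw; rewrite DG (hr_vt hr) // eqz_nat degree_link (hr_dg hr) // eq_sym.
  by case: (_ == _); rewrite ?addn0 ?PoszD.
+ move=> w hw; have [L [hc hu hL]] := hr_list hr hw.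
  have zL : fr H \notin L by rewrite hL ltnn.
  have ext h : (h < fr H)%N -> h != mt H q -> m2 aNX h%:Z = m aNX h%:Z.
    by move=> h1 /negPf h2; rewrite NX !eqz_nat h2 (ltn_eqF h1).
  case: (eqVneq (vt H (mt H q)) w) => vw.
    have bL : mt H q \in L by rewrite hL mq_lt vw eqxx.
    have [||h h1 h2|L' [l1 l2 l3]] := @chain_insert (m aNX) (m2 aNX) _ _ _ (fr H) hc bL zL hu.
    * by rewrite NX !eqz_nat !zs eqxx.
    * by rewrite NX eqxx.
    * by apply: ext => //; move: h1; rewrite hL => /andP[].
    exists L'; split=> //; first by rewrite HE.
    move=> h; rewrite l3 inE hL ltnS [in RHS]leq_eqVlt.
    case: (eqVneq h (fr H)) => [->|hn] //=.
    by rewrite ?vw ?eqxx.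
  exists L; split=> //.
    rewrite HE; apply: chain_ext hc => h; rewrite hL => /andP[h1 h2].
    by apply: ext => //; apply: contraNneq vw => E; rewrite -E.
  move=> h; rewrite hL ltnS [in RHS]leq_eqVlt; case: (eqVneq h (fr H)) => [->|hn] //=.
  by rewrite ltnn (negPf vw).
Qed.

Section Elimination.
Variables (R : realType) (phi : R) (O : network -> seq nat) (b : nat).
Hypothesis b3 : (3 <= b)%N.
Local Notation ptriple := (ptriple phi O b).

Lemma ptriple_step a e1 e2 c m t (Q : memory -> Prop) :
  (0 < t)%N && (simple e1 && simple e2) ->
  (bounded b m -> (`|eval phi m e2| < 2 ^ b)%N) ->
  ptriple c (write m a (eval phi m e1) (eval phi m e2)) t.-1 Q ->
  ptriple (Seq (Assign a e1 e2) c) m t Q.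
Proof.
move=> /and3P[t0 s1 s2] hz hc; apply: triple_bounded => hm.
by apply: ptriple_aseq => //; exact: hz.
Qed.

Lemma bounded_lt m a i : bounded b m -> (`|m a i| < 2 ^ b)%N.
Proof. by move=> hm; rewrite -bitsize_le ?hm //; lia. Qed.

Lemma ptriple_copy a e1 x e2 c m t (Q : memory -> Prop) :
  (0 < t)%N && (simple e1 && simple (Get x e2)) ->
  ptriple c (write m a (eval phi m e1) (m x (eval phi m e2))) t.-1 Q ->
  ptriple (Seq (Assign a e1 (Get x e2)) c) m t Q.
Proof. by move=> h hc; apply: ptriple_step => // hm; exact: (bounded_lt x (eval phi m e2) hm). Qed.

Lemma ptriple_copy1 a e1 x e2 m t (Q : memory -> Prop) :
  (0 < t)%N && (simple e1 && simple (Get x e2)) ->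
  Q (write m a (eval phi m e1) (m x (eval phi m e2))) ->
  ptriple (Assign a e1 (Get x e2)) m t Q.
Proof.
move=> /and3P[t0 s1 s2] hc; apply: triple_bounded => hm.
by apply: ptriple_assign => //; exact: (bounded_lt x (eval phi m e2) hm).
Qed.

Lemma link_spec m (p q a c z : nat) : m aP 0 = p%:Z -> m aQ 0 = q%:Z -> m aMT p%:Z = a%:Z ->
  m aMT q%:Z = c%:Z -> m aFR 0 = z%:Z -> c <> z -> q <> z -> p <> z -> p <> q -> c <> q ->
  (z.+1 < 2 ^ b)%N -> (absz (m aAM q%:Z - m aAM p%:Z)%R < 2 ^ b)%N ->
  (absz (m aDG (m aVT c%:Z) + 1)%R < 2 ^ b)%N ->
  ptriple link_cmd m 17 (fun m' =>
   [/\ forall x, m' aNX x = if x == c%:Z then z%:Z else if x == z%:Z then m aNX c%:Z else m aNX x,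
      forall x, m' aVT x = if x == z%:Z then m aVT c%:Z else m aVT x,
      forall x, m' aSI x = if x == z%:Z then m aSI c%:Z else m aSI x,
      forall x, m' aDG x = if x == m aVT c%:Z then m aDG x + 1 else m aDG x &
   [/\ forall x, m' aAM x = if x == p%:Z then 0 else if x == c%:Z then m aAM p%:Z
          else if (x == q%:Z) || (x == z%:Z) then m aAM q%:Z - m aAM p%:Z else m aAM x,
      forall x, m' aMT x = if x == a%:Z then c%:Z else if x == c%:Z then a%:Z
          else if x == q%:Z then z%:Z else if x == z%:Z then q%:Z else m aMT x &
      m' aFR 0 = z.+1%:Z]]).
Proof.
move=> eP eQ eA eC eZ cz qz pz pq cq zb hb1 hb2.
have b0 : (0 < 2 ^ b)%N by rewrite expn_gt0.
have E (x y : nat) : x <> y -> (x%:Z == y%:Z) = false by move=> h; apply/eqP; lia.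
rewrite /link_cmd.
have Es := (E _ _ cz, E _ _ qz, E _ _ pz, E _ _ pq, E _ _ cq,
  E _ _ (not_eq_sym cz), E _ _ (not_eq_sym qz), E _ _ (not_eq_sym pz),
  E _ _ (not_eq_sym pq), E _ _ (not_eq_sym cq)).
do 7 (apply: ptriple_copy => //; rewrite /write /= ?eP ?eQ ?eA ?eC ?eZ ?eqxx ?Es).
apply: ptriple_step => //=; first by rewrite ?Es.
rewrite /write /= ?Es.
apply: ptriple_step => //=; first by rewrite ?eP ?eQ.
rewrite /write /= ?eP ?eQ.
do 2 (apply: ptriple_copy => //; rewrite /write /= ?eP ?eQ ?eqxx ?Es).
apply: ptriple_step => //; rewrite /write /= ?eP.
do 4 (apply: ptriple_copy => //; rewrite /write /= ?eP ?eQ ?eqxx ?Es).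
apply: ptriple_assign => //=; first by lia.
rewrite /write /= ?eqxx; split=> // [x|]; first by case: eqP => [->|].
split=> [x|x|]; last by lia.
  by case: (x == p%:Z) => //; case: (x == c%:Z) => //; case: (x == q%:Z).
by [].
Qed.

Lemma kill_spec m a (p c : nat) : a != aAM -> a != aMT -> m a 0 = p%:Z -> m aMT p%:Z = c%:Z ->
  ptriple (kill_cmd a) m 2 (fun m' => agree_off [:: aAM] m m' /\
    forall x, m' aAM x = if (x == p%:Z) || (x == c%:Z) then 0 else m aAM x).
Proof.
move=> /negPf na1 /negPf na2 ea ec; have b0 : (0 < 2 ^ b)%N by rewrite expn_gt0.
apply: ptriple_step => //=.
rewrite /write /= ea ec.
apply: ptriple_assign => //=; rewrite /write /= na1 /= ea; split.
  by move=> y; rewrite inE => /negPf hy x; rewrite hy.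
by move=> x; rewrite /= ; case: (x == p%:Z) => //=.
Qed.

Lemma chain_cons nx x L : chain nx x L -> 0 <= x ->
  exists h L', [/\ L = h :: L', x = h%:Z & chain nx (nx h%:Z) L'].
Proof. by case: L => [-> //|h L [-> hc] _]; exists h, L. Qed.

Lemma chain_nil nx x L : chain nx x L -> x < 0 -> L = [::].
Proof. by case: L => // h L [-> _]. Qed.

Section Vertex.
Variables (n K : nat) (Tm : pred nat) (home : nat -> nat) (X : pred nat -> nat).
Local Notation hinv := (hinv n K Tm home X).
Variables (v : nat) (H0 : heap).
Hypothesis vn : (v < n)%N.

(** [ex_count] carries the amortisation: a half is created only when a live half at [v] dies, so
    that eliminating [v] creates at most [live H0 v] halves. *)
Record extends (H : heap) : Prop := {
  ex_fr : (fr H0 <= fr H)%N;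
  ex_vt : forall h, (h < fr H0)%N -> vt H h = vt H0 h;
  ex_dead : forall w, dead H0 w -> dead H w;
  ex_count : (fr H + live H v <= fr H0 + live H0 v)%N }.

(** [Ri] and [Rj] are the parts of the list of [v] still ahead of the two pointers; the live
    entering halves all lie in the first, the live leaving ones in the second. The factor 30 exceeds
    the cost 29 of one turn. *)
Definition elim_inv (B : nat) (m : memory) : Prop := exists H Ri Rj,
  [/\ heap_rep n H m, hinv H, m aVI 0 = v%:Z, extends H &
  [/\ chain (m aNX) (m aPA 0) Ri, chain (m aNX) (m aPB 0) Rj,
    forall h, h \in Ri ++ Rj -> (h < fr H)%N /\ vt H h = v,
    forall h, (h < fr H)%N -> vt H h = v -> (0 < am H h)%N ->
      h \in (if si H h then Rj else Ri) &
    B = (30 * (size Ri + size Rj + live H v))%N]].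

Hypothesis frb : (fr H0 + fr H0 + n + 10 < 2 ^ b)%N.

(** Every branch advances a pointer or lowers [live H v]. A splice changes a list only behind the
    mate of [q], which is at another vertex, so both remaining parts of the list of [v] survive. *)
Lemma elim_body_spec B m : bounded b m -> elim_inv B m -> 0 <= m aPA 0 -> 0 <= m aPB 0 ->
  exists tb B', (tb + B' < B)%N /\ ptriple elim_body m tb (elim_inv B').
Proof.
move=> hm [H [Ri [Rj [hr hI hv hx [ci cj hR hL eB]]]]] /(chain_cons ci) [i [Ri' [eRi ei ci']]].
move=> /(chain_cons cj) [j [Rj' [eRj ej cj']]].
have [i_lt vi] : (i < fr H)%N /\ vt H i = v by apply: hR; rewrite eRi mem_head.
have [j_lt vj] : (j < fr H)%N /\ vt H j = v by apply: hR; rewrite mem_cat eRj mem_head orbT.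
have li : (live H v <= live H v)%N by [].
exists 29%N.
have eai := hr_am hr i_lt; have eaj := hr_am hr j_lt.
have esi := hr_si hr i_lt; have esj := hr_si hr j_lt.
have skip_i : (am H i = 0%N \/ si H i) -> forall m', heap_rep n H m' -> agree_off [:: aPA] m m' ->
    m' aPA 0 = m aNX i%:Z -> elim_inv (30 * (size Ri' + size Rj + live H v)) m'.
  move=> hi m' hr' ha e; exists H, Ri', Rj; split=> //; first by rewrite ha.
  split=> //.
  - by rewrite e; apply: chain_ext ci' => x _; rewrite ha.
  - by rewrite ha //; apply: chain_ext cj => x _; rewrite ha.
  - by move=> h hh; apply: hR; rewrite eRi inE hh orbT.
  - move=> h h1 h2 h3; have := hL h h1 h2 h3; case sh : (si H h) => //.
    rewrite eRi inE => /orP[/eqP E|//]; move: h3 sh; rewrite E.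
    by case: hi => ->.
have skip_j : (am H j = 0%N \/ ~~ si H j) -> forall m', heap_rep n H m' -> agree_off [:: aPB] m m' ->
    m' aPB 0 = m aNX j%:Z -> elim_inv (30 * (size Ri + size Rj' + live H v)) m'.
  move=> hj m' hr' ha e; exists H, Ri, Rj'; split=> //; first by rewrite ha.
  split=> //.
  - by rewrite ha //; apply: chain_ext ci => x _; rewrite ha.
  - by rewrite e; apply: chain_ext cj' => x _; rewrite ha.
  - move=> h; rewrite mem_cat => hh; apply: hR; rewrite mem_cat eRj inE.
    by case/orP: hh => ->; rewrite ?orbT.
  - move=> h h1 h2 h3; have := hL h h1 h2 h3; case sh : (si H h) => //.
    rewrite eRj inE => /orP[/eqP E|//]; move: h3 sh; rewrite E.
    by case: hj => [->|/negPf->].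
case: (boolP ((am H i == 0%N) || si H i)) => ci1.
  exists (30 * (size Ri' + size Rj + live H v))%N; split; first by rewrite eB eRi /=; lia.
  apply: (ptriple_if b3) => //=; rewrite ei eai esi; last first.
    by move=> e; exfalso; move: e; case/orP: ci1 => [/eqP->|->]; lia.
  move=> _; apply: ptriple_assign => //=; rewrite ei; first exact: bounded_lt.
  apply: skip_i => //.
  - by case/orP: ci1 => [/eqP->|->]; [left|right].
  - exact: heap_rep_write.
  - exact: agree_off_write.
move: ci1; rewrite negb_or -lt0n => /andP[ai si_i].
case: (boolP ((am H j == 0%N) || ~~ si H j)) => cj1.
  exists (30 * (size Ri + size Rj' + live H v))%N; split; first by rewrite eB eRj /=; lia.
  apply: (ptriple_if b3) => //=; rewrite ei eai esi (negPf si_i).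
    by move=> e; exfalso; move: e; have -> : ((am H i)%:Z <= 0) = false by lia.
  move=> _; apply: (ptriple_if b3) => //=; rewrite ej eaj esj; last first.
    by move=> e; exfalso; move: e; case/orP: cj1 => [/eqP->|/negPf->]; lia.
  move=> _; apply: ptriple_assign => //=; rewrite ej; first exact: bounded_lt.
  apply: skip_j => //.
  - by case/orP: cj1 => [/eqP->|->]; [left|right].
  - exact: heap_rep_write.
  - exact: agree_off_write.
move: cj1; rewrite negb_or -lt0n negbK => /andP[aj si_j].
have [mi_lt mmi ami smi] := h_mate hI i_lt ai.
have [mj_lt mmj amj smj] := h_mate hI j_lt aj.
have emi := hr_mt hr i_lt; have emj := hr_mt hr j_lt.
have evmi := hr_vt hr mi_lt; have evmj := hr_vt hr mj_lt.
have enter (c : cmd) t Q : ptriple c m t Q ->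
    ptriple (If (Add (Le (Get aAM (V aPA)) (C 0)) (Get aSI (V aPA)))
    (Assign aPA (C 0) (Get aNX (V aPA)))
  (If (Add (Le (Get aAM (V aPB)) (C 0)) (Sub (C 1) (Get aSI (V aPB))))
    (Assign aPB (C 0) (Get aNX (V aPB))) c)) m t.+2 Q.
  move=> hc; apply: (ptriple_if b3) => //=; rewrite ei eai esi (negPf si_i).
    by move=> e; exfalso; move: e; have -> : ((am H i)%:Z <= 0) = false by lia.
  move=> _; apply: (ptriple_if b3) => //=; rewrite ej eaj esj si_j.
  by move=> e; exfalso; move: e; have -> : ((am H j)%:Z <= 0) = false by lia.
have vtest x y (c1 c2 : cmd) t Q m' : m' aVI 0 = v%:Z -> m' x 0 = y%:Z ->
    m' aVT (m' aMT y%:Z) = (vt H (mt H y))%:Z ->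
    (vt H (mt H y) = v -> ptriple c1 m' t Q) ->
    (vt H (mt H y) != v -> ptriple c2 m' t Q) -> ptriple (If (at_vertex x) c1 c2) m' t.+1 Q.
  move=> h1 h2 h3 h4 h5; apply: (ptriple_if b3) => //=; rewrite h2 h3 h1.
    case: (eqVneq (vt H (mt H y)) v) => [/h4//|ne].
    by case: lerP => h6; case: lerP => h7 //; rewrite ?mulr0 //; move/eqP: ne; lia.
  case: (eqVneq (vt H (mt H y)) v) => [->|/h5//].
  by rewrite lexx.
have kill_ok y m' : (y < fr H)%N -> (0 < am H y)%N -> vt H y = v -> vt H (mt H y) = v ->
    agree_off [:: aAM] m m' ->
    (forall x, m' aAM x = if (x == y%:Z) || (x == (mt H y)%:Z) then 0 else m aAM x) ->
    elim_inv (30 * (size Ri + size Rj + live (kill H y) v)) m'.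
  move=> hy ay vy vmy ha hA; exists (kill H y), Ri, Rj.
  have hl : (live (kill H y) v < live H v)%N by rewrite -vy; exact: live_kill.
  split.
  - split => /=; try by move=> *; peel; case: hr; auto.
    + move=> h hh; rewrite hA (hr_am hr) //.
      by rewrite !eqz_nat; case: (_ || _).
    + move=> w hw; have [L [hc hu hL']] := hr_list hr hw; exists L; split=> //.
      by peel; apply: chain_ext hc => x _; peel.
  - by apply: hinv_kill; rewrite ?vy.
  - by peel.
  - case: hx => x1 x2 x3 x4; split=> //=; last by lia.
    by move=> w /x3; exact: dead_kill.
  split=> //.
  - by peel; apply: chain_ext ci => x _; peel.
  - by peel; apply: chain_ext cj => x _; peel.
  - move=> h h1 h2 /=; case: ifP => // _; exact: hL.
case: (eqVneq (vt H (mt H i)) v) => vmi.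
  have hl : (live (kill H i) v < live H v)%N by rewrite -vi; exact: live_kill.
  exists (30 * (size Ri + size Rj + live (kill H i) v))%N; split; first by lia.
  apply: (@ptriple_conseq _ _ _ _ _ _ 5 _ (elim_inv (30 * (size Ri + size Rj + live (kill H i) v)))) => //.
  apply: enter; apply: (vtest aPA i) => //; rewrite ?emi //; last by rewrite vmi eqxx.
  move=> _; apply: ptriple_conseq (kill_spec _ _ ei emi) (leqnn _) _ => // m' _ [h1 h2].
  exact: kill_ok.
case: (eqVneq (vt H (mt H j)) v) => vmj.
  have hl : (live (kill H j) v < live H v)%N by rewrite -vj; exact: live_kill.
  exists (30 * (size Ri + size Rj + live (kill H j) v))%N; split; first by lia.
  apply: (@ptriple_conseq _ _ _ _ _ _ 6 _ (elim_inv (30 * (size Ri + size Rj + live (kill H j) v)))) => //.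
  apply: enter; apply: (vtest aPA i) => //; rewrite ?emi //; first by move=> e; rewrite e eqxx in vmi.
  move=> _; apply: (vtest aPB j) => //; rewrite ?emj //; last by rewrite vmj eqxx.
  move=> _; apply: ptriple_conseq (kill_spec _ _ ej emj) (leqnn _) _ => // m' _ [h1 h2].
  exact: kill_ok.
have link_ok p q m' : (p < fr H)%N -> (q < fr H)%N -> (0 < am H p)%N -> (am H p <= am H q)%N ->
    vt H p = v -> vt H q = v -> si H p = ~~ si H q -> vt H (mt H p) != v -> vt H (mt H q) != v ->
    heap_rep n H m' -> agree_off [:: aP; aQ] m m' -> bounded b m' ->
    m' aP 0 = p%:Z -> m' aQ 0 = q%:Z ->
    ptriple link_cmd m' 17 (elim_inv (30 * (size Ri + size Rj + live (link H p q) v))).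
  move=> hp hq hap apq vp vq sp vmp vmq hr' ha' hm' eP eQ.
  have aq : (0 < am H q)%N by exact: leq_trans apq.
  have [mp_lt mmp amp smp] := h_mate hI hp hap.
  have [mq_lt mmq amq smq] := h_mate hI hq aq.
  have hl : (live (link H p q) v < live H v)%N by rewrite -vp; apply: (live_link hI); rewrite ?vq ?vp.
  (* At most one new half for each live half of the beginning, so the number of halves at most
     doubles and [frb] keeps the indices within a word. *)
  have frH : (fr H <= fr H0 + fr H0)%N.
    apply: leq_trans (leq_addr _ _) (leq_trans (ex_count hx) _).
    by rewrite leq_add2l (leq_trans (live_le_degree H0 v)) // degree_le_fr.
  have hplace := h_place hI mq_lt.
  have nb := bounded_lt aAM q%:Z hm'; have nb2 := bounded_lt aAM p%:Z hm'.
  have pq : p <> q by move=> E; move: sp; rewrite E; case: (si H q).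
  have cq : mt H q <> q by move=> E; move: vmq; rewrite E vq eqxx.
  have pc : p <> mt H q by move=> E; move: vmq; rewrite -E vp eqxx.
  have qa : q <> mt H p by move=> E; move: vmp; rewrite -E vq eqxx.
  have zb : ((fr H).+1 < 2 ^ b)%N.
    by clear - frH frb; lia.
  have hb1 : (absz (m' aAM q%:Z - m' aAM p%:Z)%R < 2 ^ b)%N.
    by move: nb; rewrite !(hr_am hr') // subzn // !absz_nat; apply: leq_ltn_trans; exact: leq_subr.
  have hb2 : (absz (m' aDG (m' aVT (mt H q)%:Z) + 1)%R < 2 ^ b)%N.
    rewrite (hr_vt hr') // (hr_dg hr') // -PoszD absz_nat addn1.
    by apply: leq_ltn_trans zb; rewrite ltnS degree_le_fr.
  have fne h : (h < fr H)%N -> h <> fr H by move=> hh E; rewrite E ltnn in hh.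
  apply: ptriple_conseq (ptriple_frame (link_spec eP eQ (hr_mt hr' hp) (hr_mt hr' hq) (hr_fr hr')
    (fne _ mq_lt) (fne _ hq) (fne _ hp) pq cq zb hb1 hb2)) (leqnn _) _.
  move=> m2 hm2 [ha2 [NX VT SI DG [AM MT FR]]].
  exists (link H p q), Ri, Rj; split.
  - by apply: (rep_link hI hr') => //; rewrite ?vp ?vq // => x; rewrite ha2.
  - by apply: hinv_link; rewrite ?vp ?vq.
  - by rewrite ha2 // ha'.
  - case: hx => x1 x2 x3 x4; split=> /=; [exact: leqW| | |by apply: leq_trans x4; rewrite addSnnS leq_add2l].
    + by move=> h hh; rewrite (ltn_eqF (leq_trans hh x1)) x2.
    + move=> w /x3 hd; by apply: (dead_link hI hp hq hap apq) => //; rewrite ?vq ?vp.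
  have old h : h \in Ri ++ Rj -> (h < fr H)%N /\ h != mt H q.
    by move=> /hR[h1 h2]; split=> //; apply: contraNneq vmq => <-; rewrite h2.
  have ext h : h \in Ri ++ Rj -> m2 aNX h%:Z = m aNX h%:Z.
    by move=> /old[h1 /negPf h2]; rewrite NX !eqz_nat h2 (ltn_eqF h1) ha'.
  split=> //.
  - rewrite ha2 // ha' //; apply: chain_ext ci => h hh; apply: ext; by rewrite mem_cat hh.
  - rewrite ha2 // ha' //; apply: chain_ext cj => h hh; apply: ext; by rewrite mem_cat hh orbT.
  - by move=> h /hR[h1 h2]; rewrite /= (ltn_eqF h1); split=> //; exact: ltnW.
  - move=> h; rewrite [fr _]/= ltnS leq_eqVlt => /orP[/eqP->|hh].
      by rewrite /= eqxx => e; rewrite e eqxx in vmq.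
    rewrite [vt _ _]/= [si _ _]/= (ltn_eqF hh) => h1 h2; apply: hL => //.
    apply: leq_trans h2 _; apply: (link_am_le hI) => //.
set B' := fun H' => (30 * (size Ri + size Rj + live H' v))%N.
pose p := if (am H i <= am H j)%N then i else j.
pose q := if (am H i <= am H j)%N then j else i.
exists (B' (link H p q)).
have [hp hq] : (p < fr H)%N /\ (q < fr H)%N by rewrite /p /q; case: ifP.
have [hap hle] : (0 < am H p)%N /\ (am H p <= am H q)%N.
  by rewrite /p /q; case: (leqP (am H i) (am H j)) => [h|/ltnW h].
have [vp vq] : vt H p = v /\ vt H q = v by rewrite /p /q; case: ifP.
have [vmp vmq] : vt H (mt H p) != v /\ vt H (mt H q) != v by rewrite /p /q; case: ifP.
have sp : si H p = ~~ si H q by rewrite /p /q; case: ifP => _; rewrite (negPf si_i) si_j.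
have hl : (live (link H p q) v < live H v)%N by rewrite -vp; apply: (live_link hI); rewrite ?vq ?vp.
split; first by rewrite eB /B'; lia.
apply: (@ptriple_conseq _ _ _ _ _ _ 24 _ (elim_inv (B' (link H p q)))) => //.
apply: enter; apply: (vtest aPA i) => //; rewrite ?emi //; first by move=> e; rewrite e eqxx in vmi.
move=> _; apply: (vtest aPB j) => //; rewrite ?emj //; first by move=> e; rewrite e eqxx in vmj.
move=> _.
apply: (ptriple_seqf (t1 := 3) (t2 := 17) (Q1 := fun m1 => m1 aP 0 = p%:Z /\ m1 aQ 0 = q%:Z)) => //.
  apply: (ptriple_if b3) => //=; rewrite ei ej eai eaj lez_nat => hc.
    have hc' : (am H i <= am H j)%N by move: hc; case: (_ <= _)%N.
    apply: ptriple_copy => //=; apply: ptriple_copy1 => //=.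
    by rewrite /write /= ei ej /p /q hc'.
  have hc' : (am H i <= am H j)%N = false by move: hc; case: (_ <= _)%N.
  apply: ptriple_copy => //=; apply: ptriple_copy1 => //=.
  by rewrite /write /= ei ej /p /q hc'.
move=> m1 hm1 ha1 [e1 e2]; apply: link_ok => //; last first.
  by apply: (agree_off_sub _ ha1) => x; rewrite !inE => /or4P[] ->; rewrite ?orbT.
exact: (heap_rep_agree ha1).
Qed.
End Vertex.
End Elimination.

(** * Matchings from flows *)

(* The alive vertices have total degree at most [D = 4 N] throughout, so that at
   most [D / aTH] of them survive a pass; the next one, with threshold doubled,
   therefore costs [O(D)] again. *)
Definition pass_cmd : cmd :=
  for_loop aVI (V 0)
    (If (Mul (Get aAL (V aVI)) (Le (Get aDG (V aVI)) (V aTH))) elim_cmd Skip).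

Definition decompose_cmd : cmd :=
  Assign aTH (C 0) (C 1) ;;
  While (Le (V aTH) (Mul (C 4) (Add (V aNN) (V aNN))))
    (pass_cmd ;; Assign aTH (C 0) (Add (V aTH) (V aTH))).

Lemma sum_ord_split (F : nat -> nat) (m n : nat) : (m <= n)%N ->
  (\sum_(h < n) F h = \sum_(h < m) F h + \sum_(h < n - m) F (m + h))%N.
Proof. by move=> h; rewrite -[in LHS](subnKC h) big_split_ord. Qed.

Section Extends.
Variables (v : nat) (H0 H : heap).
Hypothesis hx : extends v H0 H.

Lemma extends_split (Q : pred nat) :
  (\sum_(h < fr H) Q (vt H h) <= \sum_(h < fr H0) Q (vt H0 h) + (fr H - fr H0))%N.
Proof.
case: hx => hfr hvt _ _; rewrite (sum_ord_split (fun h => Q (vt H h)) hfr) leq_add //.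
  by apply: leq_sum => h _; rewrite hvt.
rewrite -[leqRHS]card_ord -sum1_card; apply: leq_sum => h _.
by case: (Q _).
Qed.

Lemma extends_degree w : (degree H0 w <= degree H w)%N.
Proof.
case: hx => hfr hvt _ _; rewrite /degree (sum_ord_split (fun h => vt H h == w) hfr).
apply: leq_trans (leq_addr _ _); apply: leq_sum => h _.
by rewrite hvt.
Qed.
End Extends.

Lemma size_list H w L : uniq L -> (forall h, (h \in L) = (h < fr H)%N && (vt H h == w)) ->
  size L = degree H w.
Proof.
move=> hu hL.
have p : perm_eq L [seq h <- iota 0 (fr H) | vt H h == w].
  apply: uniq_perm => //; first by rewrite filter_uniq // iota_uniq.
  by move=> h; rewrite hL mem_filter mem_iota add0n /= andbC.
rewrite (perm_size p) size_filter -sum1_count /degree.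
rewrite -(big_mkord xpredT (fun h => vt H h == w : nat)) /index_iota subn0 big_mkcond.
by apply: eq_bigr => h _; case: (_ == _).
Qed.

Section Decompose.
Variables (R : realType) (phi : R) (O : network -> seq nat) (b : nat).
Hypothesis b3 : (3 <= b)%N.
Local Notation ptriple := (ptriple phi O b).
Variables (n K : nat) (Tm : pred nat) (home : nat -> nat) (X : pred nat -> nat).
Local Notation hinv := (hinv n K Tm home X).

(** Both pointers start on a list of length [degree H0 v], and [live] is no larger, whence
    [90 = 3 * 30]. When a pointer runs off its list, one side of [v] carries nothing, and by
    [dead_side] neither does the other. *)
Lemma elim_spec m (H0 : heap) (v : nat) : heap_rep n H0 m -> hinv H0 -> m aVI 0 = v%:Z ->
  (v < n)%N -> (fr H0 + fr H0 + n + 10 < 2 ^ b)%N ->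
  ptriple elim_cmd m (90 * degree H0 v + 10) (fun m' => exists H,
    [/\ heap_rep n H m', hinv H, extends v H0 H, dead H v &
      forall x, m' aAL x = if x == v%:Z then 0 else m aAL x]).
Proof.
move=> hr hI hv vn frb.
rewrite (_ : 90 * degree H0 v + 10 = (90 * degree H0 v + 7).+3)%N; last by clear; lia.
apply: ptriple_step => //=; first by move=> _; rewrite expn_gt0.
rewrite hv; set m1 := write _ _ _ _.
have hr1 : heap_rep n H0 m1 by exact: heap_rep_write.
apply: ptriple_copy => //; apply: ptriple_copy => //.
set m2 := write _ aPB _ _.
have hr2 : heap_rep n H0 m2 by do 2 (apply: heap_rep_write => //).
have vn2 : (v < n.+2)%N by rewrite (leq_trans vn) // -addn2 leq_addr.
have [L [hc hu hL]] := hr_list hr2 vn2.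
have hs := size_list hu hL.
have ha : m2 aAL =1 m1 aAL by [].
have ePA : m2 aPA 0 = m2 aHE v%:Z by rewrite /m2 /m1 /write /= hv.
have ePB : m2 aPB 0 = m2 aHE v%:Z by rewrite /m2 /m1 /write /= hv.
have eVI : m2 aVI 0 = v%:Z by [].
have eAL x : m1 aAL x = if x == v%:Z then 0 else m aAL x by rewrite /m1 /write.
have hB : (30 * (size L + size L + live H0 v) < 90 * degree H0 v + 7)%N.
  by have := live_le_degree H0 v; rewrite hs; clear; lia.
clearbody m2 m1.
apply: (@ptriple_conseq _ _ _ _ _ _ _ _ (fun m' => agree_off (mods elim_body) m2 m' /\
   exists H, [/\ heap_rep n H m', hinv H, extends v H0 H & dead H v])); first last.
- move=> m' _ [hag [H [h1 h2 h3 h4]]]; exists H; split=> // x.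
  by rewrite hag // ha eAL.
- exact: leqnn.
apply: (@ptriple_frame _ _ _ _ (While _ elim_body)).
apply: (ptriple_while b3 (Inv := elim_inv n K Tm home X v H0) _ _ hB) => //.
- have e0 : extends v H0 H0 by split.
  exists H0, L, L; split=> //; split=> //; rewrite ?ePA ?ePB //.
  + by move=> h; rewrite mem_cat orbb hL => /andP[h1 /eqP].
  + by move=> h h1 h2 _; case: ifP => _; rewrite hL h1 h2 eqxx.
- move=> B m3 hm3 hI3 /=; case: lerP => [hA|_]; last by rewrite mul0r.
  case: lerP => [hB'|_]; last by rewrite mulr0.
  by move=> _; exact: elim_body_spec.
move=> B m3 hm3 [H [Ri [Rj [hr3 hI3 _ hx [ci cj hR hLL _]]]]] /= he.
exists H; split=> //.
have [hn|hn] : m3 aPA 0 < 0 \/ m3 aPB 0 < 0.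
- by move: he; case: lerP => [hA|]; [case: lerP => [hB'|]; [|right]|left].
- have e := chain_nil ci hn; apply: (dead_side (s := false) hI3 vn) => h h1 h2 h3.
  apply/eqP; rewrite -leqn0 leqNgt; apply/negP => h4.
  by have := hLL h h1 h2 h4; rewrite h3 e.
- have e := chain_nil cj hn; apply: (dead_side (s := true) hI3 vn) => h h1 h2 h3.
  apply/eqP; rewrite -leqn0 leqNgt; apply/negP => h4.
  by have := hLL h h1 h2 h4; rewrite h3 e.
Qed.

Variable D : nat.
Hypothesis frb : (D * (n + 1) + D * (n + 1) + n + 10 < 2 ^ b)%N.

Definition alive_count (al : pred nat) : nat := (\sum_(v < n) al v)%N.
Definition alive_degree (H : heap) (al : pred nat) : nat :=
  (\sum_(h < fr H) ((vt H h < n)%N && al (vt H h)))%N.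

Lemma alive_degreeE H al : alive_degree H al = (\sum_(v < n | al v) degree H v)%N.
Proof.
rewrite /degree exchange_big; apply: eq_bigr => h _ /=.
case: (ltnP (vt H h) n) => hv /=.
  rewrite big_mkcond (bigD1 (Ordinal hv)) //= eqxx big1 ?addn0; first by case: (al _).
  by move=> u; rewrite -val_eqE /= eq_sym => /negPf->; case: (al _).
rewrite big1 // => u _; have := ltn_ord u; case: eqP => // e.
by rewrite -e ltnNge hv.
Qed.

(** [pi_fr] reserves [D] future halves for each vertex still alive; [pi_deg] guarantees that no
    elimination needs more. *)
Record pass_inv (al : pred nat) (H : heap) (m : memory) : Prop := {
  pi_rep : heap_rep n H m;
  pi_inv : hinv H;
  pi_al : forall v, (v < n)%N -> m aAL v%:Z = (al v : nat)%:Z;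
  pi_dead : forall v, (v < n)%N -> ~~ al v -> dead H v;
  pi_deg : (alive_degree H al <= D)%N;
  pi_fr : (fr H + D * alive_count al <= D * (n + 1))%N }.

Lemma pass_inv_write al H m a i z : a \notin [:: 36; 37; 38; 39; 40; 41; 42; 43; 44]%N ->
  pass_inv al H m -> pass_inv al H (write m a i z).
Proof.
rewrite !inE !negb_or => /and5P[a1 a2 a3 a4 /and5P[a5 a6 a7 a8 a9]] [h1 h2 h3 h4 h5 h6]; split=> //.
  apply: heap_rep_write => //; rewrite !inE !negb_or.
  by do !(apply/andP; split).
by move=> v hv; rewrite /write eq_sym (negPf a8) h3.
Qed.

(** Eliminating [v] removes its degree from the alive total and creates at most as many halves, so
    the total degree of the alive vertices never grows. *)
Lemma pass_inv_elim al H m v H' m' : pass_inv al H m -> (v < n)%N -> al v ->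
  heap_rep n H' m' -> hinv H' -> extends v H H' -> dead H' v ->
  (forall x, m' aAL x = if x == v%:Z then 0 else m aAL x) ->
  pass_inv (fun u => al u && (u != v)) H' m' /\
  alive_count al = (alive_count (fun u => al u && (u != v))).+1.
Proof.
move=> [h1 h2 h3 h4 h5 h6] vn av hr' hI' hx hd hA.
have cnt : alive_count al = (alive_count (fun u => al u && (u != v))).+1.
  rewrite /alive_count (bigD1 (Ordinal vn)) //= av [in RHS](bigD1 (Ordinal vn)) //= eqxx andbF add0n add1n.
  congr (_.+1); apply: eq_bigr => u; rewrite -val_eqE /= => /negPf->.
  by rewrite andbT.
have dv : (degree H v <= D)%N.
  apply: leq_trans h5; rewrite alive_degreeE (bigD1 (Ordinal vn)) //=.
  exact: leq_addr.
have hfr : (fr H' - fr H <= degree H v)%N.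
  rewrite leq_subLR; apply: leq_trans (leq_trans (leq_addr _ _) (ex_count hx)) _.
  by rewrite leq_add2l live_le_degree.
split=> //; split=> //.
- move=> u hu; rewrite hA eqz_nat; case: eqP => [->|/eqP hn]; first by rewrite andbF.
  by rewrite andbT h3.
- move=> u hu; rewrite negb_and negbK => /orP[hn|/eqP->//].
  by apply: (ex_dead hx); exact: h4.
- apply: leq_trans h5.
  apply: leq_trans (extends_split hx (fun w => (w < n)%N && (al w && (w != v)))) _.
  apply: leq_trans (leq_add (leqnn _) hfr) _.
  rewrite -/(alive_degree H (fun u => al u && (u != v))) !alive_degreeE.
  rewrite [leqRHS](bigD1 (Ordinal vn)) //= addnC leq_add2l.
  by rewrite (eq_bigl (fun u : 'I_n => al u && (u != Ordinal vn))).
- move: h6; rewrite cnt mulnS addnA => h6; apply: leq_trans h6; rewrite leq_add2r.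
  by rewrite -leq_subLR; exact: leq_trans dv.
Qed.

(** Degrees only increase, so an alive vertex that was passed over still has degree above [th] at
    the end; the total [D] then bounds the number of survivors. *)
Lemma pass_spec m al H (th : nat) : pass_inv al H m -> m 0%N 0 = n%:Z -> m aTH 0 = th%:Z ->
  ptriple pass_cmd m (3 * n + (4 * n + alive_count al * (90 * th + 15)) + 2) (fun m' =>
    exists al' H', [/\ pass_inv al' H' m', (alive_count al' <= alive_count al)%N &
      (alive_count al' * th.+1 <= D)%N]).
Proof.
move=> hp hn hth.
have nb : (n < 2 ^ b)%N by apply: leq_ltn_trans frb; clear; lia.
apply: (@ptriple_for_budget _ phi O b b3 aVI _ _ (fun k B m1 => exists al1 H1,
   [/\ pass_inv al1 H1 m1, (alive_count al1 <= alive_count al)%N,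
     forall v, (v < k)%N -> al1 v -> (th < degree H1 v)%N &
     B = (4 * (n - k) + alive_count al1 * (90 * th + 15))%N])
   _ _ n (4 * n + alive_count al * (90 * th + 15))%N) => //.
- by exists al, H; split=> //; [exact: pass_inv_write|rewrite subn0].
- move=> k B m1 kn hm1 [al1 [H1 [hp1 hc1 hk1 eB]]] mk ha.
  have eTH : m1 aTH 0 = th%:Z by rewrite ha.
  have eAL := pi_al hp1 kn.
  have kn2 : (k < n.+2)%N by rewrite (leq_trans kn) // -addn2 leq_addr.
  have eDG := hr_dg (pi_rep hp1) kn2.
  case: (boolP (al1 k && (degree H1 k <= th)%N)) => [/andP[ak dk]|hn1]; last first.
    exists 4%N, (4 * (n - k.+1) + alive_count al1 * (90 * th + 15))%N; split.
      by rewrite eB addnA leq_add2r -mulnS subnSK.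
    apply: (ptriple_if b3) => //=; rewrite mk eAL eDG eTH lez_nat.
      by move=> e; exfalso; move: e hn1; case: (al1 k) => //=; case: (_ <= _)%N.
    move=> _; apply: ptriple_skip; exists al1, H1; split=> //; first exact: pass_inv_write.
    move=> v; rewrite ltnS leq_eqVlt => /orP[/eqP->|]; last exact: hk1.
    by move=> a1; move: hn1; rewrite a1 /= -ltnNge.
  have frH : (fr H1 + fr H1 + n + 10 < 2 ^ b)%N.
    have h : (fr H1 <= D * (n + 1))%N by apply: leq_trans (pi_fr hp1); exact: leq_addr.
    by apply: leq_ltn_trans frb; rewrite !leq_add2r leq_add.
  pose al2 u := al1 u && (u != k).
  have cnt : alive_count al1 = (alive_count al2).+1.
    rewrite /alive_count (bigD1 (Ordinal kn)) //= ak [in RHS](bigD1 (Ordinal kn)) //= /al2 eqxx andbF add0n add1n.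
    congr (_.+1); apply: eq_bigr => u; rewrite -val_eqE /= => /negPf->.
    by rewrite andbT.
  exists (90 * th + 15)%N, (4 * (n - k.+1) + alive_count al2 * (90 * th + 15))%N; split.
    by rewrite eB cnt mulSn addnCA leq_add2r leq_mul2l leq_sub2l ?orbT.
  apply: (ptriple_if b3) => //=.
  - by rewrite addnS.
  - move=> _; rewrite addnS /=.
    apply: ptriple_conseq (elim_spec (pi_rep hp1) (pi_inv hp1) mk kn frH) _ _.
      by rewrite leq_add // leq_mul2l dk orbT.
    move=> m2 hm2 [H2 [r1 r2 r3 r4 r5]].
    have [q1 q2] := pass_inv_elim hp1 kn ak r1 r2 r3 r4 r5.
    exists al2, H2; split=> //.
    + exact: pass_inv_write.
    + by apply: leq_trans hc1; rewrite cnt.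
    + move=> v; rewrite ltnS leq_eqVlt => /orP[/eqP->|hv]; first by rewrite /al2 eqxx andbF.
      by move=> /andP[a1 _]; apply: leq_trans (extends_degree r3 v); exact: hk1.
  - by rewrite mk eAL eDG eTH ak lez_nat dk.
- move=> B m1 [al1 [H1 [hp1 hc1 hk1 _]]] _ _; exists al1, H1; split=> //.
  apply: leq_trans (pi_deg hp1); rewrite alive_degreeE /alive_count big_distrl /= [leqRHS]big_mkcond.
  apply: leq_sum => v _; case av : (al1 v); rewrite ?mul0n ?mul1n //.
  exact: hk1.
Qed.

(** The invariant that the number of alive vertices times [2 ^ j] is at most [2 * D] comes from the
    previous pass, whose threshold was half the present one. It makes a pass linear in [D + n]; the
    first pass is cheap because its threshold is 1. *)
Lemma decompose_spec m al H (N k : nat) : pass_inv al H m -> m 0%N 0 = n%:Z -> m aNN 0 = N%:Z ->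
  D = (4 * N)%N -> (0 < N)%N -> (8 * N <= 2 ^ k)%N -> (32 * N + 10 < 2 ^ b)%N ->
  ptriple decompose_cmd m ((k + 2) * (200 * n + 1000 * N + 20)) (fun m' =>
    exists H', [/\ heap_rep n H' m', hinv H' & forall v, (v < n)%N -> dead H' v]).
Proof.
move=> hp hn hN eD N0 hk hb.
have alive_n al' : (alive_count al' <= n)%N.
  by rewrite /alive_count -[leqRHS]card_ord -sum1_card; apply: leq_sum => v _; case: (al' _).
move E : (200 * n + 1000 * N + 20)%N => cost.
have c20 : (20 <= cost)%N by rewrite -E leq_addl.
apply: ptriple_step => //=; first by rewrite muln_gt0 addn_gt0 orbT (leq_trans _ c20).
  by move=> _; clear - hb; lia.
set m1 := write _ _ _ _.
have hp1 : pass_inv al H m1 by exact: pass_inv_write.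
apply: (ptriple_while b3 (B := ((k + 1) * cost)%N) (Inv := fun B m2 => exists j al2 H2,
   [/\ pass_inv al2 H2 m2, m2 0%N 0 = n%:Z, m2 aNN 0 = N%:Z, m2 aTH 0 = (2 ^ j)%N%:Z &
     ((alive_count al2 * 2 ^ j <= 2 * D)%N \/ j = 0%N) /\ (j <= k + 1)%N /\ B = ((k + 1 - j) * cost)%N])) => //.
- exists 0%N, al, H; split=> //; first by split; [right|split=> //; rewrite subn0].
- by move: c20; clear; nia.
- move=> B m2 hm2 [j [al2 [H2 [hp2 n2 N2 t2 [hj [jk eB]]]]]] /=.
  rewrite t2 N2 => hle.
  have {}hle : (2 ^ j <= 8 * N)%N.
    by move: hle; case: lerP => // h _; move: h; clear; lia.
  have jk' : (j <= k)%N by rewrite -(@leq_exp2l 2) //; exact: leq_trans hk.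
  have a2 : (alive_count al2 * 2 ^ j <= 8 * N + n)%N.
    case: hj => [h|->]; first by apply: leq_trans h _; rewrite eD; clear; lia.
    by rewrite muln1; apply: leq_trans (alive_n al2) _; exact: leq_addl.
  have p2 : (0 < 2 ^ j)%N by rewrite expn_gt0.
  exists (7 * n + 105 * (8 * N + n) + 3)%N, ((k + 1 - j.+1) * cost)%N; split.
    have -> : B = (cost + (k + 1 - j.+1) * cost)%N.
      by rewrite eB -mulSn; congr (_ * _)%N; clear - jk'; lia.
    by rewrite ltn_add2r -E; clear - N0; lia.
  apply: (ptriple_seqf (t1 := 7 * n + 105 * (8 * N + n) + 2) (t2 := 1)
     (Q1 := fun m3 => exists al' H', [/\ pass_inv al' H' m3, (alive_count al' <= alive_count al2)%N &
      (alive_count al' * (2 ^ j).+1 <= D)%N])).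
  + apply: ptriple_conseq (pass_spec hp2 n2 t2) _ _ => //.
    move: a2 p2; move: (2 ^ j)%N (alive_count al2) => x y; clear; nia.
  + by rewrite -addnA.
  move=> m3 hm3 ha3 [al3 [H3 [hp3 c3 d3]]].
  have t3 : m3 aTH 0 = (2 ^ j)%N%:Z by rewrite ha3.
  apply: ptriple_assign => //=; rewrite t3 -PoszD addnn -mul2n -expnS.
    by rewrite absz_nat expnS; move: hle hb; clear; lia.
  exists j.+1, al3, H3; split=> //.
  + exact: pass_inv_write.
  + by rewrite /write /= ha3.
  + by rewrite /write /= ha3.
  split; first by left; rewrite expnS mulnCA leq_mul2l /=; apply: leq_trans d3; rewrite leq_mul2l leqnSn orbT.
  by rewrite addn1 ltnS.
move=> B m2 hm2 [j [al2 [H2 [hp2 n2 N2 t2 [hj [jk eB]]]]]] /=.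
rewrite t2 N2 => hle.
have {}hle : (8 * N < 2 ^ j)%N by move: hle; case: lerP => // h _; move: h; clear; lia.
(* The threshold now exceeds [8 * N = 2 * D], which leaves no room for a single alive vertex. *)
have al0 : alive_count al2 = 0%N.
  case: hj => [h|j0]; last by move: hle; rewrite j0 expn0; clear - N0; lia.
  apply/eqP; rewrite -leqn0 -ltnS; move: h hle; rewrite eD; move: (2 ^ j)%N (alive_count _) => x y; clear; nia.
exists H2; split; [exact: pi_rep hp2|exact: pi_inv hp2|].
move=> v vn; apply: (pi_dead hp2) => //; apply/negP => av.
by move: al0; rewrite /alive_count (bigD1 (Ordinal vn)) //= av.
Qed.
End Decompose.

Definition lists_cmd : cmd :=
  for_loop aI (Add (Add (V aNN) (V aNN)) (Add (V aNN) (V aNN)))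
    (Assign aNX (V aI) (Get aHE (Get aVT (V aI))) ;;
     Assign aHE (Get aVT (V aI)) (V aI) ;;
     Assign aDG (Get aVT (V aI)) (Add (Get aDG (Get aVT (V aI))) (C 1))).

Definition build_cmd : cmd :=
  let K := Add (V aNN) (V aNN) in
  fill aI K aMT (C 0) (Add K (V aI)) ;;
  fill aI K aMT K (V aI) ;;
  fill aI K aVT (C 0) (Get aTL (V aI)) ;;
  fill aI K aVT K (Get aHD (V aI)) ;;
  fill aI K aAM (C 0) (Get aF (V aI)) ;;
  fill aI K aAM K (Get aF (V aI)) ;;
  fill aI K aSI (C 0) (C 1) ;;
  fill aI K aSI K (C 0) ;;
  fill aI (Add (V 0) (C 2)) aHE (C 0) (C (-1)) ;;
  fill aI (Add (V 0) (C 2)) aDG (C 0) (C 0) ;;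
  fill aI (V 0) aAL (C 0) (C 1) ;;
  lists_cmd ;;
  Assign aFR (C 0) (Add K K).

(** Arc [k] becomes the leaving half [k] at its tail and the entering half [K + k] at its head. *)
Definition build_heap (K : nat) (tl hd f : nat -> nat) : heap :=
  Heap (fun h => f (if h < K then h else h - K)%N)
       (fun h => if h < K then K + h else h - K)%N
       (fun h => if h < K then tl h else hd (h - K))%N
       (fun h => h < K)%N (K + K)%N.

Lemma build_heap_first K tl hd f h : (h < K)%N ->
  [/\ am (build_heap K tl hd f) h = f h, mt (build_heap K tl hd f) h = (K + h)%N,
      vt (build_heap K tl hd f) h = tl h & si (build_heap K tl hd f) h].
Proof. by move=> hh; rewrite /= hh. Qed.

Lemma build_heap_second K tl hd f h :
  [/\ am (build_heap K tl hd f) (K + h) = f h, mt (build_heap K tl hd f) (K + h) = h,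
      vt (build_heap K tl hd f) (K + h) = hd h & si (build_heap K tl hd f) (K + h) = false].
Proof. by rewrite /= ltnNge leq_addr addKn. Qed.

(** * From a saturating flow to half-arcs and to a matching *)

Section InitialHeap.
Local Open Scope nat_scope.
Variables (P : params) (SD : pred nat) (Nw : network) (fl : seq nat).
Local Notation N := (p_N P).
Local Notation n := (p_n P).
Local Notation K := (N + N)%N.
Hypothesis hdv : forall i, (i < N)%N -> (p_dv P i < n)%N.
Hypothesis hdw : forall i, (i < N)%N -> (p_dw P i < n)%N.
Hypothesis hdn : dart_net P SD Nw.
Hypothesis hfl : is_flow Nw fl.
Hypothesis hsat : forall k, (k < N)%N -> nth 0%N fl k = 1%N.

Definition dart_boundary (U : pred nat) : nat :=
  (\sum_(k < N) (U (p_dv P k) && ~~ U (p_dw P k)))%N.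

Hypothesis hrev : forall U : pred nat,
  (\sum_(k < N) (U (p_dw P k) && ~~ U (p_dv P k)))%N = dart_boundary U.

(** The source ends of the unit arcs of [SD] and the sink ends of the others. [home] places such an
    end at the tail of its dart, so that unit arcs cross no cut. *)
Definition terminal (h : nat) : bool :=
  ((h < N)%N && SD h) || [&& (K <= h)%N, (h < K + N)%N & ~~ SD (h - K)].
Definition home (h : nat) : nat := p_dv P (if (h < K)%N then h else h - K)%N.

Definition flow_heap : heap :=
  build_heap K (fun k => (arc_nth Nw k).1.1) (fun k => (arc_nth Nw k).1.2) (nth 0%N fl).

Local Notation hinvP := (hinv n K terminal home (fun U => 4 * p_c P * dart_boundary U)%N).

Lemma half_cases h : (h < K + K)%N -> (h < K)%N \/ exists2 k, (k < K)%N & h = (K + k)%N.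
Proof.
move=> hh; case: (ltnP h K) => h1; [by left|right].
by exists (h - K)%N; rewrite ?subnKC // ltn_subLR.
Qed.

Lemma arc_cases k : (k < K)%N ->
  [\/ (k < N)%N /\ SD k /\ arc_nth Nw k = (n, p_dv P k, 1%N),
      (k < N)%N /\ ~~ SD k /\ arc_nth Nw k = (p_dv P k, n.+1, 1%N) |
      exists2 j, (j < N)%N & k = (N + j)%N /\ arc_nth Nw k = (p_dv P j, p_dw P j, p_c P)].
Proof.
case: hdn => _ _ _ _ d1 d2 _ hk; case: (ltnP k N) => h1.
  by case Sk : (SD k); [apply: Or31|apply: Or32]; rewrite d1 // Sk.
apply: Or33; exists (k - N)%N; first by rewrite ltn_subLR.
by rewrite -d2 ?ltn_subLR // subnKC.
Qed.

(** The factor 4 of the cut bound: a boundary edge has two darts, and the arc of each, carrying at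
    most [p_c P], is counted at both of its halves. *)
Lemma hinv_flow_heap : hinvP flow_heap.
Proof.
split=> //.
- move=> h hh; case: (half_cases hh) => [h1|[k hk ->]] _.
    rewrite /flow_heap; case: (build_heap_first (fun k => (arc_nth Nw k).1.1) (fun k => (arc_nth Nw k).1.2) (nth 0%N fl) h1) => e1 e2 e3 e4.
    case: (build_heap_second K (fun k => (arc_nth Nw k).1.1) (fun k => (arc_nth Nw k).1.2) (nth 0%N fl) h) => e5 e6 e7 e8.
    by rewrite e2 e6 e5 e1 e8 e4; split=> //; rewrite /= ltn_add2l.
  rewrite /flow_heap; case: (build_heap_first (fun k => (arc_nth Nw k).1.1) (fun k => (arc_nth Nw k).1.2) (nth 0%N fl) hk) => e1 e2 e3 e4.
  case: (build_heap_second K (fun k => (arc_nth Nw k).1.1) (fun k => (arc_nth Nw k).1.2) (nth 0%N fl) k) => e5 e6 e7 e8.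
  by rewrite e6 e2 e5 e1 e8 e4; split=> //; rewrite /= ltn_addr.
- move=> h hh; case: (half_cases hh) => [h1|[k hk ->]].
    rewrite /flow_heap /= h1; case: (arc_cases h1) => [[a [_ ->]]|[a [_ ->]]|[j a [_ ->]]] /=.
    + by rewrite ltnW.
    + exact: leq_trans (hdv a) (leqW (leqnSn _)).
    + exact: leq_trans (hdv a) (leqW (leqnSn _)).
  have [_ _ -> _] := build_heap_second K (fun k => (arc_nth Nw k).1.1) (fun k => (arc_nth Nw k).1.2) (nth 0%N fl) k.
  case: (arc_cases hk) => [[a [_ ->]]|[a [_ ->]]|[j a [_ ->]]] /=.
  + exact: leq_trans (hdv a) (leqW (leqnSn _)).
  + by [].
  + exact: leq_trans (hdw a) (leqW (leqnSn _)).
- move=> w hw.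
  have E s : side_sum flow_heap w s =
     \sum_(i < K) (((arc_nth Nw i).1.1 == w) && (true == s)) * nth 0 fl i +
     \sum_(i < K) (((arc_nth Nw i).1.2 == w) && (false == s)) * nth 0 fl i.
    rewrite /side_sum /flow_heap [fr _]/= big_split_ord; congr (_ + _); apply: eq_bigr => i _.
      by rewrite /= ltn_ord.
    by rewrite /= ltnNge leq_addr /= addKn.
  rewrite !E /= [X in _ + X]big1 ?addn0 => [|i _]; last by rewrite andbF.
  rewrite [X in _ = X + _]big1 ?add0n => [|i _]; last by rewrite andbF.
  have [sz _ hc] := hfl.
  have := hc w; rewrite (dn_nodes hdn) (dn_source hdn) (dn_sink hdn).
  move=> /(_ (leq_trans hw (leqW (leqnSn _)))).
  rewrite (ltn_eqF hw) (ltn_eqF (leq_trans hw (leqnSn _))) => /(_ isT isT).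
  rewrite /inflow /outflow (dn_size hdn) => e.
  transitivity (\sum_(i < K | (arc_nth Nw i).1.1 == w) nth 0 fl i)%N.
    rewrite [RHS]big_mkcond; apply: eq_bigr => i _; rewrite andbT.
    by case: (_ == _); rewrite ?mul1n ?mul0n.
  rewrite -e [LHS]big_mkcond; apply: eq_bigr => i _; rewrite andbT.
  by case: (_ == _); rewrite ?mul1n ?mul0n.
- move=> U; rewrite /crossing [fr _]/= big_split_ord /=.
  (* A unit arc has both ends located at the same vertex, so only the dart arcs contribute. *)
  have E k : (k < K)%N -> (nth 0 fl k * (U (loc n home flow_heap k) != U (loc n home flow_heap (K + k))) <=
      if (k < N)%N then 0 else p_c P * (U (p_dv P (k - N)) != U (p_dw P (k - N))))%N.
    move=> hk; have hkk : (K + k < K)%N = false by rewrite ltnNge leq_addr.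
    rewrite /loc /flow_heap /= hk hkk addKn /home hk hkk addKn.
    case: (arc_cases hk) => [[a [_ ->]]|[a [_ ->]]|[j a [ek e]]] /=.
    + by rewrite a ltnn hdv // eqxx muln0.
    + by rewrite a hdv // ltnNge leqnSn /= eqxx muln0.
    + rewrite e /= hdv // hdw // ek ltnNge leq_addr /= addKn leq_mul2r.
      case: hfl => _ hcap _; have := hcap (N + j)%N; rewrite (dn_size hdn) -ek e => -> //.
      by rewrite orbT.
  have E2 : (\sum_(k < K) (if (k < N)%N then 0 else p_c P * (U (p_dv P (k - N)) != U (p_dw P (k - N)))) =
      2 * p_c P * dart_boundary U)%N.
    rewrite big_split_ord /= big1 ?add0n => [|k _]; last by rewrite ltn_ord.
    rewrite (_ : 2 * p_c P * dart_boundary U = p_c P * (dart_boundary U + dart_boundary U)); last by clear; lia.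
    rewrite -{2}hrev /dart_boundary -big_split /= big_distrr /=.
    apply: eq_bigr => k _; rewrite ltnNge leq_addr /= addKn; congr (_ * _)%N.
    by case: (U _); case: (U _).
  rewrite (_ : 4 * p_c P * dart_boundary U = 2 * p_c P * dart_boundary U + 2 * p_c P * dart_boundary U)%N; last by clear; nia.
  apply: leq_add; rewrite -E2; apply: leq_sum => k _; have hk := ltn_ord k.
    by rewrite hk; exact: E.
  have hkk : (K + k < K)%N = false by rewrite ltnNge leq_addr.
  by rewrite hkk addKn eq_sym; exact: E.
- move=> h hh _; case: (half_cases hh) => [h1|[k hk ->]].
    rewrite /flow_heap /= h1; case: (arc_cases h1) => [[a [S ->]]|[a [_ ->]]|[j a [_ ->]]] /=.
    + by move=> _; rewrite hsat // /terminal a S.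
    + by rewrite leqNgt hdv.
    + by rewrite leqNgt hdv.
  have [-> _ -> _] := build_heap_second K (fun k => (arc_nth Nw k).1.1) (fun k => (arc_nth Nw k).1.2) (nth 0%N fl) k.
  case: (arc_cases hk) => [[a [_ ->]]|[a [S ->]]|[j a [_ ->]]] /=.
  + by rewrite leqNgt hdv.
  + by move=> _; rewrite hsat // /terminal leq_addr ltn_add2l a addKn S orbT.
  + by rewrite leqNgt hdw.
- move=> h /orP[/andP[h1 S]|/and3P[h1 h2 S]].
    have hK : (h < K)%N by rewrite ltn_addr.
    rewrite /flow_heap /= hK; split; [by rewrite ltn_addr|exact: hsat|].
    by case: (arc_cases hK) => [[a [_ ->]]|[a [S' _]]|[j a [e _]]] //=; [rewrite S in S'|rewrite e ltnNge leq_addr in h1].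
  have [k hk e] : exists2 k, (k < N)%N & h = (K + k)%N by exists (h - K)%N; rewrite ?subnKC // ltn_subLR.
  have kK : (k < K)%N by rewrite ltn_addr.
  rewrite e addKn in S *; have [-> _ -> _] := build_heap_second K (fun k => (arc_nth Nw k).1.1) (fun k => (arc_nth Nw k).1.2) (nth 0%N fl) k.
  rewrite hsat //; split=> //=; first by rewrite ltn_add2l.
  by case: (arc_cases kK) => [[a [S' _]]|[a [_ ->]]|[j a [e' _]]] //=; [rewrite S' in S|rewrite e' ltnNge leq_addr in hk].
Qed.

(** * Reading the matching off the terminals *)

Section Extract.
Variable H : heap.
Hypothesis hI : hinvP H.
Hypothesis hdead : forall v, (v < n)%N -> dead H v.

Definition partner (i : nat) : nat := if SD i then (mt H i - K)%N else mt H (K + i).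

(** The mate carries the same unit, and no vertex holds a live half any more, so it must sit at the
    source or at the sink. *)
Lemma mate_terminal h : terminal h -> [/\ terminal (mt H h), mt H (mt H h) = h,
  si H (mt H h) = ~~ si H h & (mt H h < fr H)%N].
Proof.
move=> /(h_termP hI)[h1 h2 h3]; have a0 : 0 < am H h by rewrite h2.
have [m1 m2 m3 m4] := h_mate hI h1 a0.
have a1 : 0 < am H (mt H h) by rewrite m3 h2.
have a2 : n <= vt H (mt H h).
  by rewrite leqNgt; apply/negP => hv; have := hdead hv m1 erefl; rewrite m3 h2.
by have [_ tm] := h_term hI m1 a1 a2.
Qed.

Lemma terminal_source i : (i < N)%N -> SD i ->
  exists j, [/\ (j < N)%N, ~~ SD j, mt H i = (K + j)%N & mt H (K + j) = i].
Proof.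
move=> hi Si; have ti : terminal i by rewrite /terminal hi Si.
have [t1 t2 t3 _] := mate_terminal ti.
have iK : (i < K)%N by rewrite ltn_addr.
have e := h_side hI (ltn_addr K iK); rewrite e iK in t3.
case/orP: t1 => [/andP[h1 _]|/and3P[h1 h2 S]].
  have h1' : mt H i < K by rewrite ltn_addr.
  by move: t3; rewrite (h_side hI (ltn_addr K h1')) h1'.
exists (mt H i - K)%N; rewrite subnKC //; split=> //.
by rewrite ltn_subLR.
Qed.

Lemma terminal_sink i : (i < N)%N -> ~~ SD i ->
  exists j, [/\ (j < N)%N, SD j, mt H (K + i) = j & mt H j = (K + i)%N].
Proof.
move=> hi Si; have ti : terminal (K + i) by rewrite /terminal leq_addr ltn_add2l hi addKn Si orbT.
have [t1 t2 t3 _] := mate_terminal ti.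
have iK : (K + i < K + K)%N by rewrite ltn_add2l ltn_addr.
rewrite (h_side hI iK) ltnNge leq_addr /= in t3.
case/orP: t1 => [/andP[h1 S]|/and3P[h1 h2 S]]; first by exists (mt H (K + i)).
have h3 : (mt H (K + i) < K + K)%N by apply: leq_trans h2 _; rewrite leq_add2l leq_addr.
by move: t3; rewrite (h_side hI h3) ltnNge h1.
Qed.

Lemma partner_spec i : (i < N)%N ->
  [/\ (partner i < N)%N, partner (partner i) = i & SD (partner i) = ~~ SD i].
Proof.
move=> hi; rewrite {2 3}/partner; case: (boolP (SD i)) => Si.
  have [j [h1 h2 h3 h4]] := terminal_source hi Si.
  by rewrite /partner Si h3 addKn (negPf h2) h4.
have [j [h1 h2 h3 h4]] := terminal_sink hi Si.
by rewrite /partner (negPf Si) h3 h2 h4 addKn.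
Qed.

(** The sum is [crossing] restricted to the terminal halves; [h_cut] has carried the congestion
    bound of the flow through all splices. *)
Lemma partner_crossing U :
  (\sum_(i < N) (U (p_dv P i) != U (p_dv P (partner i))) <= 4 * p_c P * dart_boundary U)%N.
Proof.
apply: leq_trans (h_cut hI U); rewrite /crossing.
set F := fun h => (am H h * (U (loc n home H h) != U (loc n home H (mt H h))))%N.
rewrite -[leqRHS]/(\sum_(h < fr H) F h)%N.
have add (G : nat -> nat) (a c : nat) :
    \sum_(h < a + c) G h = \sum_(h < a) G h + \sum_(h < c) G (a + h) by exact: big_split_ord.
rewrite (sum_ord_split F (h_fresh hI)) (add F K K) (add F N N) (add (fun h => F (K + h)) N N).
apply: (@leq_trans (\sum_(i < N) F i + \sum_(i < N) F (K + i))%N); last first.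
  by rewrite -!addnA leq_add2l addnCA leq_addr.
have loct h : terminal h -> loc n home H h = home h.
  by move=> /(h_termP hI)[_ _ h3]; rewrite /loc ltnNge h3.
have homeK i : (i < N)%N -> home i = p_dv P i by move=> hi; rewrite /home ltn_addr.
have homeKK i : home (K + i) = p_dv P i by rewrite /home ltnNge leq_addr addKn.
rewrite -big_split /=; apply: leq_sum => i _; have hi := ltn_ord i.
rewrite /partner; case: (boolP (SD i)) => Si.
  have [j [h1 h2 h3 h4]] := terminal_source hi Si.
  have ti : terminal i by rewrite /terminal hi Si.
  have [tm _ _ _] := mate_terminal ti.
  apply: leq_trans (leq_addr _ _); rewrite /F; have [_ -> _] := h_termP hI ti.
  by rewrite mul1n !loct // h3 homeK // homeKK addKn.
have [j [h1 h2 h3 h4]] := terminal_sink hi Si.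
have ti : terminal (K + i) by rewrite /terminal leq_addr ltn_add2l hi addKn Si orbT.
have [tm _ _ _] := mate_terminal ti.
apply: leq_trans (leq_addl _ _); rewrite /F; have [_ -> _] := h_termP hI ti.
by rewrite mul1n !loct // h3 homeKK homeK.
Qed.
End Extract.
End InitialHeap.

(** * One round of the game *)

Definition store_cmd : cmd :=
  let K := Add (V aNN) (V aNN) in
  fill aI (V aNN) aPI (Mul (V at_) (V aNN))
    (Add (Mul (Get aSD (V aI)) (Sub (Get aMT (V aI)) K))
         (Mul (Sub (C 1) (Get aSD (V aI))) (Get aMT (Add K (V aI))))).

(** Finding a cut sets the round counter to [T + 1]: this ends the loop, and the final comparison
    with [T] tells it from a game played to the end. *)
Definition round_cmd : cmd :=
  flip_cmd ;; apply_cmd ;; median_cmd ;; network_cmd ;; flow_cmd ;; check_cmd ;;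
  If (V aOK)
    (build_cmd ;; decompose_cmd ;; store_cmd ;; Assign at_ (C 0) (Add (V at_) (C 1)))
    ((residual_cmd ;; reach_cmd ;; output_cmd) ;; Assign at_ (C 0) (Add (V aT) (C 1))).

Section Build.
Variables (R : realType) (phi : R) (O : network -> seq nat) (b : nat).
Hypothesis b3 : (3 <= b)%N.
Local Notation ptriple := (ptriple phi O b).

Definition lists_upto (H : heap) (n j : nat) (m : memory) : Prop :=
  forall w, (w < n.+2)%N -> m aDG w%:Z = (\sum_(h < j) (vt H h == w))%N%:Z /\
    exists L, [/\ chain (m aNX) (m aHE w%:Z) L, uniq L &
      forall h, (h \in L) = (h < j)%N && (vt H h == w)].

Lemma lists_spec m (H : heap) (n N : nat) : m aNN 0 = N%:Z -> fr H = (N + N + (N + N))%N ->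
  (fr H + 10 < 2 ^ b)%N -> (forall h, (h < fr H)%N -> (vt H h < n.+2)%N) ->
  (forall h, (h < fr H)%N -> m aVT h%:Z = (vt H h)%:Z) -> lists_upto H n 0 m ->
  ptriple lists_cmd m (24 * N + 2) (lists_upto H n (fr H)).
Proof.
move=> hN efr hb hp hvt h0.
apply: (@ptriple_for _ phi O b b3 aI _ _ (fun j m' => lists_upto H n j m') _ _ (fr H) 3) => //.
- by rewrite /= hN efr.
- by apply: leq_ltn_trans hb; exact: leq_addr.
- by rewrite efr; clear; lia.
move=> j m1 hj hm1 hl mj ha.
have vj : m1 aVT j%:Z = (vt H j)%:Z by rewrite ha //; exact: hvt.
have pj := hp j hj; have [dj [Lj [cj uj hLj]]] := hl _ pj.
have jb : (j < 2 ^ b)%N by apply: leq_trans hj (ltnW (leq_ltn_trans (leq_addr _ _) hb)).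
have cnt : (\sum_(h < j) (vt H h == vt H j) <= j)%N.
  by rewrite -[leqRHS]card_ord -sum1_card; apply: leq_sum => h _; case: (_ == _).
apply: ptriple_copy => //; rewrite /= mj vj.
apply: ptriple_step => //=; first by rewrite /write /= mj absz_nat.
rewrite /write /= mj vj; apply: ptriple_assign => //=; rewrite /write /= mj vj ?dj.
  by move: hb hj cnt; clear; move: (\sum_(_ < _) _)%N => x; lia.
move=> w hw; have [dw [L [cw uw hL]]] := hl w hw; rewrite /= !eqz_nat big_ord_recr /=; split.
  by rewrite (eq_sym w); case: (eqVneq (vt H j) w) => [->|_] /=; rewrite ?addn0 ?dw ?PoszD // -dj.
have ext h : h \in L -> (if h%:Z == j%:Z then m1 aHE (vt H j)%:Z else m1 aNX h%:Z) = m1 aNX h%:Z.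
  by rewrite hL => /andP[h1 _]; rewrite eqz_nat (ltn_eqF h1).
case: (eqVneq w (vt H j)) => [ew|nw].
  exists (j :: L); split.
  - by split=> //; rewrite eqxx -ew; apply: chain_ext cw => h hh; rewrite ew ext.
  - by rewrite /= uw hL ltnn.
  - move=> h; rewrite inE hL ltnS [in RHS]leq_eqVlt; case: (eqVneq h j) => [->|_] //=.
    by rewrite ew eqxx.
exists L; split=> //; first by apply: chain_ext cw => h hh; rewrite ext.
move=> h; rewrite hL ltnS [in RHS]leq_eqVlt; case: (eqVneq h j) => [->|_] //=.
by rewrite ltnn eq_sym (negPf nw).
Qed.
End Build.

Section Round.
Variables (R : realType) (phi : R) (O : network -> seq nat) (b : nat) (P : params).
Hypothesis hP : params_ok b P.
Hypothesis hO : max_flow_solver O.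
Local Notation ptriple := (ptriple phi O b).
Local Notation triple := (triple phi O b).
Local Notation N := (p_N P).
Local Notation n := (p_n P).
Let b3 := b_ge3 hP.
Hypothesis hrev : forall U : pred nat,
  (\sum_(k < N) (U (p_dw P k) && ~~ U (p_dv P k)))%N = dart_boundary P U.

Let facts := small_facts hP.

(** The invariant of the passes starts with [D = 4 * N], the number of halves, and with all vertices
    alive; [pi_fr] is then an equality. *)
Lemma build_spec m SD Nw fl : static P m -> net_arrays P SD m -> dart_net P SD Nw ->
  (forall k, (k < N + N)%N -> m aF k%:Z = (nth 0%N fl k)%:Z) -> is_flow Nw fl ->
  (forall k, (k < N)%N -> nth 0%N fl k = 1%N) ->
  ptriple build_cmd m (100 * N + 20 * n + 60) (fun m' =>
    pass_inv n (N + N) (terminal P SD) (home P) (fun U => 4 * p_c P * dart_boundary P U)%N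
      (4 * N) xpredT (flow_heap P Nw fl) m').
Proof.
move=> hm hna hdn hF hfl hsat.
have [hn1 hn2 hc1 hN] := facts.
have harc := net_arrays_arc hP hna hdn.
set H := flow_heap P Nw fl.
have hI := hinv_flow_heap (ok_dv hP) (ok_dw hP) hdn hfl hsat hrev.
have hpl := h_place hI.
have frE : fr H = (N + N + (N + N))%N by [].
have eK m' : static P m' -> eval phi m' (Add (V aNN) (V aNN)) = (N + N)%N%:Z.
  by move=> h /=; rewrite (st_NN h).
have en m' : static P m' -> eval phi m' (V 0) = n%:Z by move=> h; exact: st_n.
have en2 m' : static P m' -> eval phi m' (Add (V 0) (C 2)) = n.+2%:Z.
  by move=> h /=; rewrite (st_n h) -PoszD addn2.
have hcell k : (k < N + N)%N -> [/\ ((arc_nth Nw k).1.1 < 2 ^ b)%N, ((arc_nth Nw k).1.2 < 2 ^ b)%N &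
     (nth 0%N fl k < 2 ^ b)%N].
  move=> hk; have h1 := hpl k; have h2 := hpl (N + N + k)%N.
  have [_ _ e1 _] := build_heap_first (fun k => (arc_nth Nw k).1.1) (fun k => (arc_nth Nw k).1.2) (nth 0%N fl) hk.
  have [_ _ e2 _] := build_heap_second (N + N) (fun k => (arc_nth Nw k).1.1) (fun k => (arc_nth Nw k).1.2) (nth 0%N fl) k.
  have h3 : ((arc_nth Nw k).1.1 < n.+2)%N by rewrite -e1; apply: h1; rewrite ltn_addr.
  have h4 : ((arc_nth Nw k).1.2 < n.+2)%N by rewrite -e2; apply: h2; rewrite ltn_add2l.
  have nb : (n.+2 <= 2 ^ b)%N by move: hn1; clear; lia.
  split; [exact: leq_trans nb|exact: leq_trans nb|].
  case: hfl => _ hc _; have := hc k; rewrite (dn_size hdn) => /(_ hk) hle.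
  apply: leq_ltn_trans hle _; case: (arc_cases hdn hk) => [[_ [_ ->]]|[_ [_ ->]]|[j _ [_ ->]]] //=.
    by move: hn1; clear; lia.
  by move: hn1; clear; lia.
have Kb : (N + N < 2 ^ b)%N by move: hn2; clear; lia.
have KKb : (N + N + (N + N) < 2 ^ b)%N by move: hn2; clear; lia.
have n2b : (n.+2 < 2 ^ b)%N by move: hn1; clear; lia.
have nb : (n < 2 ^ b)%N by move: hn1; clear; lia.
rewrite /build_cmd.
apply: (ptriple_seqf (t1 := 4 * (N + N) + 2) (t2 := 92 * N + 20 * n + 58)
   (Q1 := filled aMT 0 (N + N) (fun k => (N + N + k)%N%:Z) m)); [|clear; lia|].
  apply: (ptriple_filled O b3) => //; try solve [exact: eK].
  - by move=> k m1 hk mk ha /=; rewrite mk; peel; rewrite (st_NN hm).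
  - by move=> k hk; rewrite absz_nat; apply: leq_trans KKb; rewrite ltnS leq_add2l ltnW.
  - by clear; lia.
move=> m1 _ ha1 f1; have hs1 : static P m1 by exact: (static_agree ha1).
apply: (ptriple_seqf (t1 := 4 * (N + N) + 2) (t2 := 84 * N + 20 * n + 56)
   (Q1 := filled aMT (N + N) (N + N) (fun k => k%:Z) m1)); [|clear; lia|].
  apply: (ptriple_filled O b3) => //; try solve [exact: eK].
  - by move=> k hk; rewrite absz_nat; exact: ltn_trans Kb.
  - by clear; lia.
move=> m2 _ ha2 f2; have hs2 : static P m2 by exact: (static_agree ha2).
apply: (ptriple_seqf (t1 := 4 * (N + N) + 2) (t2 := 76 * N + 20 * n + 54)
   (Q1 := filled aVT 0 (N + N) (fun k => (arc_nth Nw k).1.1%:Z) m2)); [|clear; lia|].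
  apply: (ptriple_filled O b3) => //; try solve [exact: eK].
  - by move=> k m3 hk mk ha /=; rewrite mk; peel; case: (harc k hk).
  - by move=> k hk; case: (hcell k hk).
  - by clear; lia.
move=> m3 _ ha3 f3; have hs3 : static P m3 by exact: (static_agree ha3).
apply: (ptriple_seqf (t1 := 4 * (N + N) + 2) (t2 := 68 * N + 20 * n + 52)
   (Q1 := filled aVT (N + N) (N + N) (fun k => (arc_nth Nw k).1.2%:Z) m3)); [|clear; lia|].
  apply: (ptriple_filled O b3) => //; try solve [exact: eK].
  - by move=> k m4 hk mk ha /=; rewrite mk; peel; case: (harc k hk).
  - by move=> k hk; case: (hcell k hk).
  - by clear; lia.
move=> m4 _ ha4 f4; have hs4 : static P m4 by exact: (static_agree ha4).
apply: (ptriple_seqf (t1 := 4 * (N + N) + 2) (t2 := 60 * N + 20 * n + 50)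
   (Q1 := filled aAM 0 (N + N) (fun k => (nth 0%N fl k)%:Z) m4)); [|clear; lia|].
  apply: (ptriple_filled O b3) => //; try solve [exact: eK].
  - by move=> k m5 hk mk ha /=; rewrite mk; peel; rewrite hF.
  - by move=> k hk; case: (hcell k hk).
  - by clear; lia.
move=> m5 _ ha5 f5; have hs5 : static P m5 by exact: (static_agree ha5).
apply: (ptriple_seqf (t1 := 4 * (N + N) + 2) (t2 := 52 * N + 20 * n + 48)
   (Q1 := filled aAM (N + N) (N + N) (fun k => (nth 0%N fl k)%:Z) m5)); [|clear; lia|].
  apply: (ptriple_filled O b3) => //; try solve [exact: eK].
  - by move=> k m6 hk mk ha /=; rewrite mk; peel; rewrite hF.
  - by move=> k hk; case: (hcell k hk).
  - by clear; lia.
move=> m6 _ ha6 f6; have hs6 : static P m6 by exact: (static_agree ha6).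
have b1 : (1 < 2 ^ b)%N by move: hn1; clear; lia.
have b0 : (0 < 2 ^ b)%N by move: hn1; clear; lia.
apply: (ptriple_seqf (t1 := 4 * (N + N) + 2) (t2 := 44 * N + 20 * n + 46)
   (Q1 := filled aSI 0 (N + N) (fun k => 1) m6)); [|clear; lia|].
  by apply: (ptriple_filled O b3) => //; [exact: eK|clear; lia].
move=> m7 _ ha7 f7; have hs7 : static P m7 by exact: (static_agree ha7).
apply: (ptriple_seqf (t1 := 4 * (N + N) + 2) (t2 := 36 * N + 20 * n + 44)
   (Q1 := filled aSI (N + N) (N + N) (fun k => 0) m7)); [|clear; lia|].
  by apply: (ptriple_filled O b3) => //; [exact: eK|exact: eK|clear; lia].
move=> m8 _ ha8 f8; have hs8 : static P m8 by exact: (static_agree ha8).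
apply: (ptriple_seqf (t1 := 4 * n.+2 + 2) (t2 := 36 * N + 16 * n + 34)
   (Q1 := filled aHE 0 n.+2 (fun k => -1) m8)); [|clear; lia|].
  by apply: (ptriple_filled O b3) => //; [exact: en2|clear; lia].
move=> m9 _ ha9 f9; have hs9 : static P m9 by exact: (static_agree ha9).
apply: (ptriple_seqf (t1 := 4 * n.+2 + 2) (t2 := 36 * N + 12 * n + 24)
   (Q1 := filled aDG 0 n.+2 (fun k => 0) m9)); [|clear; lia|].
  by apply: (ptriple_filled O b3) => //; [exact: en2|clear; lia].
move=> m10 _ ha10 f10; have hs10 : static P m10 by exact: (static_agree ha10).
apply: (ptriple_seqf (t1 := 4 * n + 2) (t2 := 36 * N + 8 * n + 22)
   (Q1 := filled aAL 0 n (fun k => 1) m10)); [|clear; lia|].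
  by apply: (ptriple_filled O b3) => //; [exact: en|clear; lia].
move=> m11 _ ha11 f11; have hs11 : static P m11 by exact: (static_agree ha11).
have vtE h : (h < fr H)%N -> m11 aVT h%:Z = (vt H h)%:Z.
  move=> hh; case: (half_cases hh) => [h1|[k hk ->]]; peel.
    rewrite (filled_out f4) ?h1 // (filled_val f3) ?subn0 //.
    by rewrite /H /flow_heap /= h1.
  have [_ _ e2 _] := build_heap_second (N + N) (fun k => (arc_nth Nw k).1.1) (fun k => (arc_nth Nw k).1.2) (nth 0%N fl) k.
  by rewrite (filled_val f4) ?leq_addr ?ltn_add2l // addKn e2.
apply: (ptriple_seqf (t1 := 24 * N + 2) (t2 := 1) (Q1 := lists_upto H n (fr H))); [|clear; lia|].
  apply: (@lists_spec _ phi O b b3 m11 H n N) => //.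
  - exact: st_NN.
  - by rewrite frE; move: hn2; clear; lia.
  - move=> w hw; split; first by peel; rewrite (filled_val f10) ?big_ord0.
    exists [::]; split=> //=; first by peel; rewrite (filled_val f9).
move=> m12 _ ha12 hl; have hs12 : static P m12 by exact: (static_agree ha12).
have eKK : eval phi m12 (Add (Add (V aNN) (V aNN)) (Add (V aNN) (V aNN))) = (fr H)%:Z.
  by rewrite frE /= (st_NN hs12).
apply: ptriple_assign => //; rewrite eKK; first by rewrite frE absz_nat.
have hrep : heap_rep n H (write m12 aFR (eval phi m12 (C 0)) (fr H)%:Z).
  split=> [h hh|h hh|h hh|h hh||w hw|w hw]; rewrite /write /=.
  - case: (half_cases hh) => [h1|[k hk ->]]; peel.
      by rewrite (filled_out f6) ?h1 // (filled_val f5) ?subn0.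
    by rewrite (filled_val f6) ?leq_addr ?ltn_add2l // addKn ltnNge leq_addr.
  - case: (half_cases hh) => [h1|[k hk ->]]; peel.
      by rewrite (filled_out f2) ?h1 // (filled_val f1) ?subn0.
    by rewrite (filled_val f2) ?leq_addr ?ltn_add2l // addKn ltnNge leq_addr.
  - by rewrite ha12 // vtE.
  - case: (half_cases hh) => [h1|[k hk ->]]; peel.
      by rewrite (filled_out f8) ?h1 // (filled_val f7).
    by rewrite (filled_val f8) ?leq_addr ?ltn_add2l // ltnNge leq_addr.
  - by [].
  - by case: (hl w hw).
  - by case: (hl w hw).
split=> //.
- by move=> v hv; rewrite /write /=; peel; rewrite (filled_val f11).
- rewrite /alive_degree (@leq_trans (fr H)) //; last by rewrite frE; clear; lia.
  by rewrite -[leqRHS]card_ord -sum1_card; apply: leq_sum => h _; case: (_ && _).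
- have -> : alive_count n xpredT = n by rewrite /alive_count sum1_card card_ord.
  by rewrite frE; clear; nia.
Qed.

Definition balanced (u : nat -> int) (pi : nat -> nat) : Prop :=
  exists eta : int, forall i, (i < N)%N -> (u i <= eta <= u (pi i)) || (u (pi i) <= eta <= u i).

Definition embedded (pi : nat -> nat) : Prop := forall U : pred nat,
  (\sum_(i < N) (U (p_dv P i) != U (p_dv P (pi i))) <= 4 * p_c P * dart_boundary P U)%N.

Lemma match_spec m SD Nw fl pis (u : nat -> int) eta : static P m -> matchings P m pis ->
  (size pis < p_T P)%N ->
  net_arrays P SD m -> dart_net P SD Nw ->
  (forall i, (i < N)%N -> m aSD i%:Z = (SD i : nat)%:Z) ->
  (forall i, (i < N)%N -> if SD i then u i <= eta else eta <= u i) ->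
  (forall k, (k < N + N)%N -> m aF k%:Z = (nth 0%N fl k)%:Z) -> is_flow Nw fl ->
  (forall k, (k < N)%N -> nth 0%N fl k = 1%N) ->
  ptriple (build_cmd ;; decompose_cmd ;; store_cmd ;; Assign at_ (C 0) (Add (V at_) (C 1))) m
    ((p_k P + 6) * (400 * n + 1200 * N + 100)) (fun m' =>
    static P m' /\ exists pi, [/\ matchings P m' (rcons pis pi), balanced u pi & embedded pi]).
Proof.
move=> hm hma hT hna hdn hSD hu hF hfl hsat.
have [hn1 hn2 hc1 hN] := facts.
have [_ /andP[n0 hn] m0 hNP _ _ _ hb1 hb2 hb3] := hP.
set c1 := (100 * N + 20 * n + 60)%N.
set c2 := ((p_k P + 3 + 2) * (200 * n + 1000 * N + 20))%N.
apply: (ptriple_seqf (t1 := c1) (t2 := c2 + (4 * N + 3)) _ _ _).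
- exact: build_spec hm hna hdn hF hfl hsat.
- by rewrite /c1 /c2; clear; nia.
move=> m1 _ ha1 hp1; have hs1 : static P m1 by exact: (static_agree ha1).
have N0 : (0 < N)%N by rewrite addn_gt0 m0.
apply: (ptriple_seqf (t1 := c2) (t2 := 4 * N + 3) _ _ _).
- apply: (@decompose_spec _ phi O b b3 n _ _ _ _ _ _ m1 _ _ N (p_k P + 3) hp1 (st_n hs1) (st_NN hs1) (erefl _) N0).
  + apply: leq_ltn_trans hb1.
    by move: n0 hn hNP N0; rewrite /p_NP; move: (2 ^ p_k P)%N => x; clear; nia.
  + by rewrite expnD; move: hNP; rewrite /p_NP; move: (2 ^ p_k P)%N => x; clear; lia.
  + apply: leq_ltn_trans hb1.
    by move: hNP; rewrite /p_NP; move: (2 ^ p_k P)%N => x; clear; nia.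
- by [].
move=> m2 _ ha2 [H [hr hI hd]]; have hs2 : static P m2 by exact: (static_agree ha2).
pose pi := partner P SD H.
have hpi := partner_spec hI hd.
have hfrH := h_fresh hI.
have eK : eval phi m2 (Add (V aNN) (V aNN)) = (N + N)%N%:Z by rewrite /= (st_NN hs2).
have t2 : m2 at_ 0 = (size pis)%:Z by peel; exact: ma_t hma.
have piE i : (i < N)%N -> (pi i)%:Z = (SD i : nat)%:Z * (m2 aMT i%:Z - (N + N)%N%:Z) +
    (1 - (SD i : nat)%:Z) * m2 aMT (N + N + i)%N%:Z.
  move=> hi; have h1 : (i < fr H)%N by apply: leq_trans hfrH; rewrite -addnA ltn_addr.
  have h2 : (N + N + i < fr H)%N by apply: leq_trans hfrH; rewrite ltn_add2l ltn_addr.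
  rewrite (hr_mt hr h1) (hr_mt hr h2) /pi /partner; case: (boolP (SD i)) => Si.
    have [j [h3 h4 h5 h6]] := terminal_source hI hd hi Si.
    by rewrite h5 addKn subrr mul0r addr0 mul1r PoszD addrAC subrr add0r.
  by rewrite mul0r add0r subr0 mul1r.
apply: (ptriple_seqf (t1 := 4 * N + 2) (t2 := 1)
   (Q1 := filled aPI (size pis * N) N (fun i => (pi i)%:Z) m2)); [|by rewrite -addnA|].
  apply: (ptriple_filled O b3) => //.
  - exact: st_NN.
  - by rewrite /= t2 (st_NN hs2).
  - move=> i m3 hi mi ha /=; rewrite mi.
    have -> : m3 aNN 0 = N%:Z by rewrite ha // (st_NN hs2).
    have -> : m3 aSD i%:Z = (SD i : nat)%:Z by rewrite ha //; peel; rewrite hSD.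
    by rewrite !ha // -!PoszD piE.
  - by move=> i hi; case: (hpi i hi) => h1 _ _; rewrite absz_nat; exact: ltn_trans hN.
  - by rewrite mulnC.
move=> m3 hm3 ha3 f3; have hs3 : static P m3 by exact: (static_agree ha3).
have t3 : m3 at_ 0 = (size pis)%:Z by rewrite ha3.
have nT : (size pis + 1 < 2 ^ b)%N by apply: leq_ltn_trans hb3; move: hT; clear; nia.
apply: ptriple_assign => //=; rewrite t3 -PoszD ?absz_nat //.
split; first exact: static_write.
exists pi; split.
- split; rewrite ?size_rcons /write /= ?addn1 //.
  + move=> k; rewrite size_rcons ltnS leq_eqVlt => /orP[/eqP->|hk]; last first.
      by rewrite nth_rcons hk; exact: (ma_inv hma).
    by rewrite nth_rcons ltnn eqxx => i hi; case: (hpi i hi).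
  + move=> s i; rewrite ltnS leq_eqVlt => /orP[/eqP->|hs] hi.
      by rewrite nth_rcons ltnn eqxx (filled_val f3) ?addKn // leq_addr ltn_add2l.
    rewrite nth_rcons hs (filled_out f3); first by peel; exact: ma_PI hma _ _ hs hi.
    apply/orP; left; apply: (@leq_trans (s.+1 * N)); last by rewrite leq_mul2r hs orbT.
    by rewrite mulSn addnC ltn_add2r.
- exists eta => i hi; have [h1 h2 h3] := hpi i hi.
  have := hu i hi; have := hu _ h1; rewrite -/(pi i) in h3 *; rewrite h3.
  by case: (SD i) => /= -> ->; rewrite ?orbT.
- exact: partner_crossing hI hd.
Qed.

Definition round_time : nat := 2000 * (n + N + 1) * (p_k P + p_T P + 8).

Lemma round_spec m pis r : static P m -> matchings P m pis -> (size pis < p_T P)%N -> size r = N ->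
  triple round_cmd m r round_time (fun m' ls =>
    ((size ls <= 2)%N /\ forall l, l \in ls -> (l <= 3 * b * (4 * N + 2 * n + 3))%N) /\
    ((static P m' /\ exists pi, [/\ matchings P m' (rcons pis pi), balanced (projection pis r) pi &
        embedded pi]) \/
     [/\ m' at_ 0 = (p_T P).+1%:Z, m' aT 0 = (p_T P)%:Z, m' aOUT 0 = 0 &
       exists X : pred nat, separated P X /\ forall v, (v < n)%N -> (m' aCUT v%:Z != 0) = X v])).
Proof.
move=> hm hma hT hr.
have [hn1 hn2 hc1 hN] := facts.
set t1 := (5 * N + 2)%N; set t2 := ((8 * N + 20) * (p_T P + 1))%N.
set t3 := ((4 * N + 20) * (p_k P + size pis + 5))%N.
set tm := ((p_k P + 6) * (400 * n + 1200 * N + 100))%N.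
set tc := (48 * N + 16 * n + 30)%N.
set t6 := ((5 * N + 3) + (tm + (tc + 1) + 1))%N.
have ht : (t1 + (t2 + (t3 + ((24 * N + 12) + (2 + t6)))) <= round_time)%N.
  rewrite /t1 /t2 /t3 /t6 /tm /tc /round_time; move: hT; clear; move: (size pis) (p_T P) (p_k P) => s T k.
  by nia.
apply: (triple_conseq _ ht (fun _ _ _ h => h)).
suff : triple round_cmd m (r ++ [::]) (t1 + (t2 + (t3 + ((24 * N + 12) + (2 + t6))))) (fun m' ls =>
    ((size ls <= 2)%N /\ forall l, l \in ls -> (l <= 3 * b * (4 * N + 2 * n + 3))%N) /\
    ((static P m' /\ exists pi, [/\ matchings P m' (rcons pis pi), balanced (projection pis r) pi &
        embedded pi]) \/
     [/\ m' at_ 0 = (p_T P).+1%:Z, m' aT 0 = (p_T P)%:Z, m' aOUT 0 = 0 &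
       exists X : pred nat, separated P X /\ forall v, (v < n)%N -> (m' aCUT v%:Z != 0) = X v])).
  by rewrite cats0.
apply: triple_seq; have hfs := flip_spec phi O hP hr hm.
apply: (triple_conseq hfs (leqnn _)) => m1 l1 _ [-> [ha1 hU1]] /=.
have hs1 : static P m1 by exact: (static_agree ha1).
have hma1 : matchings P m1 pis by exact: (matchings_agree ha1).
apply: triple_pseqf (apply_spec phi O hP hs1 hma1 hU1) (leqnn _) _ => m2 _ ha2 [hU2 hW2].
have hs2 : static P m2 by exact: (static_agree ha2).
have hma2 : matchings P m2 pis by exact: (matchings_agree ha2).
apply: triple_pseqf (median_spec phi O hP hs2 (ltnW hT) hU2 _ hW2) (leqnn _) _.
  by move=> i hi; apply: projection_bound (ma_inv hma) hi.
move=> m3 _ ha3 [SD [eta [hSD3 half heta]]].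
have hs3 : static P m3 by exact: (static_agree ha3).
have hma3 : matchings P m3 pis by exact: (matchings_agree ha3).
apply: triple_pseqf (network_spec phi O hP hs3 hSD3) (leqnn _) _ => m4 _ ha4 hna4.
have hs4 : static P m4 by exact: (static_agree ha4).
have hma4 : matchings P m4 pis by exact: (matchings_agree ha4).
have hSD4 i : (i < N)%N -> m4 aSD i%:Z = (SD i : nat)%:Z by move=> hi; rewrite ha4 // hSD3.
rewrite -[[::]]cats0; apply: triple_seq.
apply: triple_conseq (flow_spec phi hP hO hs4 hna4 half) (leqnn _) _.
move=> m5 l5 _ [Nw [hdn hfl ha5 hF5 [l -> hl]]].
have hs5 : static P m5 by exact: (static_agree ha5).
have hma5 : matchings P m5 pis by exact: (matchings_agree ha5).
have hSD5 i : (i < N)%N -> m5 aSD i%:Z = (SD i : nat)%:Z by move=> hi; rewrite ha5 // hSD4.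
have hna5 : net_arrays P SD m5.
  by case: hna4 => g1 g2 g3 g4 g5 g6; split=> k hk; rewrite ha5 //; [exact: g1|exact: g2|exact: g3|exact: g4|exact: g5|exact: g6].
have hl' : (l <= 3 * b * (4 * N + 2 * n + 3))%N.
  by apply: leq_trans hl _; rewrite leq_mul2l; apply/orP; right; clear; lia.
have hF5' k : (k < N)%N -> m5 aF k%:Z = (nth 0%N (O Nw) k)%:Z by move=> hk; apply: hF5; rewrite ltn_addr.
have cs := check_spec phi O hP (f := fun k => nth 0%N (O Nw) k) hs5 hSD5 hF5'.
apply: triple_pseqf cs (leqnn _) _ => m6 _ ha6 [hOK hsat].
have hs6 : static P m6 by exact: (static_agree ha6).
have hma6 : matchings P m6 pis by exact: (matchings_agree ha6).
have hSD6 i : (i < N)%N -> m6 aSD i%:Z = (SD i : nat)%:Z by move=> hi; rewrite ha6 // hSD5.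
have hna6 : net_arrays P SD m6.
  by case: hna5 => g1 g2 g3 g4 g5 g6; split=> k hk; rewrite ha6 //; [exact: g1|exact: g2|exact: g3|exact: g4|exact: g5|exact: g6].
have hF6 k : (k < N + N)%N -> m6 aF k%:Z = (nth 0%N (O Nw) k)%:Z by move=> hk; rewrite ha6 // hF5.
apply: (triple_if (b_ge3 hP)) => //=; first by rewrite addn1.
- move=> hok; have h1 := hsat.1 hok.
  have h2 : forall k, (k < N)%N -> nth 0%N (O Nw) k = 1%N.
    apply: (saturated (ok_dv hP) (ok_dw hP) half (dn_nodes hdn) (dn_source hdn) (dn_sink hdn)
       (dn_size hdn) (dn_unit hdn) (dn_dart hdn) hfl.1) => //.
  have ms := match_spec hs6 hma6 hT hna6 hdn hSD6 heta hF6 hfl.1 h2.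
  have htm : (tm <= (tm + (tc + 1) + 1).-1)%N by clear; lia.
  apply: (ptriple_triple (ptriple_conseq ms htm (fun _ _ h => h))) => m' _ [h3 h4].
  split; last by left.
  by split=> // l'; rewrite inE => /eqP ->.
move=> hok.
have hns : ~ (forall k, (k < N)%N -> SD k -> nth 0%N (O Nw) k = 1%N) by move=> /hsat; rewrite hok.
have hcut := triple_frame (cut_spec phi hP hO hs6 hna6 hdn hfl hF6 hns).
have htc : (tc + 1 <= (tm + (tc + 1) + 1).-1)%N by clear; lia.
apply: (triple_conseq _ htc (fun _ _ _ h => h)).
apply: (@triple_seq _ _ _ _ _ _ _ [::] [::]).
apply: (triple_conseq hcut (leqnn _)) => m7 l7 _ [ha7 [[l2 -> hl2] [X [hX1 hX2]]]].
have T7 : m7 aT 0 = (p_T P)%:Z by rewrite ha7 // (st_T hs6).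
have has : ptriple (Assign at_ (C 0) (Add (V aT) (C 1))) m7 1 (fun m' => m' = write m7 at_ 0 (p_T P).+1%:Z).
  apply: (@ptriple_assign _ phi O b b3) => //=; rewrite T7 -PoszD ?addn1 //.
  by have := ok_b3 hP; rewrite absz_nat; clear; nia.
apply: (ptriple_triple has) => m' _ ->; split.
  split=> // l'; rewrite !inE => /orP[]/eqP-> //.
right; split; rewrite /write /= ?T7 //; first by rewrite ha7 // (st_OUT hs6).
by exists X; split.
Qed.
End Round.

(** * Set-up *)

Notation aL := 5%N (only parsing).
Notation aPW := 6%N (only parsing).
Notation aMK := 16%N (only parsing).
Notation aIS := 17%N (only parsing).

Notation Get01 := (Get 0 (C 1)) (only parsing).

(** [aL] ends one above the integer part of [log2 n], so [aPW = 2 ^ aL] exceeds [n] and its square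
    [aNP] exceeds the number of darts. *)
Definition setup_cmd : cmd :=
  Assign aNN (C 0) (Add Get01 Get01) ;;
  fill aI Get01 aDV (C 0) (Get 1 (V aI)) ;;
  fill aI Get01 aDV Get01 (Get 2 (V aI)) ;;
  fill aI Get01 aDW (C 0) (Get 2 (V aI)) ;;
  fill aI Get01 aDW Get01 (Get 1 (V aI)) ;;
  Assign aL (C 0) (C 1) ;;
  Assign aPW (C 0) (C 2) ;;
  While (Le (V aPW) (V 0))
    (Assign aL (C 0) (Add (V aL) (C 1)) ;; Assign aPW (C 0) (Add (V aPW) (V aPW))) ;;
  Assign aNP (C 0) (Mul (V aPW) (V aPW)).

Definition scan_cmd : cmd :=
  for_loop aI (V 0)
    (If (Get aMK (V aI)) Skip (Assign aIS (C 0) (Add (V aI) (C 1)))).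

(** A vertex without darts is invisible to the game, yet alone it forms a cut of conductance 0, so
    it is looked for beforehand. [aIS] holds its number plus one, 0 meaning that there is none. *)
Definition isolated_cmd : cmd :=
  for_loop aI (V aNN) (Assign aMK (Get aDV (V aI)) (C 1)) ;;
  Assign aIS (C 0) (C 0) ;;
  scan_cmd.

(* [B] depends on the exponent [p]: repeating the addition keeps the constants of
   the program small. *)
Definition core_cmd (B : nat) : cmd :=
  Assign aCC (C 0) (C 1) ;;
  While (Mul (Le (Add (V aCC) (V aCC)) (V aNP))
             (Sub (C 1) (Bin OpLePhi (C 1) (Mul (V aCC) (Mul (V aL) (V aL))))))
    (Assign aCC (C 0) (Add (V aCC) (V aCC))) ;;
  Assign aT (C 0) (C 0) ;;
  iter B (fun c => Assign aT (C 0) (Add (V aT) (Mul (V aL) (V aL))) ;; c) Skip.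

Section Setup.
Variables (R : realType) (phi : R) (O : network -> seq nat) (b : nat).
Hypothesis b3 : (3 <= b)%N.
Local Notation ptriple := (ptriple phi O b).
Local Notation triple := (triple phi O b).
Variables (n : nat) (e : rel 'I_n) (l : nat).
Hypotheses (n_gt1 : (1 < n)%N) (l_lo : (2 ^ l <= n)%N) (l_hi : (n < 2 ^ l.+1)%N).
Local Notation M := (size (edges e)).
Local Notation N := (num_darts e).
Local Notation PW := (2 ^ l.+1)%N.
Hypothesis b_big : (100 * (PW * PW + N + 10) <= 2 ^ b)%N.

Record ready (m : memory) : Prop := {
  rd_n : m 0%N 0 = n%:Z;
  rd_m : m 0%N 1 = M%:Z;
  rd_OUT : m aOUT 0 = 0;
  rd_CUT : forall z, m aCUT z = 0;
  rd_NN : m aNN 0 = N%:Z;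
  rd_DV : forall i, (i < N)%N -> m aDV i%:Z = (dart_tail e i)%:Z;
  rd_DW : forall i, (i < N)%N -> m aDW i%:Z = (dart_head e i)%:Z;
  rd_L : m aL 0 = l.+1%:Z;
  rd_NP : m aNP 0 = (PW * PW)%N%:Z }.

Lemma dart_tail_edges i : (i < M)%N ->
  dart_tail e i = nth 0%N [seq nat_of_ord x.1 | x <- edges e] i /\
  dart_tail e (M + i) = nth 0%N [seq nat_of_ord x.2 | x <- edges e] i.
Proof.
move=> hi; rewrite /dart_tail /dart_seq map_cat !nth_cat size_map hi.
by rewrite ltnNge leq_addr /= addKn -map_comp.
Qed.

Lemma dart_head_edges i : (i < M)%N ->
  dart_head e i = nth 0%N [seq nat_of_ord x.2 | x <- edges e] i /\
  dart_head e (M + i) = nth 0%N [seq nat_of_ord x.1 | x <- edges e] i.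
Proof.
move=> hi; rewrite /dart_head /dart_seq map_cat !nth_cat size_map hi.
by rewrite ltnNge leq_addr /= addKn -map_comp.
Qed.

Lemma setup_spec : ptriple setup_cmd (input_mem e) (16 * N + 4 * l + 40) (fun m =>
  ready m /\ forall z, m aMK z = 0).
Proof.
set m0 := input_mem e.
have PWp : (n < PW * PW)%N by apply: leq_trans l_hi _; rewrite leq_pmulr // expn_gt0.
have nb : (n < 2 ^ b)%N by move: PWp b_big; clear; lia.
have Nb : (N < 2 ^ b)%N by move: b_big; clear; lia.
have Mb : (M < 2 ^ b)%N by move: Nb; rewrite /num_darts; clear; lia.
have lt1 k : (nth 0%N [seq nat_of_ord x.1 | x <- edges e] k < 2 ^ b)%N.
  case: (ltnP k M) => hk; last by rewrite nth_default ?size_map // expn_gt0.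
  have := @mem_nth _ 0%N [seq nat_of_ord x.1 | x <- edges e] k; rewrite size_map => /(_ hk)/mapP[x _ ->].
  exact: ltn_trans (ltn_ord _) nb.
have lt2 k : (nth 0%N [seq nat_of_ord x.2 | x <- edges e] k < 2 ^ b)%N.
  case: (ltnP k M) => hk; last by rewrite nth_default ?size_map // expn_gt0.
  have := @mem_nth _ 0%N [seq nat_of_ord x.2 | x <- edges e] k; rewrite size_map => /(_ hk)/mapP[x _ ->].
  exact: ltn_trans (ltn_ord _) nb.
have NE : N = (M + M)%N by [].
rewrite NE.
apply: (ptriple_aseq b3) => //=; first by clear; lia.
set m1 := write _ _ _ _.
apply: (ptriple_seqf (t1 := 4 * M + 2) (t2 := 28 * M + 4 * l + 37)
  (Q1 := filled aDV 0 M (fun i => (nth 0%N [seq nat_of_ord x.1 | x <- edges e] i)%:Z) m1)).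
- apply: (ptriple_filled O b3) => //.
  + by move=> k m hk mk ha /=; rewrite mk ha.
  + by move=> k hk; first [exact: lt1|exact: lt2].
  + by clear; lia.
- by clear; lia.
move=> m2 _ ha2 f2.
apply: (ptriple_seqf (t1 := 4 * M + 2) (t2 := 24 * M + 4 * l + 35)
  (Q1 := filled aDV M M (fun i => (nth 0%N [seq nat_of_ord x.2 | x <- edges e] i)%:Z) m2)).
- apply: (ptriple_filled O b3) => //.
  + by rewrite /= ha2.
  + by rewrite /= ha2.
  + by move=> k m hk mk ha /=; rewrite mk ha // ha2.
  + by move=> k hk; first [exact: lt1|exact: lt2].
  + by clear; lia.
- by clear; lia.
move=> m3 _ ha3 f3.
apply: (ptriple_seqf (t1 := 4 * M + 2) (t2 := 20 * M + 4 * l + 33)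
  (Q1 := filled aDW 0 M (fun i => (nth 0%N [seq nat_of_ord x.2 | x <- edges e] i)%:Z) m3)).
- apply: (ptriple_filled O b3) => //.
  + by rewrite /=; peel.
  + by move=> k m hk mk ha /=; rewrite mk; peel.
  + by move=> k hk; first [exact: lt1|exact: lt2].
  + by clear; lia.
- by clear; lia.
move=> m4 _ ha4 f4.
apply: (ptriple_seqf (t1 := 4 * M + 2) (t2 := 16 * M + 4 * l + 31)
  (Q1 := filled aDW M M (fun i => (nth 0%N [seq nat_of_ord x.1 | x <- edges e] i)%:Z) m4)).
- apply: (ptriple_filled O b3) => //.
  + by rewrite /=; peel.
  + by rewrite /=; peel.
  + by move=> k m hk mk ha /=; rewrite mk; peel.
  + by move=> k hk; first [exact: lt1|exact: lt2].
  + by clear; lia.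
- by clear; lia.
move=> m5 _ ha5 f5.
have b8 : (8 <= 2 ^ b)%N by rewrite (@leq_pexp2l 2 3).
apply: (ptriple_aseq b3) => //=; [by clear; lia|by apply: leq_trans b8|].
apply: (ptriple_aseq b3) => //=; [by clear; lia|by apply: leq_trans b8|].
set m6 := write _ _ _ _.
have n6 : m6 0%N 0 = n%:Z by rewrite /m6 /write /=; peel.
apply: (ptriple_seqf (t1 := 3 * l + 1) (t2 := 1) (Q1 := fun m => m aL 0 = l.+1%:Z /\ m aPW 0 = PW%:Z)).
- apply: (@ptriple_while _ phi O b b3 _ _ (fun B m => exists j, [/\ (j <= l)%N, m aL 0 = j.+1%:Z,
    m aPW 0 = (2 ^ j.+1)%N%:Z, m 0%N 0 = n%:Z & B = (3 * (l - j))%N]) _ _ (3 * l)) => //.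
  + by exists 0%N; split=> //; rewrite subn0.
  + by clear; lia.
  + move=> B m _ [j [hj hL hPW hn ->]] /=; rewrite hPW hn lez_nat.
    case: (leqP (2 ^ j.+1) n) => // h2 _.
    have jl : (j < l)%N.
      by rewrite -ltnS -(ltn_exp2l _ _ (isT : (1 < 2)%N)); apply: leq_ltn_trans h2 l_hi.
    exists 2%N, (3 * (l - j.+1))%N; split; first by move: jl; clear; lia.
    apply: (ptriple_aseq b3) => //=; rewrite hL.
      rewrite -PoszD absz_nat addn1; apply: leq_ltn_trans nb; apply: leq_trans l_lo.
      exact: leq_ltn_trans jl (ltn_expl _ _).
    apply: (ptriple_assign _ b3) => //=; rewrite /write /= hPW -PoszD addnn -mul2n -expnS.
      by rewrite absz_nat; move: h2 b_big PWp; rewrite !expnS; clear; lia.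
    by exists j.+1; split=> //; rewrite -PoszD addn1.
  + move=> B m _ [j [hj hL hPW hn _]] /=; rewrite hPW hn lez_nat.
    case: (leqP (2 ^ j.+1) n) => // h2 _.
    suff -> : l = j by [].
    apply/eqP; rewrite eqn_leq hj andbT -ltnS -(ltn_exp2l _ _ (isT : (1 < 2)%N)).
    exact: leq_ltn_trans l_lo h2.
- by clear; lia.
move=> m7 _ ha7 [hL hPW].
apply: (ptriple_assign _ b3) => //=; rewrite hPW -PoszM.
  by rewrite absz_nat; move: b_big; clear; lia.
have hDV i : (i < N)%N -> m5 aDV i%:Z = (dart_tail e i)%:Z.
  move=> hi; peel; case: (ltnP i M) => h.
    by rewrite (filled_out f3) ?h // (filled_val f2) ?subn0 //; case: (dart_tail_edges h) => ->.
  have h' : (i - M < M)%N by move: hi h; rewrite NE; clear; lia.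
  rewrite (filled_val f3) ?h -?NE //; case: (dart_tail_edges h') => _; rewrite subnKC // => -> //.
have hDW i : (i < N)%N -> m5 aDW i%:Z = (dart_head e i)%:Z.
  move=> hi; case: (ltnP i M) => h.
    by rewrite (filled_out f5) ?h // (filled_val f4) ?subn0 //; case: (dart_head_edges h) => ->.
  have h' : (i - M < M)%N by move: hi h; rewrite NE; clear; lia.
  rewrite (filled_val f5) ?h -?NE //; case: (dart_head_edges h') => _; rewrite subnKC // => -> //.
split; last by move=> z; rewrite /write /=; peel; rewrite /m6 /write /=; peel.
split; rewrite /write //=; try by [peel; rewrite /m6 /write /=; peel | move=> *; peel; rewrite /m6 /write /=; peel].
- by move=> i hi; peel; rewrite /m6 /write /= hDV.
- by move=> i hi; peel; rewrite /m6 /write /= hDW.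
Qed.

Lemma ready_agree A m m' : agree_off A m m' ->
  all (fun a => a \notin A) [:: 0; 3; 4; 5; 7; 9; 14; 15]%N -> ready m -> ready m'.
Proof.
move=> h /allP hA [h1 h2 h3 h4 h5 h6 h7 h8 h9].
by split; move=> *; rewrite h ?hA //; by [apply: h4|apply: h6|apply: h7].
Qed.

Lemma ready_write m a i z : a \notin [:: 0; 3; 4; 5; 7; 9; 14; 15]%N -> ready m -> ready (write m a i z).
Proof.
move=> ha; apply: ready_agree; first exact: agree_off_write.
by apply/allP => x hx; rewrite inE; apply: contraNneq ha => <-.
Qed.

Lemma isolated_spec m : ready m -> (forall z, m aMK z = 0) ->
  ptriple isolated_cmd m (4 * N + 5 * n + 6) (fun m' => ready m' /\
    ((m' aIS 0 = 0 /\ forall v, (v < n)%N -> exists2 i, (i < N)%N & dart_tail e i = v) \/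
     exists2 v, (v < n)%N & m' aIS 0 = v.+1%:Z /\ forall i, (i < N)%N -> dart_tail e i != v)).
Proof.
move=> hm hMK.
have PWp : (n < PW * PW)%N by apply: leq_trans l_hi _; rewrite leq_pmulr // expn_gt0.
have nb : (n + 10 < 2 ^ b)%N by move: PWp b_big; clear; lia.
have Nb : (N < 2 ^ b)%N by move: b_big; clear; lia.
pose mark j (m' : memory) := forall v : nat, (m' aMK v%:Z != 0) = has (fun i => dart_tail e i == v) (iota 0 j).
apply: (ptriple_seqf (t1 := N * 4 + 2) (t2 := 5 * n + 4) (Q1 := mark N)).
- apply: (@ptriple_for _ phi O b b3 aI _ _ mark _ _ N 1) => //.
  + exact: rd_NN.
  + by move=> v; rewrite /write /= hMK.
  + move=> k m1 hk _ h1 mk ha; apply: (ptriple_assign _ b3) => //=; first by move: nb; clear; lia.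
    move=> v; rewrite mk ha // (rd_DV hm) // -[k.+1]addn1 iotaD has_cat /= orbF -h1 /write /= eqz_nat eq_sym.
    by rewrite add0n eq_sym (eq_sym v); case: (dart_tail e k == v); rewrite ?orbT ?orbF.
- by clear; lia.
move=> m1 _ ha1 h1; have hs1 : ready m1 by exact: (ready_agree ha1).
apply: (ptriple_aseq b3) => //=; [by clear; lia|by move: nb; clear; lia|].
set m2 := write _ _ _ _.
have hs2 : ready m2 by exact: ready_write.
have h2 : ptriple scan_cmd m2 (5 * n + 3) (fun m3 =>
    (m3 aIS 0 = 0 /\ (forall v, (v < n)%N -> m3 aMK v%:Z != 0)) \/
    (exists2 v, (v < n)%N & m3 aIS 0 = v.+1%:Z /\ m3 aMK v%:Z = 0)).
  apply: (@ptriple_for _ phi O b b3 aI _ _ (fun k m3 =>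
    (m3 aIS 0 = 0 /\ (forall v, (v < k)%N -> m3 aMK v%:Z != 0)) \/
    (exists2 v, (v < k)%N & m3 aIS 0 = v.+1%:Z /\ m3 aMK v%:Z = 0)) _ _ n 2) => //.
  - exact: rd_n.
  - by move: nb; clear; lia.
  - by left; split.
  - by clear; lia.
  move=> k m3 hk _ h3 mk ha3; apply: (ptriple_if b3) => //=; rewrite mk => hc.
    apply: ptriple_skip; rewrite /write /=; case: h3 => [[h4 h5]|[v hv [h4 h5]]]; [left|right].
      by split=> // v; rewrite ltnS leq_eqVlt => /orP[/eqP->|/h5].
    by exists v; rewrite // ltnW.
  apply: (ptriple_assign _ b3) => //=; rewrite mk -PoszD.
    by rewrite absz_nat; move: nb hk; clear; lia.
  by right; exists k; rewrite // /write /= addn1.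
have n3 : (5 * n + 3 <= (5 * n + 4).-1)%N by clear; lia.
apply: (ptriple_conseq (ptriple_frame h2) n3) => m3 _ [ha3 h3]; split; first exact: (ready_agree ha3).
have e3 z : m3 aMK z = m1 aMK z by rewrite ha3.
case: h3 => [[h4 h5]|[v hv [h4 h5]]]; [left|right].
  split=> // v /h5; rewrite e3 h1 => /hasP[i]; rewrite mem_iota => /andP[_ hi] /eqP h; by exists i.
exists v => //; split=> // i hi; apply/negP => h; suff : m1 aMK v%:Z != 0 by rewrite -e3 h5.
by rewrite h1; apply/hasP; exists i; rewrite ?mem_iota.
Qed.

Definition cut_params (B c : nat) : params :=
  Params n M (l.+1 + l.+1) c (B * (l.+1 * l.+1)) (dart_tail e) (dart_head e).

(** Doubling from [c = 1], where the product with [l.+1 ^ 2 * phi] is below 1, stops as soon as that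
    product reaches 1, hence below 2, unless the next double would exceed [PW * PW]. *)
Lemma core_spec B m : ready m -> ~~ (1 <= (l.+1 * l.+1)%N%:R * phi) -> (B * (l.+1 * l.+1) < 2 ^ b)%N ->
  (forall i, m at_ i = 0) ->
  ptriple (core_cmd B) m (4 * l + B + 10) (fun m' => exists c,
    [/\ static (cut_params B c) m', matchings (cut_params B c) m' [::],
        (0 < c <= PW * PW)%N, (c * (l.+1 * l.+1))%N%:R * phi < 2 &
        (PW * PW < c + c)%N \/ 1 <= (c * (l.+1 * l.+1))%N%:R * phi]).
Proof.
move=> hm hphi hB ht.
have b8 : (8 <= 2 ^ b)%N by rewrite (@leq_pexp2l 2 3).
apply: (ptriple_aseq b3) => //=; [by clear; lia|by apply: leq_trans b8|].
set m1 := write _ _ _ _.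
have hs1 : ready m1 by exact: ready_write.
apply: (ptriple_seqf (t1 := 4 * l + 5) (t2 := B + 1) (Q1 := fun m' => exists c,
    [/\ m' aCC 0 = c%:Z, (0 < c <= PW * PW)%N, (c * (l.+1 * l.+1))%N%:R * phi < 2 &
        (PW * PW < c + c)%N \/ 1 <= (c * (l.+1 * l.+1))%N%:R * phi])).
- apply: (@ptriple_while _ phi O b b3 _ _ (fun Bt m' => exists j, [/\ (j <= l.+1 + l.+1)%N,
     [/\ m' aCC 0 = (2 ^ j)%N%:Z, m' aL 0 = l.+1%:Z & m' aNP 0 = (PW * PW)%N%:Z],
     (2 ^ j * (l.+1 * l.+1))%N%:R * phi < 2 & Bt = (2 * (l.+1 + l.+1 - j))%N]) _ _ (4 * l + 4)) => //.
  + exists 0%N; split=> //.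
    * by split=> //; [exact: rd_L|exact: rd_NP].
    * by move: hphi; rewrite -ltNge mul1n => /lt_trans; apply; rewrite ltr1n.
    * by clear; lia.
  + by clear; lia.
  + move=> Bt m' _ [j [hj [hC hL hNP] hp ->]]; rewrite /= hC hL hNP -PoszD lez_nat.
    case: (leqP _ (PW * PW)) => [hle|]; last by rewrite mul0r.
    rewrite mul1r -!PoszM -!pmulrn mulr1n; case: lerP => [|hn _]; first by rewrite subrr.
    have jl : (j < l.+1 + l.+1)%N.
      rewrite -(ltn_exp2l _ _ (isT : (1 < 2)%N)) expnD; apply: leq_trans hle.
      by rewrite -[X in (X < _)%N]addn0 ltn_add2l expn_gt0.
    exists 1%N, (2 * (l.+1 + l.+1 - j.+1))%N; split; first by move: jl; clear; lia.
    apply: (ptriple_assign _ b3) => //=; rewrite hC -PoszD.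
      by rewrite absz_nat; move: hle b_big; clear; lia.
    exists j.+1; split=> //; first by rewrite /write /= expnS mul2n addnn.
    by rewrite expnS -mulnA natrM -mulrA -[ltRHS]mulr1 ltr_pM2l.
  + move=> Bt m' _ [j [hj [hC hL hNP] hp _]]; rewrite /= hC hL hNP -PoszD lez_nat => h.
    exists (2 ^ j)%N; split=> //.
    * by rewrite expn_gt0 -expnD leq_exp2l.
    * move: h; case: (leqP _ (PW * PW)) => [hle|]; last by left.
      by rewrite mul1r -!PoszM -!pmulrn mulr1n; case: lerP => // hn _; right.
- by clear; lia.
move=> m2 _ ha2 [c [hC c1 c2 c3]].
have hs2 : ready m2 by exact: (ready_agree ha2).
apply: (ptriple_aseq b3) => //=; [by clear; lia|by apply: leq_trans b8|].
have acc k : forall m' j, (j + k <= B)%N -> agree_off [:: aT] m2 m' -> m' aT 0 = (j * (l.+1 * l.+1))%N%:Z ->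
  ptriple (iter k (fun c => Assign aT (C 0) (Add (V aT) (Mul (V aL) (V aL))) ;; c) Skip) m' k
    (fun m'' => agree_off [:: aT] m2 m'' /\ m'' aT 0 = ((j + k) * (l.+1 * l.+1))%N%:Z).
  elim: k => [|k IH] m' j hj ha hT /=; first by apply: ptriple_skip; rewrite addn0.
  have eL : m' aL 0 = l.+1%:Z by rewrite ha // (rd_L hs2).
  have eT : m' aT 0 + m' aL 0 * m' aL 0 = (j.+1 * (l.+1 * l.+1))%N%:Z by rewrite hT eL -PoszM -PoszD (mulSnr j).
  apply: (ptriple_aseq b3) => //=; rewrite eT.
    rewrite absz_nat; apply: leq_ltn_trans hB; rewrite leq_mul2r; apply/orP; right.
    by move: hj; clear; lia.
  rewrite addnS -addSn; apply: IH => //; first by rewrite addSn -addnS.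
  by move=> a h z; rewrite /write; move: (h); rewrite inE => /negPf ->; exact: ha.
have ha0 : agree_off [:: aT] m2 (write m2 aT 0 0) by exact: agree_off_write.
have acc0 := acc B _ 0%N (leqnn _) ha0 (erefl _).
apply: (ptriple_conseq acc0); first by rewrite addn1.
move=> m3 _ [ha3 hT3].
have hs3 : ready m3 by exact: (ready_agree ha3).
exists c; split=> //.
- split; try solve [exact: rd_n|exact: rd_m|exact: rd_OUT|exact: rd_CUT|exact: rd_NN].
  + by rewrite (rd_NP hs3) /p_NP /= expnD.
  + by rewrite ha3.
  + by rewrite hT3.
  + exact: rd_DV.
  + exact: rd_DW.
- by split=> //; rewrite ha3 // ha2 // /m1 /write /= ht.
Qed.
End Setup.

(** * The whole game *)

Lemma projection_lin (R : realType) N pis r i : involutions N pis -> (i < N)%N ->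
  (projection pis r i)%:~R = 2 ^+ size pis * lin N (walk R pis i) r :> R.
Proof.
elim/last_ind: pis i => [|pis pi IH] i.
  move=> _ hi; rewrite mul1r /lin (bigD1 (Ordinal hi)) //= big1 ?addr0 => [|j].
    by rewrite /walk /= eqxx mul1r /projection /= /coin_sign /sgn; case: (nth _ _ _).
  by rewrite eq_sym -val_eqE /= /walk /= => /negPf ->; rewrite mul0r.
move=> /involutions_rcons[h1 h2] hi; have [h3 _] := h2 i hi.
rewrite /projection foldl_rcons -/(projection pis r) walk_rcons size_rcons intrD !IH // exprSr -mulrDr -mulrA.
congr (_ * _); rewrite /lin -big_split mulr_sumr; apply: eq_bigr => j _ /=.
by rewrite /avg -mulrDl; field.
Qed.

Definition loop_cmd : cmd := While (Le (Add (V at_) (C 1)) (V aT)) round_cmd.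

Section Loop.
Variables (R : realType) (phi : R) (O : network -> seq nat) (b : nat) (P : params).
Hypothesis hP : params_ok b P.
Hypothesis hO : max_flow_solver O.
Local Notation ptriple := (ptriple phi O b).
Local Notation triple := (triple phi O b).
Local Notation N := (p_N P).
Local Notation n := (p_n P).
Let b3 := b_ge3 hP.
Hypothesis hrev : forall U : pred nat,
  (\sum_(k < N) (U (p_dw P k) && ~~ U (p_dv P k)))%N = dart_boundary P U.

Definition embeddable (pis : seq (nat -> nat)) : Prop :=
  forall k, (k < size pis)%N -> embedded P (nth id pis k).

Definition few_calls (k : nat) (ls : seq nat) : Prop :=
  (size ls <= 2 * k)%N /\ forall l, l \in ls -> (l <= 3 * b * (4 * N + 2 * n + 3))%N.

Definition finished (x : R) (m : memory) : Prop :=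
  (m at_ 0 = (p_T P).+1%:Z /\ m aT 0 = (p_T P)%:Z /\ m aOUT 0 = 0 /\
     exists X : pred nat, separated P X /\ forall v, (v < n)%N -> (m aCUT v%:Z != 0) = X v) \/
  (m at_ 0 = (p_T P)%:Z /\ m aT 0 = (p_T P)%:Z /\
     exists pis, [/\ size pis = p_T P, involutions N pis, embeddable pis & psi N (walk R pis) <= x]).

(** Only a prefix [w] is consumed: a game that ends early with a cut leaves the remaining coins
    untouched. *)
Definition outcome (m : memory) (k : nat) (r : seq bool) (x : R) : Prop :=
  exists w r', r = w ++ r' /\ triple loop_cmd m w (k * (round_time P).+1 + 1)
    (fun m' ls => few_calls k ls /\ finished x m').

Lemma loop_exit m x : finished x m -> triple loop_cmd m [::] 1 (fun m' ls => few_calls 0 ls /\ finished x m').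
Proof.
move=> hx; apply: (@triple_while_false _ phi O b b3) => //=.
by case: hx => [[-> [-> _]]|[-> [-> _]]]; rewrite -PoszD lez_nat addn1 ?ltnn // ltnNge leqW.
Qed.

Lemma few_calls_cat k k' l l' : few_calls k l -> few_calls k' l' -> few_calls (k + k') (l ++ l').
Proof.
move=> [h1 h2] [h3 h4]; split; first by rewrite size_cat mulnDr leq_add.
by move=> x; rewrite mem_cat => /orP[/h2|/h4].
Qed.

(* [F r] is the final potential when the coins show [r], and [0] once a cut has
   been found. *)
Lemma loop_spec (s : R) : (1 <= s) ->
  2 * expR (- (s / 8)) * (N%:R * N.+1%:R) <= (2 * N%:R)^-1 ->
  forall k m pis, bounded b m -> static P m -> matchings P m pis -> embeddable pis ->
    (size pis + k)%N = p_T P ->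
  exists F : seq bool -> R, (forall r, size r = (k * N)%N -> 0 <= F r /\ outcome m k r (F r)) /\
    Ex (k * N) F <= (1 - (4 * s)^-1) ^+ k * psi N (walk R pis).
Proof.
move=> s1 s_big; set gamma := 1 - _; have s0 : 0 < s by apply: lt_le_trans s1.
have g0 : 0 < gamma.
  by rewrite /gamma subr_gt0 invf_lt1 ?mulr_gt0 //; apply: (@lt_le_trans _ _ 4); [rewrite ltr1n|rewrite ler_peMr].
have N0 : (0 < N)%N by rewrite addn_gt0 (ok_m hP).
elim=> [|k IH] m pis hb hm hma hemb hk.
  exists (fun=> psi N (walk R pis)); split; last by rewrite expr0 mul1r.
  move=> r /size0nil ->; split; first exact: psi_ge0.
  exists [::], [::]; split=> //; apply: loop_exit; right.
  rewrite (ma_t hma) (st_T hm); rewrite addn0 in hk; split; [by rewrite hk|split=> //].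
  by exists pis; split=> //; exact: (ma_inv hma).
have hT : (size pis < p_T P)%N by rewrite -hk addnS ltnS leq_addr.
have hcond : eval phi m (Le (Add (V at_) (C 1)) (V aT)) != 0.
  by rewrite /= (ma_t hma) (st_T hm) -PoszD lez_nat addn1 hT.
(* Once the coins of a round are fixed, either the game goes on from a definite memory, to which the
   induction hypothesis applies, or it is over and the potential is declared 0. *)
have step r1 : size r1 = N -> exists F' : seq bool -> R,
    (forall r2, size r2 = (k * N)%N -> 0 <= F' r2 /\ outcome m k.+1 (r1 ++ r2) (F' r2)) /\
    (Ex (k * N) F' <= 0 \/ exists2 pi, median_matching N (fun i => lin N (walk R pis i) r1) pi &
       Ex (k * N) F' <= gamma ^+ k * psi N (avg pi (walk R pis))).
  move=> hr1; have [m1 [l1 [k1 [hb1 hk1 [hl1 hres] he1]]]] := round_spec phi hP hO hrev hm hma hT hr1 hb.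
  have hround : triple round_cmd m r1 (round_time P) (fun m' ls => m' = m1 /\ ls = l1).
    by move=> _; exists m1, l1, k1.
  have next w x k' : triple loop_cmd m1 w (k' * (round_time P).+1 + 1) (fun m' ls => few_calls k' ls /\ finished x m') ->
      triple loop_cmd m (r1 ++ w) (k'.+1 * (round_time P).+1 + 1) (fun m' ls => few_calls k'.+1 ls /\ finished x m').
    move=> h; apply: (triple_conseq (t := (round_time P + (k' * (round_time P).+1 + 1)).+1) _ _ (fun _ _ _ h => h)).
      apply: (@triple_while_true _ phi O b b3) => //; apply: (triple_conseq hround (leqnn _)) => m' ls _ [-> ->].
      apply: (triple_conseq h (leqnn _)) => m2 l2 _ [h3 h4]; split=> //.
      by rewrite -add1n; apply: few_calls_cat => //; exact: hl1.
    by clear; lia.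
  case: hres => [[hm1 [pi [hma1 hbal hem]]]|hcut].
    have [||F' [hF1 hF2]] := IH m1 (rcons pis pi) hb1 hm1 hma1.
    - move=> j; rewrite size_rcons ltnS leq_eqVlt => /orP[/eqP->|hj]; first by rewrite nth_rcons ltnn eqxx.
      by rewrite nth_rcons hj; exact: hemb.
    - by rewrite size_rcons addSnnS.
    exists F'; split.
      move=> r2 hr2; have [h1 [w [r' [e2 h2]]]] := hF1 r2 hr2; split=> //.
      by exists (r1 ++ w), r'; split; [rewrite {1}e2 catA|exact: next].
    right; exists pi; last by rewrite -walk_rcons.
    have [hi1 hi2] : involutions N pis /\ involution_on N pi := involutions_rcons (@ma_inv _ _ _ hma1).
    split=> //; case: hbal => eta heta; exists (eta%:~R / 2 ^+ size pis) => i hi.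
    have p2 : 0 < 2 ^+ size pis :> R by rewrite exprn_gt0.
    have E j : (j < N)%N -> lin N (walk R pis j) r1 = (projection pis r1 j)%:~R / 2 ^+ size pis.
      by move=> hj; rewrite (projection_lin _ _ hi1 hj) mulrC mulKf // lt0r_neq0.
    have [hpi _] := hi2 i hi.
    by rewrite !E // !ler_pM2r ?invr_gt0 // !ler_int; exact: heta.
  exists (fun=> 0); split; last by left; rewrite Ex_cst.
  move=> r2 _; split=> //; exists r1, r2; split=> //.
  have hfin : finished 0 m1 by left; case: hcut => h1 h2 h3 h4.
  suff h : triple loop_cmd m (r1 ++ [::]) (1 * (round_time P).+1 + 1) (fun m' ls => few_calls 1 ls /\ finished 0 m').
    rewrite cats0 in h; apply: (triple_conseq h) => [|m' ls _ [[h1 h2] h3]].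
      by rewrite leq_add2r leq_mul2r orbT.
    by split=> //; split=> //; apply: leq_trans h1 _; rewrite leq_mul2l.
  by apply: next; rewrite mul0n; exact: loop_exit.
(* [G r1] is the potential as a function of the later coins when the first round shows [r1]. *)
have /choice[G hG] : forall r1, exists F' : seq bool -> R, size r1 = N ->
    (forall r2, size r2 = (k * N)%N -> 0 <= F' r2 /\ outcome m k.+1 (r1 ++ r2) (F' r2)) /\
    (Ex (k * N) F' <= 0 \/ exists2 pi, median_matching N (fun i => lin N (walk R pis i) r1) pi &
       Ex (k * N) F' <= gamma ^+ k * psi N (avg pi (walk R pis))).
  move=> r1; case: (eqVneq (size r1) N) => [/step[F' h]|h]; first by exists F'.
  by exists (fun=> 0) => h'; rewrite h' eqxx in h.
exists (fun r => G (take N r) (drop N r)); split.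
  move=> r hr; rewrite mulSn in hr; have h1 : size (take N r) = N by rewrite size_takel // hr leq_addr.
  have := (hG _ h1).1 (drop N r); rewrite size_drop hr addKn => /(_ erefl).
  by rewrite cat_take_drop.
rewrite mulSn Ex_cat.
have gk : 0 < gamma ^+ k by rewrite exprn_gt0.
(* The conditional expectation given the first round, divided by [gamma ^+ k], is the round
   potential that [expected_drop] asks for. *)
have := @expected_drop R N (walk R pis) s (fun r1 => Ex (k * N) (G r1) / gamma ^+ k) (stochastic_walk _ (ma_inv hma)) N0 s0 s_big.
rewrite -/gamma => hd.
have {}hd : Ex N (fun r1 => Ex (k * N) (G r1) / gamma ^+ k) <= gamma * psi N (walk R pis).
  apply: hd => r1 /hG[_ [h|[pi h1 h2]]]; [left|right].
    by rewrite pmulr_lle0 ?invr_gt0.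
  by exists pi => //; rewrite ler_pdivrMr // mulrC.
rewrite exprSr -mulrA.
have -> : Ex N (fun r1 => Ex (k * N) (fun w => G (take N (r1 ++ w)) (drop N (r1 ++ w)))) =
    gamma ^+ k * Ex N (fun r1 => Ex (k * N) (G r1) / gamma ^+ k).
  rewrite -ExZ; apply: eq_Ex => r1 hr1; rewrite mulrC divfK ?lt0r_neq0 //.
  by apply: eq_Ex => w _; rewrite take_size_cat // drop_size_cat.
by rewrite ler_pM2l.
Qed.
End Loop.

(** * Conductance *)

Section Conductance.
Variables (R : realType) (n : nat) (e : rel 'I_n).
Hypotheses (n_gt1 : (1 < n)%N) (e_sym : symmetric e) (e_irr : irreflexive e).
Local Notation N := (num_darts e).
Implicit Types (U : pred nat) (S : {set 'I_n}).

Local Notation side U := [set v : 'I_n | U (nat_of_ord v)]%SET.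

Lemma num_darts_lt : (N <= n * n)%N.
Proof.
have <- : #|{: 'I_n * 'I_n}| = (n * n)%N by rewrite card_prod card_ord.
rewrite -size_dart_seq cardE; apply: uniq_leq_size => [|x _]; first exact: uniq_dart_seq.
by rewrite mem_enum.
Qed.

Lemma vol_side U : vol e (side U) = (\sum_(i < N) U (dart_tail e i))%N.
Proof. exact: vol_darts. Qed.

Lemma vol_side_total U : (vol e (side U) + vol e (~: side U)%SET = N)%N.
Proof.
rewrite vol_darts // vol_setC_darts // -big_split /= -[RHS]card_ord -sum1_card.
by apply: eq_bigr => i _; case: (U _).
Qed.

Lemma boundary_le U : (boundary e (side U) <= minn (vol e (side U)) (vol e (~: side U)%SET))%N.
Proof.
rewrite leq_min boundary_darts // {1}vol_darts // vol_setC_darts //; apply/andP; split.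
  by apply: leq_sum => i _; case: (U (dart_tail _ _)) => //=; case: (U _).
rewrite (dart_reverse e (fun a c => (U a && ~~ U c : nat))).
by apply: leq_sum => i _; case: (U (dart_tail _ _)); rewrite ?andbF //=; case: (U _).
Qed.

Lemma side_set S : exists U, S = side U.
Proof.
exists (fun v => [exists i : 'I_n, (nat_of_ord i == v) && (i \in S)]).
apply/setP => v; rewrite inE; apply/idP/existsP => [h|[i /andP[/eqP/val_inj-> //]]].
by exists v; rewrite eqxx.
Qed.

Lemma is_cut_vol U : (0 < vol e (side U))%N -> (0 < vol e (~: side U)%SET)%N -> is_cut (side U).
Proof.
move=> h1 h2; rewrite /is_cut; apply/andP; split; apply/eqP => E.
  by move: h1; rewrite E /vol big_set0.
by move: h2; rewrite E /vol big1 // => i; rewrite inE finset.in_setT.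
Qed.

Lemma cut_conductance_le1 U : cut_conductance e R (side U) <= 1.
Proof.
rewrite /cut_conductance; have := boundary_le U.
move: (minn _ _) => w; case: (posnP w) => [->|h0 h]; first by rewrite invr0 mulr0.
by rewrite ler_pdivrMr ?ltr0n // mul1r ler_nat.
Qed.

(** When [N < c + c], the smaller side has volume below [c], and [c] times the boundary can only be
    less than that if the boundary is empty. *)
Lemma cut_conductance_sparse U c : (0 < c)%N ->
  (c * boundary e (side U) < vol e (side U))%N -> (c * boundary e (side U) < vol e (~: side U)%SET)%N ->
  is_cut (side U) /\ (cut_conductance e R (side U) <= c%:R^-1 /\
    ((N < c + c)%N -> cut_conductance e R (side U) = 0)).
Proof.
move=> c0 h1 h2; split; first by apply: is_cut_vol; [exact: leq_ltn_trans h1|exact: leq_ltn_trans h2].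
rewrite /cut_conductance; set w := minn _ _.
have hw : (c * boundary e (side U) < w)%N by rewrite leq_min h1 h2.
split=> [|hc].
  rewrite ler_pdivrMr ?ltr0n ?(leq_ltn_trans _ hw) // mulrC ler_pdivlMr ?ltr0n //.
  by rewrite -natrM ler_nat mulnC ltnW.
suff -> : boundary e (side U) = 0%N by rewrite mul0r.
have := vol_side_total U; move: h1 h2 hc; move: (vol _ _) (vol _ _) (boundary _ _) (num_darts e).
by clear; case=> [|a] [|a'] [|d] M; nia.
Qed.

Lemma conductance_ge (x : R) : (forall U, is_cut (side U) -> x <= cut_conductance e R (side U)) ->
  x <= conductance e R.
Proof.
move=> h; apply: lb_le_inf; last by move=> y [S hS ->]; have [U E] := side_set S; rewrite E; apply: h; rewrite -E.
have n0 : (0 < n)%N by apply: ltnW.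
(* The infimum of an empty set would be a default value; a singleton is a cut since [1 < n]. *)
exists (cut_conductance e R [set Ordinal n0]%SET), [set Ordinal n0]%SET => //.
rewrite /is_cut; apply/andP; split; apply/eqP => /setP E.
  by have := E (Ordinal n0); rewrite !inE eqxx.
by have := E (Ordinal n_gt1); rewrite !inE -val_eqE.
Qed.

Lemma isolated_cut (U : pred nat) v0 : (v0 < n)%N -> (forall v, U v = (v == v0)) ->
  (forall i, (i < N)%N -> dart_tail e i != v0) -> is_cut (side U) /\ cut_conductance e R (side U) = 0.
Proof.
move=> hv hU hi; split.
  rewrite /is_cut; apply/andP; split; apply/eqP => /setP E.
    by have := E (Ordinal hv); rewrite !inE hU eqxx.
  (* The boolean [v0 == 0], read as the vertex 0 or 1, always differs from [v0]. *)
  have hv1 : ((v0 == 0) < n)%N by case: (v0 == 0)%N => //; exact: ltnW.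
  by have := E (Ordinal hv1); rewrite !inE hU /=; clear; case: v0 => [|[]].
rewrite /cut_conductance; have := boundary_le U; rewrite vol_side big1 ?min0n => [|i _].
  by rewrite leqn0 => /eqP ->; rewrite mul0r.
by rewrite hU (negPf (hi _ _)).
Qed.

(** The larger side has at least half of the darts, so [N] times the smaller volume is at most twice
    the product of the two volumes; together with [mixing_cut] and congestion [4 * c] this gives the
    factor 8. *)
Lemma expander_conductance (T c : nat) (pis : seq (nat -> nat)) (x : R) : (0 < N)%N ->
  (forall v, (v < n)%N -> exists2 i, (i < N)%N & dart_tail e i = v) ->
  size pis = T -> involutions N pis ->
  (forall k, (k < T)%N -> forall U, (\sum_(i < N) (U (dart_tail e i) != U (dart_tail e (nth id pis k i))) <=
      4 * c * \sum_(i < N) (U (dart_tail e i) && ~~ U (dart_head e i)))%N) ->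
  psi N (walk R pis) <= (4 * N%:R ^+ 2)^-1 ->
  0 <= x -> (8 * T * c)%N%:R * x <= 1 -> x <= conductance e R.
Proof.
move=> N0 hiso hT hinv hemb hpsi x0 hx; apply: conductance_ge => U hcut.
have pos (V : pred nat) : side V != finset.set0 -> (0 < vol e (side V))%N.
  case/set0Pn => v; rewrite inE => hv; have [i hi ei] := hiso v (ltn_ord v).
  by rewrite vol_side (bigD1 (Ordinal hi)) //= ei hv.
have [h1 h2] := andP hcut.
have a0 := pos U h1.
have a1 : (0 < vol e (~: side U)%SET)%N.
  have -> : (~: side U)%SET = side (fun v => ~~ U v) by apply/setP => v; rewrite !inE.
  apply: (pos (fun v => ~~ U v)); apply: contraNneq h2 => /setP E; apply/eqP; apply/setP => v; have := E v.
  by rewrite !inE => /negbFE.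
have hb : (forall k, (k < size pis)%N -> (\sum_(i < N) (U (dart_tail e i) != U (dart_tail e (nth id pis k i))) <=
      4 * c * boundary e (side U))%N).
  by move=> k hk; rewrite boundary_darts //; apply: hemb; rewrite -hT.
have := mixing_cut (A := fun i => U (dart_tail e i)) N0 hinv hb hpsi.
rewrite -vol_side -vol_setC_darts // hT -!natrM ler_nat.
have := vol_side_total U; rewrite /cut_conductance.
move: (vol e (side U)) (vol e (~: _)%SET) (boundary e _) a0 a1 N0 => a a' d a0 a1 N0 E h.
have {}h : (minn a a' <= 8 * T * c * d)%N.
  rewrite -(leq_pmul2l N0); apply: leq_trans (_ : (2 * (N * T * (4 * c * d)) <= _)%N); last by clear; lia.
  apply: leq_trans (leq_mul (leqnn 2) h).
  by rewrite -E; case: (leqP a a') => h'; move: h'; clear; nia.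
rewrite ler_pdivlMr ?ltr0n ?leq_min ?a0 //.
apply: (@le_trans _ _ (x * (8 * T * c * d)%N%:R)); first by rewrite ler_wpM2l // ler_nat.
by rewrite natrM mulrA -[leRHS]mul1r ler_wpM2r // mulrC.
Qed.
End Conductance.

(** * The program *)

(** Names the memory reached before the coins of the game are quantified: the potential function is
    chosen from that memory. *)
Lemma triple_det (R : realType) (phi : R) O b c m w t Q : triple phi O b c m w t Q -> bounded b m ->
  exists m' ls, [/\ bounded b m', agree_off (mods c) m m', Q m' ls &
    triple phi O b c m w t (fun m'' ls' => m'' = m' /\ ls' = ls)].
Proof.
move=> /triple_frame h hm; have [m' [ls [k [h1 h2 [h3 h4] h5]]]] := h hm.
by exists m', ls; split=> //; move=> _; exists m', ls, k.
Qed.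

(** Two cases need no game: an isolated vertex, and [1 <= aL ^ 2 * phi], where any cut is good
    enough because conductances are at most 1. *)
Definition branch_cmd (B : nat) : cmd :=
  If (V aIS) (Assign aCUT (Sub (V aIS) (C 1)) (C 1))
    (If (Bin OpLePhi (C 1) (Mul (V aL) (V aL))) (Assign aCUT (C 0) (C 1))
       (core_cmd B ;; loop_cmd ;; Assign aOUT (C 0) (Le (V at_) (V aT)))).

Definition main_cmd (B : nat) : cmd := setup_cmd ;; isolated_cmd ;; branch_cmd B.

Section Main.
Variables (R : realType) (phi : R) (O : network -> seq nat) (n : nat) (e : rel 'I_n) (l B : nat).
Hypotheses (n_gt1 : (1 < n)%N) (e_sym : symmetric e) (e_irr : irreflexive e).
Hypotheses (phi_gt0 : 0 < phi) (hO : max_flow_solver O) (B_gt0 : (0 < B)%N).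
Hypotheses (l_lo : (2 ^ l <= n)%N) (l_hi : (n < 2 ^ l.+1)%N).
Local Notation M := (size (edges e)).
Local Notation N := (num_darts e).
Local Notation L := l.+1.
Local Notation T := (B * (L * L))%N.
(** [T] bits serve the unnormalised projections, the rest serves numbers polynomial in [n]. *)
Local Notation b := (T + 8 * L + 20)%N.
Local Notation PW := (2 ^ L)%N.
Local Notation triple := (triple phi O b).
Local Notation ptriple := (ptriple phi O b).


Lemma word_ge3 : (3 <= b)%N.
Proof. by apply: leq_trans (leq_addl _ 20). Qed.

Lemma word_big : (1000 * (PW * PW) * (PW * PW) * 2 ^ T <= 2 ^ b)%N.
Proof.
have e1 : (2 ^ b = 2 ^ T * ((PW * PW) * (PW * PW)) * (2 ^ (4 * L + 20)))%N.
  by rewrite -!expnD; congr (2 ^ _)%N; clear; lia.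
have e2 : (1000 <= 2 ^ (4 * L + 20))%N.
  by apply: leq_trans (_ : 2 ^ 10 <= _)%N => //; rewrite leq_exp2l // addnC.
rewrite e1; move: (2 ^ T)%N (PW * PW)%N (2 ^ (4 * L + 20))%N e2 => t x y e2.
have -> : (t * (x * x) * y = y * x * x * t)%N by clear; lia.
by rewrite !leq_mul2r e2 !orbT.
Qed.

Lemma PW_gt : (n * n < PW * PW)%N.
Proof. by apply: ltn_mul. Qed.

Lemma word_setup : (100 * (PW * PW + N + 10) <= 2 ^ b)%N.
Proof.
apply: leq_trans word_big; have := num_darts_lt e; have := PW_gt.
have : (0 < 2 ^ T)%N by rewrite expn_gt0.
have : (4 <= PW * PW)%N by rewrite -expnD (@leq_exp2l 2 2) // addnS addSn.
move: (2 ^ T)%N (PW * PW)%N (num_darts e) (n * n)%N => t x N1 n2 h1 h2 h3 h4; have : (x <= x * x * t)%N by rewrite -mulnA leq_pmulr // muln_gt0 h2 (ltn_trans _ h1).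
  by rewrite -!mulnA; move: (x * (x * t))%N => y; move: h1 h3 h4; clear; lia.
Qed.

Lemma cut_params_ok c : (0 < M)%N -> (0 < c <= PW * PW)%N -> params_ok b (cut_params e l B c).
Proof.
move=> M0 /andP[c0 c1]; have hN := num_darts_lt e; have hP := PW_gt; have hw : (1000 * (PW * PW) * (PW * PW) * 2 ^ T <= 2 ^ b)%N := word_big.
have eNP : p_NP (cut_params e l B c) = (PW * PW)%N by rewrite /p_NP /= expnD.
have hT : (0 < 2 ^ T)%N by rewrite expn_gt0.
have hT2 : (T < 2 ^ T)%N by rewrite ltn_expl.
have hx : (16 <= PW * PW)%N.
  rewrite -expnD (@leq_exp2l 2 4) //.
  suff : (0 < l)%N by clear; lia.
  by case: (l) l_hi => //; rewrite expn1 ltnNge n_gt1.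
split; rewrite ?eNP //=.
- exact: word_ge3.
- by rewrite (ltnW n_gt1) /=; move: hP n_gt1; clear; nia.
- by rewrite /p_N /=; apply: leq_trans hN (ltnW hP).
- by rewrite c0 (leq_trans c1) // leq_pmull.
- by move=> i /dart_lt[].
- by move=> i /dart_lt[].
- apply: leq_trans hw; move: hx hT; clear; move: (PW * PW)%N (2 ^ T)%N => x t hx ht.
  have h : ((x + 10) * (x + 10) <= (2 * x) * (2 * x))%N by apply: leq_mul; move: hx; clear; lia.
  have h2 : (x * x <= x * x * t)%N by rewrite leq_pmulr.
  by rewrite -!mulnA; move: h h2; rewrite -!mulnA; move: hx; clear; nia.
- apply: leq_trans hw; move: hx hT; clear; move: (PW * PW)%N (2 ^ T)%N => x t hx ht.
  have h : (x * t <= x * x * t)%N by rewrite leq_mul2r leq_pmulr ?orbT // (leq_trans _ hx).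
  by move: h hx ht; rewrite -!mulnA; clear; nia.
- have hN2 : (M + M < PW * PW)%N by apply: leq_ltn_trans hP.
  apply: leq_trans hw; rewrite /p_N /=; move: hx hT2 hN2; clear.
  move: (PW * PW)%N T (2 ^ T)%N (M + M)%N => x T' t N1 h1 h2 h3.
  have h : ((T' + 2) * (N1 + 2) <= (3 * t) * (3 * x))%N by apply: leq_mul; move: h1 h2 h3; clear; lia.
  apply: leq_ltn_trans h _.
  have h : (x * t <= x * x * t)%N by rewrite leq_mul2r leq_pmulr ?orbT // (leq_trans _ h1).
  have h4 : (0 < x * t)%N by rewrite muln_gt0 (leq_trans _ h1) // (leq_trans _ h2).
  have -> : (3 * t * (3 * x) = 9 * (x * t))%N by clear; lia.
  have -> : (1000 * x * x * t = 1000 * (x * x * t))%N by rewrite !mulnA.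
  by move: h h4; move: (x * t)%N (x * x * t)%N => y z; clear; lia.
Qed.

Lemma dart_params_reverse c (U : pred nat) :
  (\sum_(k < p_N (cut_params e l B c)) (U (p_dw (cut_params e l B c) k) && ~~ U (p_dv (cut_params e l B c) k)))%N =
  dart_boundary (cut_params e l B c) U.
Proof. by rewrite /dart_boundary (dart_reverse e (fun v w => (U v && ~~ U w : nat))). Qed.

Lemma input_bounded : bounded b (input_mem e).
Proof.
have hn : (n < 2 ^ b)%N.
  apply: leq_trans word_setup; have := PW_gt; move: n_gt1; move: (PW * PW)%N => x; clear; nia.
have hM : (M < 2 ^ b)%N by apply: leq_trans word_setup; rewrite /num_darts; clear; lia.
have b0 : (0 < b)%N by rewrite addn_gt0 orbT.
have z0 : (bitsize 0 <= b)%N by rewrite bitsize_le // expn_gt0.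
have hnth (f : 'I_n * 'I_n -> 'I_n) i : (bitsize (nth 0%N [seq nat_of_ord (f x) | x <- edges e] i)%:Z <= b)%N.
  rewrite bitsize_le // absz_nat; case: (ltnP i M) => hi; last by rewrite nth_default ?size_map // expn_gt0.
  have := @mem_nth _ 0%N [seq nat_of_ord (f x) | x <- edges e] i; rewrite size_map => /(_ hi)/mapP[x _ ->].
  exact: ltn_trans (ltn_ord _) hn.
move=> [|[|[|a]]] [i|i] //=; try solve [exact: hnth].
by case: i => [|[|i]] //; rewrite bitsize_le.
Qed.

Definition answer_of (m : memory) : answer n := output n (State m [::] 0 [::]).

Definition round_cost : nat := 2000 * (n + N + 1) * (L + L + T + 8).

Definition main_cost : nat :=
  (16 * N + 4 * l + 40) + ((4 * N + 5 * n + 6) +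
    (2 + ((4 * l + B + 10) + ((T * round_cost.+1 + 1) + 1)))).

(** Cuts are right whatever the coins; the condition on [f] guards the expander answer alone. *)
Definition good_run (f : R) (m : memory) (ls : seq nat) : Prop :=
  [/\ (size ls <= 2 * T)%N, forall k, k \in ls -> (k <= 3 * b * (4 * N + 2 * n + 3))%N,
    correct_cut e ((L * L)%:R * phi) (answer_of m) &
    4 * N%:R ^+ 2 * f <= 1 -> correct_expander e (phi / (16 * B)%:R) (answer_of m)].

Lemma cut_run f m (U : pred nat) : m aOUT 0 = 0 -> (forall v, (v < n)%N -> (m aCUT v%:Z != 0) = U v) ->
  is_cut [set v : 'I_n | U v]%SET -> cut_conductance e R [set v : 'I_n | U v]%SET <= (L * L)%:R * phi ->
  good_run f m [::].
Proof.
move=> h1 h2 h3 h4; have E : answer_of m = Cut [set v : 'I_n | U v]%SET.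
  rewrite /answer_of /output /= h1 eqxx; congr Cut.
  by apply/setP => v; rewrite !inE h2.
by split; rewrite ?E.
Qed.

(** [F] is 0 on the branches settled without a game; otherwise it ignores all coins beyond the
    [T * N] that the game may use. *)
Lemma main_triple (Lc : nat) : (T * N <= Lc)%N ->
  2 * expR (- ((72 * L)%:R / 8)) * (N%:R * N.+1%:R) <= (2 * N%:R)^-1 :> R ->
  exists F : seq bool -> R,
    (forall w, size w = Lc -> 0 <= F w /\ exists w1 w2, w = w1 ++ w2 /\
       triple (main_cmd B) (input_mem e) w1 main_cost (good_run (F w))) /\
    Ex Lc F <= (1 - (288 * L)%:R^-1) ^+ T * N%:R.
Proof.
move=> hLc hs.
have b3 := word_ge3; have hb0 := input_bounded; have hW := word_setup.
have s1 : 1 <= (72 * L)%:R :> R by rewrite ler1n muln_gt0.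
have gE : 4 * (72 * L)%:R = (288 * L)%:R :> R by rewrite -natrM mulnA.
have g0 : 0 <= (1 - (288 * L)%:R^-1) ^+ T * N%:R :> R.
  by rewrite mulr_ge0 // exprn_ge0 // subr_ge0 invf_le1 ?ltr0n // ler1n.
set t1 := (16 * N + 4 * l + 40)%N; set t2 := (4 * N + 5 * n + 6)%N.
set t3 := (4 * l + B + 10)%N; set t4 := (T * round_cost.+1 + 1)%N.
have p1 := setup_spec phi O b3 l_lo l_hi hW.
have [m1 [ls1 [hb1 ha1 [els1 [hm1 hMK]] hd1]]] := triple_det p1 hb0.
have p2 := isolated_spec phi O b3 l_hi hW hm1 hMK.
have [m2 [ls2 [hb2 ha2 [els2 [hm2 hIS]] hd2]]] := triple_det p2 hb1.
have pre w t Q : triple (branch_cmd B) m2 w t Q -> triple (main_cmd B) (input_mem e) w (t1 + (t2 + t)) Q.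
  move=> h; rewrite -[w]cat0s; apply: triple_seq; apply: (triple_conseq hd1 (leqnn _)) => _ _ _ [-> ->].
  rewrite -[w]cat0s; apply: triple_seq; apply: (triple_conseq hd2 (leqnn _)) => _ _ _ [-> ->].
  by rewrite els1 els2.
have early : triple (branch_cmd B) m2 [::] (2 + (t3 + (t4 + 1))) (good_run 0) ->
    exists F : seq bool -> R,
    (forall w, size w = Lc -> 0 <= F w /\ exists w1 w2, w = w1 ++ w2 /\
       triple (main_cmd B) (input_mem e) w1 main_cost (good_run (F w))) /\
    Ex Lc F <= (1 - (288 * L)%:R^-1) ^+ T * N%:R.
  move=> /pre h; exists (fun=> 0); split; last by rewrite Ex_cst.
  by move=> w _; split=> //; exists [::], w.
have e0 : (1 < 2 ^ b)%N by rewrite -{1}(expn0 2) ltn_exp2l // (leq_trans _ b3).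
have hn := rd_n hm2; have hOUT := rd_OUT hm2; have hCUT := rd_CUT hm2; have hL := rd_L hm2.
case: hIS => [[hIS hiso]|[v hv [hIS hiso]]]; last first.
  apply: early; apply: (triple_if b3) => //= hc; last by rewrite hIS in hc.
  have [h1 h2] := isolated_cut R n_gt1 e_sym e_irr hv (U := fun u => u == v) (fun=> erefl) hiso.
  have hi : m2 aIS 0 - 1 = v%:Z by rewrite hIS -addn1 PoszD addrK.
  apply: (ptriple_triple (Q := fun m' => m' = write m2 aCUT v%:Z 1)).
    by apply: (ptriple_assign _ b3) => //=; rewrite hi.
  move=> m' _ ->; apply: (@cut_run _ _ (fun u => u == v)) => //.
  - by move=> u _; rewrite /write /= eqz_nat; case: (u == v); rewrite ?hCUT.
  - by rewrite h2 mulr_ge0 // ltW.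
have N0 : (0 < N)%N by have [i hi _] := hiso 0%N (ltnW n_gt1); apply: leq_ltn_trans hi.
have M0 : (0 < M)%N by move: N0; rewrite /num_darts; clear; lia.
have ephi : eval phi m2 (Bin OpLePhi (C 1) (Mul (V aL) (V aL))) = (nat_of_bool (1 <= (L * L)%:R * phi)%R)%:Z.
  by rewrite /= hL -PoszM -!pmulrn mulr1n.
case: (boolP (1 <= (L * L)%:R * phi)) => hphi.
  apply: early; apply: (triple_if b3) => //=; rewrite hIS // => _.
  apply: (triple_if b3) => //; rewrite ephi hphi // => _.
  apply: (ptriple_triple (Q := fun m' => m' = write m2 aCUT 0 1)).
    by apply: (ptriple_assign _ b3) => //=; rewrite add0n addnA addn1.
  move=> m' _ ->; apply: (@cut_run _ _ (fun u => u == 0%N)) => //.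
  - by move=> u _; rewrite /write /= eqz_nat; case: (u == _); rewrite ?hCUT.
  - rewrite /is_cut; apply/andP; split; apply/eqP => /setP E.
      by have := E (Ordinal (ltnW n_gt1)); rewrite !inE.
    by have := E (Ordinal n_gt1); rewrite !inE.
  - by apply: le_trans hphi; have := cut_conductance_le1 R e_sym e_irr (fun u => u == 0%N); apply.
have ht i : m2 at_ i = 0 by peel.
have hB : (B * (L * L) < 2 ^ b)%N.
  by apply: leq_ltn_trans (ltn_expl b (isT : (1 < 2)%N)); rewrite -addnA leq_addr.
have p3 := core_spec O b3 hW hm2 hphi hB ht.
have [m3 [ls3 [hb3 ha3 [els3 [c [hs3 hma3 c1 c2 c3]]] hd3]]] := triple_det p3 hb2.
have hP := cut_params_ok M0 c1.
have hrev := dart_params_reverse c.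
have [|F0 [hF1 hF2]] := loop_spec phi hP hO hrev s1 hs (k := T) (pis := [::]) hb3 hs3 hma3 _ (erefl _).
  by move=> k.
exists (fun w => F0 (take (T * N) w)); split; last first.
  rewrite -(subnKC hLc) Ex_cat.
  rewrite (eq_Ex (g := F0)) => [|r hr]; last first.
    rewrite -[RHS](Ex_cst (Lc - T * N)); apply: eq_Ex => w _; by rewrite take_size_cat.
  apply: le_trans hF2 _; rewrite gE ler_wpM2l ?psi_walk0 //.
  by rewrite exprn_ge0 // subr_ge0 invf_le1 ?ltr0n // ler1n.
move=> w hw; have hr : size (take (T * N) w) = (T * N)%N by rewrite size_takel // hw.
have [h0 [w1 [r' [er hl]]]] := hF1 _ hr; split=> //.
exists w1, (r' ++ drop (T * N) w); split; first by rewrite catA -er cat_take_drop.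
apply: pre; apply: (triple_if b3) => //=; rewrite hIS // => _.
apply: (triple_if b3) => //; rewrite ephi (negPf hphi) // => _ /=.
rewrite add0n -[w1]cat0s; apply: triple_seq; apply: (triple_conseq hd3 (leqnn _)) => _ _ _ [-> ->].
rewrite els3 -[w1]cats0; apply: triple_seq; apply: (triple_conseq hl (leqnn _)) => m4 l4 _ [[hl1 hl2] hfin].
have hle : eval phi m4 (Le (V at_) (V aT)) = (nat_of_bool (m4 at_ 0 <= m4 aT 0)%R)%:Z by [].
apply: (ptriple_triple (Q := fun m' => m' = write m4 aOUT 0 (nat_of_bool (m4 at_ 0 <= m4 aT 0)%R)%:Z)).
  apply: (ptriple_assign _ b3) => //; rewrite hle absz_nat.
  by case: (_ <= _) => //; exact: ltnW.
move=> m5 _ ->; rewrite cats0.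
suff [g1 g2] : correct_cut e ((L * L)%:R * phi) (answer_of (write m4 aOUT 0 (nat_of_bool (m4 at_ 0 <= m4 aT 0)%R)%:Z)) /\
    (4 * N%:R ^+ 2 * F0 (take (T * N) w) <= 1 -> correct_expander e (phi / (16 * B)%:R) (answer_of (write m4 aOUT 0 (nat_of_bool (m4 at_ 0 <= m4 aT 0)%R)%:Z))).
  by split.
case: hfin => [[h1 [h2 [h3 [X [[x1 x2] hX]]]]]|[h1 [h2 [pis [q1 q2 q3 q4]]]]].
- have E : answer_of (write m4 aOUT 0 (nat_of_bool (m4 at_ 0 <= m4 aT 0)%R)%:Z) = Cut [set v : 'I_n | X v]%SET.
    rewrite /answer_of /output /= /write /= h1 h2 lez_nat ltnn /=; congr Cut.
    by apply/setP => v; rewrite !inE hX.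
  rewrite E; split=> //.
  rewrite -/(num_darts e) -boundary_darts // -vol_darts // -vol_setC_darts // in x1 x2.
  have [c0 cP] := andP c1.
  have [hc [hb hz]] := cut_conductance_sparse R e_sym e_irr c0 x1 x2; split=> //.
  (* If the doubling was stopped by [PW * PW], then [c + c] exceeds the number of darts and the cut
     has no boundary edge at all. *)
  case: c3 => [c3|c3].
    have hN : (N < c + c)%N := leq_ltn_trans (num_darts_lt e) (ltn_trans PW_gt c3).
    by rewrite (hz hN) mulr_ge0 // ltW.
  apply: le_trans hb _; rewrite -[leLHS]mul1r ler_pdivrMr ?ltr0n //.
  by move: c3; rewrite natrM (mulrC c%:R) mulrAC.
have E : answer_of (write m4 aOUT 0 (nat_of_bool (m4 at_ 0 <= m4 aT 0)%R)%:Z) = Expander n.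
  by rewrite /answer_of /output /= /write /= h1 h2 lez_nat leqnn.
rewrite E; split=> //; rewrite mulrC -ler_pdivlMr ?mulr_gt0 ?exprn_gt0 ?ltr0n // div1r => hF.
have q5 k : (k < T)%N -> embedded (cut_params e l B c) (nth id pis k) by move=> hk; apply: q3; rewrite q1.
apply: (@expander_conductance R n e n_gt1 e_sym e_irr T c pis _ N0 hiso q1 q2 q5 (le_trans q4 hF)).
  by rewrite divr_ge0 // ltW.
rewrite mulrA ler_pdivrMr ?ltr0n ?muln_gt0 // mul1r.
(* The other half of the choice of [c]: [c * L ^ 2 * phi < 2] makes [8 * T * c * phi] at most
   [16 * B]. *)
have -> : (8 * T * c = (8 * B) * (c * (L * L)))%N by clear; lia.
have -> : (16 * B = (8 * B) * 2)%N by clear; lia.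
by rewrite (natrM _ (8 * B) (c * _)) (natrM _ (8 * B) 2) -mulrA ler_wpM2l ?ler0n // ltW.
Qed.
End Main.

(** * Asymptotics *)

Section Asymptotics.
Variables (R : realType) (n l B : nat).
Hypotheses (n_gt1 : (1 < n)%N) (l_lo : (2 ^ l <= n)%N) (l_hi : (n < 2 ^ l.+1)%N) (B_gt0 : (0 < B)%N).
Local Notation L := l.+1.
Local Notation T := (B * (L * L))%N.
Local Notation x := (ln n%:R : R).

Lemma ln2_bounds : 1 / 2 <= ln 2 :> R /\ ln 2 <= 1 :> R.
Proof.
split; last by have := @le_ln1Dx R 1; rewrite -[1 + 1]/(2%:R); apply; lra.
have h : ln (2^-1) <= - 2^-1 :> R.
  have := @le_ln1Dx R (- 2^-1); rewrite (_ : 1 + - 2^-1 = 2^-1); last by field.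
  by apply; lra.
by move: h; rewrite lnV ?posrE //; lra.
Qed.

(** From [ln 2 >= 1 / 2] comes [l <= 2 * ln n]; the additional 1 in [L] is absorbed because
    [1 <= 2 * ln n]. *)
Lemma log_bounds : 1 / 2 <= x /\ x <= L%:R <= 4 * x.
Proof.
have [h1 h2] := ln2_bounds; have n0 : 0 < n%:R :> R by rewrite ltr0n ltnW.
have x2 : 1 / 2 <= x by apply: le_trans h1 _; rewrite ler_ln ?posrE // ler_nat.
have up : x <= ln 2 *+ L by rewrite -lnXn // ler_ln ?posrE ?exprn_gt0 // -natrX ler_nat ltnW.
have lo : ln 2 *+ l <= x by rewrite -lnXn // ler_ln ?posrE ?exprn_gt0 // -natrX ler_nat.
split=> //; apply/andP; split; first by apply: le_trans up _; rewrite -[leLHS]mulr_natr ler_piMl.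
have : (1 / 2) *+ l <= x by apply: le_trans lo; rewrite lerMn2r h1 orbT.
have -> : 1 / 2 *+ l = 1 / 2 * l%:R :> R by rewrite mulr_natr.
rewrite -[L%:R]natr1; move: (l%:R : R) x2; move: x => y z h3 h4.
lra.
Qed.

Lemma expR_log (k : nat) : n%:R ^+ k <= expR (k * L)%:R :> R.
Proof.
have [_ /andP[h _]] := log_bounds; have n0 : 0 < n%:R :> R by rewrite ltr0n ltnW.
by rewrite -(lnK n0) -expRM_natl ler_expR natrM ler_wpM2l.
Qed.

(** [72 = 8 * 9] turns the tail into at most [n ^ -9], while [8 * N ^ 3 <= n ^ 9] because
    [8 <= n ^ 3] and [N <= n ^ 2]. *)
Lemma deviation_small (N : nat) : (N <= n * n)%N ->
  2 * expR (- ((72 * L)%:R / 8)) * (N%:R * N.+1%:R) <= (2 * N%:R)^-1 :> R.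
Proof.
move=> hN; case: (posnP N) => [->|N0]; first by rewrite mul0r !mulr0 invr0.
have -> : (72 * L)%:R / 8 = (9 * L)%:R :> R by rewrite !natrM; field.
have hE := expR_log 9.
have h : (8 * N ^ 3 <= n ^ 9)%N.
  rewrite (_ : 9 = 3 + 6)%N // expnD leq_mul //; first by rewrite (@leq_exp2r 2 _ 3).
  by rewrite (_ : 6 = 2 * 3)%N // expnM leq_exp2r // -mulnn.
have {}hE : 8 * N%:R ^+ 3 <= expR (9 * L)%:R :> R.
  by apply: le_trans hE; rewrite -!natrX -natrM ler_nat.
rewrite expRN -[leRHS]mul1r ler_pdivlMr ?mulr_gt0 ?ltr0n //.
rewrite -!mulrA mulrCA ler_pdivrMl ?expR_gt0 // mulr1; apply: le_trans hE.
have h2 : N.+1%:R <= 2 * N%:R :> R by rewrite -natrM ler_nat; move: N0; clear; lia.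
have N1 : 0 <= N%:R ^+ 2 :> R by rewrite exprn_ge0.
have := ler_wpM2l N1 h2; rewrite !exprS expr0; move: N%:R N.+1%:R => a c; nra.
Qed.

(** [T / (288 * L)] equals [B * L / 288], at least [(8 + p) * ln n]. The part 8 of this exponent
    absorbs [4 * N ^ 3 <= n ^ 8], and [p] remains. *)
Lemma failure_small (p : R) (N : nat) : (N <= n * n)%N -> 288 * (8 + p) <= B%:R -> 0 < p ->
  4 * N%:R ^+ 2 * ((1 - (288 * L)%:R^-1) ^+ T * N%:R) <= n%:R `^ (- p) :> R.
Proof.
move=> hN hB p0; have [x2 /andP[xL _]] := log_bounds; have n0 : 0 < n%:R :> R by rewrite ltr0n ltnW.
have h1 : (1 - (288 * L)%:R^-1) ^+ T <= expR (- ((8 + p) * x)) :> R.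
  apply: (@le_trans _ _ (expR (- (288 * L)%:R^-1) ^+ T)).
    rewrite lerXn2r ?nnegrE ?expR_ge0 ?expR_ge1Dx //.
    by rewrite subr_ge0 invf_le1 ?ltr0n // ler1n.
  rewrite -expRM_natl ler_expR mulrN lerN2.
  have L0 : 0 < L%:R :> R by rewrite ltr0n.
  have -> : T%:R * (288 * L)%:R^-1 = B%:R / 288 * L%:R :> R.
    by rewrite !natrM; move: (L%:R : R) (B%:R : R) L0 => y z y0; field; rewrite lt0r_neq0.
  apply: ler_pM => //; [by lra|by lra|by rewrite ler_pdivlMr // mulrC].
have h2 : (4 * N ^ 2 * N <= n ^ 8)%N.
  rewrite -mulnA -expnSr (_ : 8 = 2 + 6)%N // expnD leq_mul //; first by rewrite (@leq_exp2r 2 _ 2).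
  by rewrite (_ : 6 = 2 * 3)%N // expnM leq_exp2r // -mulnn.
apply: (@le_trans _ _ ((4 * N ^ 2 * N)%:R * expR (- ((8 + p) * x)))).
  have -> : (4 * N ^ 2 * N)%:R = 4 * N%:R ^+ 2 * N%:R :> R by rewrite natrM natrM natrX.
  by rewrite [_ ^+ T * _]mulrC mulrA ler_wpM2l // !mulr_ge0 ?exprn_ge0.
apply: (@le_trans _ _ ((n ^ 8)%:R * expR (- ((8 + p) * x)))).
  by rewrite ler_wpM2r ?expR_ge0 // ler_nat.
rewrite natrX -{1}(lnK n0) -expRM_natl -expRD /powR gt_eqF //.
by rewrite ler_expR; lra.
Qed.
End Asymptotics.

(** * Running time and sizes of the networks *)

Section Costs.
Variables (n : nat) (e : rel 'I_n) (l B : nat).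
Hypotheses (n_gt1 : (1 < n)%N) (l_hi : (n < 2 ^ l.+1)%N) (B_gt0 : (0 < B)%N).
Local Notation L := l.+1.
Local Notation T := (B * (L * L))%N.
Local Notation S := (n + size (edges e))%N.

Lemma rounds_ge : (4 <= T)%N /\ (2 * L <= T)%N.
Proof.
have l0 : (0 < l)%N by case: l l_hi => //; rewrite expn1 ltnNge n_gt1.
have h : (2 * L <= L * L)%N by rewrite leq_mul2r ltnS l0 orbT.
have h2 : (L * L <= T)%N by rewrite leq_pmull.
split; last exact: leq_trans h2.
by apply: leq_trans h2; apply: leq_trans h; rewrite (@leq_mul2l 2 2).
Qed.

Lemma word_le : (T + 8 * L + 20 <= 10 * T)%N.
Proof. by have [h1 h2] := rounds_ge; move: h1 h2; move: T => t; clear; lia. Qed.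

(** The [T] rounds, each of order [T * S], account for the factor 24; everything else fits into one
    further unit because [T >= 4]. *)
Lemma main_cost_le : (main_cost e l B <= 25 * (1000 * (S * (T * T))))%N.
Proof.
have [h1 h2] := rounds_ge; have hB : (B <= T)%N by rewrite leq_pmulr.
rewrite /main_cost /round_cost /num_darts; move: n_gt1 hB h1 h2; move: T => t n1 hB h1 h2.
have r1 : (2000 * (n + (size (edges e) + size (edges e)) + 1) * (L + L + t + 8) <= 2000 * (3 * S) * (4 * t))%N.
  by apply: leq_mul; [rewrite leq_mul2l; move: n1|move: h1 h2]; clear; lia.
have r2 : (t * (2000 * (n + (size (edges e) + size (edges e)) + 1) * (L + L + t + 8)) <= 24 * (1000 * (S * (t * t))))%N.
  apply: leq_trans (_ : t * (2000 * (3 * S) * (4 * t)) <= _)%N; first by rewrite leq_mul2l r1 orbT.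
  by clear; lia.
rewrite [(t * _.+1)%N]mulnS; move: r2; move: (t * (2000 * _ * _))%N => y r2.
have s1 : (n <= S)%N by rewrite leq_addr.
have s3 : (S * 16 <= S * (t * t))%N by rewrite leq_mul2l (@leq_mul 4 4) ?orbT.
have s4 : (t * 8 <= S * (t * t))%N.
  by rewrite mulnA [leqRHS]mulnC leq_mul2l; apply/orP; right; apply: (@leq_mul 2 4) => //; apply: leq_trans s1.
move: r2 s3 s4 n1 hB h1 h2; move: (S * (t * t))%N => z; clear; lia.
Qed.

Lemma query_le : (3 * (T + 8 * L + 20) * (4 * num_darts e + 2 * n + 3) <= 390 * (T * S))%N.
Proof.
apply: (@leq_trans (3 * (10 * T) * (13 * S))%N); last by clear; lia.
apply: leq_mul; first by rewrite leq_mul2l word_le.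
by rewrite /num_darts; move: n_gt1; clear; lia.
Qed.
End Costs.

Theorem theorem3p1 (R : realType) (p : R) (p_gt0 : 0 < p) :
  exists (c C K : R) (k : nat) (P : cmd),
    [/\ 0 < c, 0 < C, 0 < K &
    forall (n : nat) (e : rel 'I_n) (phi : R) (O : network -> seq nat) (L : nat),
      (1 < n)%N -> symmetric e -> irreflexive e -> 0 < phi ->
      max_flow_solver O ->
      let polylog : R := K * ln n%:R ^+ k in
      let near_linear : R := polylog * (n + size (edges e))%:R in
      near_linear <= L%:R ->
      (forall w : L.-tuple bool, exists s : state,
        [/\ exec phi O P (init e w) s,
            (size (calls s))%:R <= polylog,
            forall l, l \in calls s -> l%:R <= near_linear,
            (time s)%:R <= near_linear
          & correct_cut e (C * phi * ln n%:R ^+ 2) (output n s)]) /\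
      1 - n%:R `^ (- p) <=
        coin_prob R (fun w : L.-tuple bool => exists2 s : state,
          exec phi O P (init e w) s &
          correct_cut e (C * phi * ln n%:R ^+ 2) (output n s) /\
          correct_expander e (c * phi) (output n s))].
Proof.
(* The least natural number above the requirement of [failure_small]; the program depends on [p]
   through [B] alone. *)
set B := (Num.trunc (288 * (8 + p))).+1.
have B_gt0 : (0 < B)%N by [].
have hB : 288 * (8 + p) <= B%:R by apply/ltW/truncnS_gt.
(* The second constant is [4 ^ 2], from [L <= 4 * ln n]. The bound [T <= B * (4 * ln n) ^ 2], cubed,
   gives [B ^ 3], [4 ^ 6] and the exponent 6. *)
exists (16 * B)%:R^-1, 16, (10 ^+ 9 * (B%:R ^+ 3 * 4 ^+ 6)), 6%N, (main_cmd B).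
split=> //; [by rewrite invr_gt0 ltr0n muln_gt0|by rewrite !mulr_gt0 ?exprn_gt0 // ltr0n|].
move=> n e phi O Lc n_gt1 e_sym e_irr phi_gt0 hO polylog near_linear hLc.
pose l := trunc_log 2 n.
have [l_lo l_hi] : (2 ^ l <= n)%N /\ (n < 2 ^ l.+1)%N by rewrite trunc_log_ltn // trunc_logP // ltnW.
have [x2 /andP[xL Lx]] := log_bounds R n_gt1 l_lo l_hi.
pose S := (n + size (edges e))%N.
set T := (B * (l.+1 * l.+1))%N.
have T1 : (1 <= T)%N by rewrite !muln_gt0 B_gt0.
have S1 : (1 <= S)%N by rewrite addn_gt0 ltnW.
have hpoly : 10 ^+ 9 * T%:R ^+ 3 <= polylog.
  have h3 : T%:R ^+ 3 <= B%:R ^+ 3 * 4 ^+ 6 * ln n%:R ^+ 6 :> R.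
    rewrite /T natrM exprMn -(mulrA (B%:R ^+ 3)) ler_wpM2l ?exprn_ge0 //.
    rewrite natrM -exprMn -expr2 -(exprM _ 2 3) lerXn2r ?nnegrE //.
    by rewrite mulr_ge0 // (le_trans _ x2) // divr_ge0.
  by rewrite /polylog -(mulrA (10 ^+ 9)) ler_wpM2l // exprn_ge0.
have hnear : 10 ^+ 9 * T%:R ^+ 3 * S%:R <= near_linear by rewrite ler_wpM2r.
have T1R : 1 <= T%:R :> R by rewrite ler1n.
have S1R : 1 <= S%:R :> R by rewrite ler1n.
have T3 : T%:R <= T%:R ^+ 3 :> R by rewrite exprS ler_peMr // exprn_ege1.
have bigTS : 10 ^+ 9 * (T%:R * S%:R) <= near_linear.
  by apply: le_trans hnear; rewrite -(mulrA (10 ^+ 9)) ler_wpM2l ?exprn_ge0 // ler_wpM2r.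
have e9 : 10 ^+ 9 = 1000 * (1000 * 1000) :> R by rewrite -[9%N]/(3 + (3 + 3))%N !exprD -natrX.
have T0 : 0 <= T%:R * S%:R :> R by rewrite mulr_ge0.
have upto_TS (k c : nat) : (k <= c * (T * S))%N -> (c <= 1000)%N -> k%:R <= near_linear.
  move=> h1 h2; apply: le_trans bigTS; apply: (@le_trans _ _ (c * (T * S))%:R); first by rewrite ler_nat.
  rewrite natrM natrM ler_wpM2r //; apply: (@le_trans _ _ 1000); first by rewrite ler_nat.
  by rewrite e9; lra.
have hcoins : (T * num_darts e <= Lc)%N.
  rewrite -(ler_nat R); apply: le_trans hLc; apply: (upto_TS _ 2) => //.
  by rewrite mulnCA leq_mul2l /S /num_darts; apply/orP; right; clear; lia.
have hN := num_darts_lt e.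
have hs := deviation_small R n_gt1 l_lo l_hi hN.
have [F [hF1 hF2]] := @main_triple R phi O n e l B n_gt1 e_sym e_irr phi_gt0 hO B_gt0 l_lo l_hi Lc hcoins hs.
have hcut (A : answer n) : correct_cut e ((l.+1 * l.+1)%:R * phi) A -> correct_cut e (16 * phi * ln n%:R ^+ 2) A.
  case: A => //= U [h1 h2]; split=> //; apply: le_trans h2 _.
  rewrite mulrAC ler_wpM2r ?(ltW phi_gt0) // natrM -expr2 (_ : 16 * _ = (4 * ln n%:R) ^+ 2); last by ring.
  by rewrite lerXn2r ?nnegrE // (le_trans _ Lx).
have run (w : seq bool) : size w = Lc -> exists s : state,
    [/\ exec phi O (main_cmd B) (init e w) s, (size (calls s))%:R <= polylog,
       forall k, k \in calls s -> k%:R <= near_linear, (time s)%:R <= near_linear &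
       correct_cut e (16 * phi * ln n%:R ^+ 2) (output n s) /\
       (4 * (num_darts e)%:R ^+ 2 * F w <= 1 -> correct_expander e ((16 * B)%:R^-1 * phi) (output n s))].
  move=> hw; have [_ [w1 [w2 [-> h]]]] := hF1 w hw.
  have [m' [ls [k0 [_ ht [q1 q2 q3 q4] he]]]] := h (input_bounded e B n_gt1 l_hi).
  exists (State m' w2 (0 + k0) ([::] ++ ls)); split=> /=.
  - exact: he.
  - apply: le_trans hpoly; apply: (@le_trans _ _ (2 * T)%:R); first by rewrite ler_nat.
    by rewrite natrM ler_pM // e9; lra.
  - by move=> k /q2 hk; apply: (upto_TS _ 390) => //; apply: leq_trans hk _; exact: query_le.
  - rewrite add0n; apply: le_trans hnear.
    apply: (@le_trans _ _ (25 * (1000 * (S * (T * T))) * (4000 * (10 * T)))%:R).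
      rewrite ler_nat; apply: leq_trans ht _; apply: leq_mul; first exact: main_cost_le.
      by rewrite leq_mul2l (word_le n_gt1 l_hi B_gt0).
    have cast (a c d f s t : nat) : (a * (c * (s * (t * t))) * (d * (f * t)))%:R =
        a%:R * c%:R * d%:R * f%:R * t%:R ^+ 3 * s%:R :> R by rewrite !natrM; ring.
    by rewrite cast e9 (_ : 25 * 1000 * 4000 * 10 = 1000 * (1000 * 1000)) //; ring.
  - by split; [exact: hcut|move=> /q4; rewrite mulrC].
split.
  move=> w; have [s [h1 h2 h3 h4 [h5 _]]] := run w (size_tuple w).
  by exists s.
pose E (w : seq bool) := exists2 s : state, exec phi O (main_cmd B) (init e w) s &
  correct_cut e (16 * phi * ln n%:R ^+ 2) (output n s) /\
  correct_expander e ((16 * B)%:R^-1 * phi) (output n s).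
rewrite (coin_prob_Ex R Lc E).
(* Markov's inequality: the indicator of success is at least [1 - 4 N ^ 2 F w], by correctness of
   the run when [4 N ^ 2 F w <= 1] and trivially otherwise. *)
have hE : Ex Lc (fun w => 1 - 4 * (num_darts e)%:R ^+ 2 * F w) <= Ex Lc (fun w => (`[< E w >])%:R).
  apply: Ex_le => w hw; have [F0 _] := hF1 w hw; have [s [h1 _ _ _ [h2 h3]]] := run w hw.
  case: (lerP (4 * (num_darts e)%:R ^+ 2 * F w) 1) => hf; last first.
    by apply: (@le_trans _ _ 0); [rewrite subr_le0 ltW|].
  have -> : `[< E w >] by apply/asboolP; exists s => //; split=> //; exact: h3.
  by rewrite gerBl // !mulr_ge0 ?exprn_ge0.
apply: le_trans hE.
have -> : Ex Lc (fun w => 1 - 4 * (num_darts e)%:R ^+ 2 * F w) = 1 - 4 * (num_darts e)%:R ^+ 2 * Ex Lc F.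
  rewrite -mulNr -[X in X + _](Ex_cst Lc) -ExZ -ExD; apply: eq_Ex => w _; by rewrite mulNr.
rewrite lerD2l lerN2; apply: le_trans (failure_small n_gt1 l_lo l_hi hN hB p_gt0).
by rewrite ler_wpM2l // mulr_ge0 ?exprn_ge0.
Qed.
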